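(* Let $p,q,r\in[0,1]$ with $p+q+r=1$ and $0<r<1$, let $s\in[0,1]$, and let $(S_n)$ be the elephant random walk with stops (ERWS) with parameters $p,q,r,s$, with number of ones $\Sigma_n=\sum_{k=1}^nX_k^2$. Assume the critical regime $\frac{p}{1-r}=\frac34$. Then $$\limsup_{n\to\infty}\frac{S_n}{\sqrt{2\Sigma_n\log\Sigma_n\log\log\log\Sigma_n}}=-\liminf_{n\to\infty}\frac{S_n}{\sqrt{2\Sigma_n\log\Sigma_n\log\log\log\Sigma_n}}=1\qquad\text{almost surely},$$ leading to $$\limsup_{n\to\infty}\frac{S_n^2}{2\Sigma_n\log\Sigma_n\log\log\log\Sigma_n}=1\qquad\text{almost surely}.$$ Moreover, $$\limsup_{n\to\infty}\frac{S_n}{\sqrt{2n^{1-r}\log n\log\log\log n}}=-\liminf_{n\to\infty}\frac{S_n}{\sqrt{2n^{1-r}\log n\log\log\log n}}=\sqrt{(1-r)\Sigma}\qquad\text{almost surely},$$ implying that $$\limsup_{n\to\infty}\frac{S_n^2}{2n^{1-r}\log n\log\log\log n}=(1-r)\Sigma\qquad\text{almost surely},$$ where $\Sigma$ is the almost sure limit $\Sigma=\lim_{n\to\infty}n^{-(1-r)}\Sigma_n$.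
   Context: The elephant random walk with stops (ERWS) is defined as follows. The parameters are $p,q,r\in[0,1]$ with $p+q+r=1$, where $0<r<1$ is assumed throughout, and $s\in[0,1]$. The first step $X_1$ equals $+1$ with probability $s$ and $-1$ with probability $1-s$. For each $n\ge 1$, given $X_1,\dots,X_n$, an integer $k$ is chosen uniformly at random in $\{1,\dots,n\}$ and, independently of this choice and of the past, $X_{n+1}=X_k$ with probability $p$, $X_{n+1}=-X_k$ with probability $q$, and $X_{n+1}=0$ with probability $r$. The position of the ERWS is $S_0=0$ and $S_n=\sum_{k=1}^n X_k$ for $n\ge1$. The number of ones up to time $n$ is $\Sigma_n=\sum_{k=1}^n X_k^2$. The sequence $n^{-(1-r)}\Sigma_n$ converges almost surely to a random variable $\Sigma$ which is positive with probability one and has a Mittag-Leffler distribution with parameter $1-r$, i.e. $\mathbb{E}[\Sigma^m]=\frac{m!}{\Gamma(1+m(1-r))}$ for all integers $m\ge1$ (these moments characterize the distribution). In particular $\Sigma_n\to\infty$ almost surely, so the iterated logarithms are well defined and positive for all $n$ large enough. *)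

(* Defs.v *)
From HB Require Import structures.
From mathcomp Require Import all_boot all_order all_algebra.
From mathcomp Require Import all_classical all_reals all_analysis.

Set Implicit Arguments.
Unset Strict Implicit.
Unset Printing Implicit Defensive.

Import Order.TTheory GRing.Theory Num.Theory.
Import numFieldNormedType.Exports.

Local Open Scope classical_set_scope.
Local Open Scope ring_scope.

(* Law of the multiplier applied to the remembered step: the step is repeated
   (1), reversed (-1) or replaced by a stop (0). *)
Definition mult_law (R : realType) (p q r e : R) : R :=
  if e == 1 then p else if e == -1 then q else if e == 0 then r else 0.

(* [X n] is the n-th step, n >= 1 ([X 0] is unused).  For n >= 1, [K n] is the
   instant remembered at time n and [E n] the multiplier applied to [X (K n)].
   [erws_choice] says that, given X_1, ..., X_n, [K n] is uniform on {1, ..., n}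
   and [E n] has law [mult_law], independently of [K n] and of the past; the
   steps being discrete, the past is described by its atoms {X_i = x_i, i <= n}. *)
Record is_ERWS (d : measure_display) (T : measurableType d) (R : realType)
    (P : probability T R) (p q r s : R) (X : nat -> {RV P >-> R})
    (K : nat -> {RV P >-> nat}) (E : nat -> {RV P >-> R}) : Prop := {
  erws_first_up : P [set w | X 1%N w = 1] = s%:E ;
  erws_first_down : P [set w | X 1%N w = -1] = (1 - s)%:E ;
  erws_choice : forall (n : nat) (x : nat -> R) (j : nat) (e : R),
    (1 <= j <= n)%N ->
    P [set w | [/\ forall i, (1 <= i <= n)%N -> X i w = x i,
                   K n w = j & E n w = e]] =
    (P [set w | forall i, (1 <= i <= n)%N -> X i w = x i]
       * (n%:R^-1 * mult_law p q r e)%:E)%E ;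
  erws_step : forall n : nat, (1 <= n)%N ->
    {ae P, forall w, X n.+1 w = E n w * X (K n w) w}
}.

Section Walk.
Context {T : Type} {R : realType} (X : nat -> T -> R).

Definition position (n : nat) (w : T) : R := \sum_(1 <= k < n.+1) X k w.

Definition number_of_ones (n : nat) (w : T) : R :=
  \sum_(1 <= k < n.+1) X k w ^+ 2.

Definition scaled_ones (r : R) (w : T) (n : nat) : R :=
  n%:R `^ (- (1 - r)) * number_of_ones n w.

Definition ones_limit (r : R) (w : T) : R := limn (scaled_ones r w).

End Walk.

(* The scale 2 v log(x) log(log(log(x))); [ln] is 0 on nonpositive reals, which
   only matters for small x. *)
Definition critical_scale {R : realType} (v x : R) : R :=
  2 * v * ln x * ln (ln (ln x)).

(* Main.v *)
Require Import Defs.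
From HB Require Import structures.
From mathcomp Require Import all_boot all_order all_algebra.
From mathcomp Require Import all_classical all_reals all_analysis.
From mathcomp Require Import ring lra zify.

Set Implicit Arguments.
Unset Strict Implicit.
Unset Printing Implicit Defensive.

Import Order.TTheory GRing.Theory Num.Theory.
Import numFieldNormedType.Exports.

Local Open Scope classical_set_scope.
Local Open Scope ring_scope.

(** Only the nonzero steps move the walk. In the critical regime, where
    [p = 3 / 4 * (1 - r)] and [q = (1 - r) / 4], a nonzero step is 1 with
    conditional probability [1 / 2 + S / (4 * N)] given the past, where [N] is
    the number of ones and [S] the position. Read along its nonzero steps, the
    walk is therefore the critical elephant random walk without stops, whatever
    the times of these steps, and the position is a function of the list of the
    signs seen so far. The operator [next_mean] averages over the next sign, and
    a function of the signs that is superharmonic for it gives a supermartingale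
    along the walk with stops ([hist_mean_signs]). The probability space enters
    only through the law of a step, which bounds the probabilities of the finite
    histories ([prob_hist_le]), and through Doob's maximal inequality
    ([doob_maximal], [doob_signs]).

    For the walk of signs, [mart], which is [norming N * S] with [norming N] of
    order [1 / Num.sqrt N], is a martingale with bounded increments whose
    quadratic variation is close to [clock N], itself close to [ln N]. On the
    scale of this clock its increments are exponentially small, so that it obeys
    the law of the iterated logarithm with scale
    [Num.sqrt (2 * b * ln (ln b))], [b] being the clock: the factor [ln N] and the
    triple logarithm of the theorem come from there.

    The upper half ([mart_upper_ae]) combines exponential supermartingales, the
    maximal inequality and the Borel-Cantelli lemma. For the lower half
    ([mart_lower_ae]), time is cut into blocks between the levels
    [2 ^ (rho ^ k)], along which the clock grows geometrically. Matching upper and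
    lower bounds on Laplace transforms ([laplace_upper], [laplace_lower]) show
    that, given the past, the increment over the block number [k] is almost as large
    as allowed with probability at least of order [1 / k] ([walk_deviation],
    [block_success]). The product of the probabilities of failure vanishes, hence
    infinitely many blocks succeed, and by the upper half the value at the
    beginning of a block is comparatively small when [rho] is large.

    The number of ones, divided by its growth factor [ones_norm], is a martingale
    whose later oscillations are controlled by [ones_spread_super], so it
    converges ([ones_mart_cvg_ae]); it is unbounded because the mean of its
    inverse tends to 0 ([ones_unbounded_ae]). The random scale is then replaced
    by the deterministic one: when the limit is positive, the logarithm of the
    number of ones is equivalent to [(1 - r) * ln n] and the further logarithms to
    those of [n], while a zero limit makes the ratio of the scales vanish
    ([critical_scale_ratio]). *)

(** * Exponential and logarithmic estimates *)

Section Exponential.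
Context {R : realType}.
Implicit Types (x t m : R) (n k : nat).

Lemma expR_taylor2 x : `|x| <= 1 -> `|expR x - (1 + x + x ^+ 2 / 2)| <= `|x| ^+ 3.
Proof.
move=> x1.
have cvgx : series (exp_coeff x) n @[n --> \oo] --> expR x.
  by apply: is_cvg_series_exp_coeff.
have {}cvgx : `|series (exp_coeff x) n - (1 + x + x ^+ 2 / 2)| @[n --> \oo]
    --> `|expR x - (1 + x + x ^+ 2 / 2)|.
  by apply: cvg_norm; apply: cvgB => //; exact: cvg_cst.
have fact_ge n : (2 ^ n.+1 <= n.+2`!)%N.
  by elim: n => // n ih; rewrite factS expnS leq_mul.
have bnd n : `|series (exp_coeff x) n.+3 - (1 + x + x ^+ 2 / 2)|
    <= `|x| ^+ 3 * (1 - 2^-1 ^+ n).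
  elim: n => [|n ih].
    rewrite seriesEord /= !big_ord_recr big_ord0 /= /exp_coeff /= !fact0 factS.
    rewrite (_ : _ - _ = 0) ?normr0 ?subrr ?mulr0 //.
    by rewrite !factS fact0 expr0 expr1; field.
  have -> : series (exp_coeff x) n.+4 = series (exp_coeff x) n.+3 + exp_coeff x n.+3.
    by rewrite /series /= big_nat_recr.
  rewrite addrAC (le_trans (ler_normD _ _))// (le_trans (lerD ih (lexx _)))//.
  rewrite [2^-1 ^+ n.+1]exprS.
  suff : `|exp_coeff x n.+3| <= `|x| ^+ 3 * (2^-1 ^+ n * 2^-1).
    by move: (2^-1 ^+ n) (`|x| ^+ 3) `|exp_coeff x n.+3| => h c e; lra.
  rewrite /exp_coeff /= normrM normrX normfV.
  rewrite (ger0_norm (ler0n _ _)) -addn3 exprD mulrAC mulrC.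
  rewrite ler_wpM2l ?exprn_ge0//.
  apply: (@le_trans _ _ (1 * (n + 3)`!%:R^-1)).
    by rewrite ler_wpM2r ?invr_ge0// exprn_ile1.
  rewrite mul1r -exprSr exprVn lef_pV2 ?posrE ?exprn_gt0 ?ltr0n ?fact_gt0//.
  rewrite -natrX ler_nat addn3 (leq_trans (fact_ge n)) // [leqRHS]factS.
  by rewrite leq_pmull.
apply: (cvgr_to_le cvgx).
near=> n.
have n3 : (3 <= n)%N by near: n; exact: nbhs_infty_ge.
rewrite -(subnK n3) addn3 (le_trans (bnd _))// ler_piMr ?exprn_ge0//.
Unshelve. all: by end_near. Qed.

Lemma ln_increment_le n : (0 < n)%N -> ln n.+1%:R - ln n%:R <= n%:R^-1 :> R.
Proof.
move=> n0; have n0' : 0 < n%:R :> R by rewrite ltr0n.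
rewrite -ln_div ?posrE ?ltr0n// -natr1 mulrDl divff ?gt_eqF// mul1r.
by apply: le_ln1Dx; rewrite (lt_trans (ltrN10 _))// invr_gt0.
Qed.

Lemma ln_increment_ge n : (0 < n)%N -> n.+1%:R^-1 <= ln n.+1%:R - ln n%:R :> R.
Proof.
move=> n0; rewrite -opprB -ln_div ?posrE ?ltr0n// lerNr.
have -> : n%:R / n.+1%:R = 1 - n.+1%:R^-1 :> R.
  by rewrite -[n.+1%:R]natr1; field; rewrite gt_eqF// natr1 ltr0n.
by apply: le_ln1Dx; rewrite ltrN2 invf_lt1 ?ltr1n// ltr0n.
Qed.

Lemma invS_le (e : R) : 0 < e -> exists k, k.+1%:R^-1 <= e.
Proof.
move=> e0; exists (Num.truncn e^-1); rewrite invf_ple ?posrE//.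
by rewrite ltW// real_truncnS_gt// num_real.
Qed.

Lemma ln_natr_ge (A : R) : exists n0, forall n, (n0 <= n)%N -> A <= ln n%:R.
Proof.
exists (Num.truncn (expR A)).+1 => n hn.
have h : expR A < n%:R.
  by apply: lt_le_trans (real_truncnS_gt (num_real _)) _; rewrite ler_nat.
by rewrite -[A]expRK ler_ln ?posrE ?expR_gt0 ?ltW// (lt_trans (expR_gt0 A)).
Qed.

(** The Laplace transform of [X - m], for a sign [X] of mean [m]. *)
Definition sign_laplace t m : R :=
  (1 + m) / 2 * expR (t * (1 - m)) + (1 - m) / 2 * expR (t * (- 1 - m)).

(** [X - m] has mean 0 and variance [1 - m ^+ 2], and it is at most 3/2 in
    absolute value: the cubic remainder of the exponential is enough. *)
Lemma sign_laplace_taylor t m : `|m| <= 1 / 2 -> `|t| <= 1 / 2 ->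
  `|sign_laplace t m - (1 + t ^+ 2 / 2 * (1 - m ^+ 2))| <= 4 * `|t| ^+ 3.
Proof.
move=> hm ht.
have hm' := hm; rewrite ler_norml in hm'; case/andP: hm' => m1 m2.
have bnd z : `|z| <= 3 / 2 ->
    `|expR (t * z) - (1 + t * z + (t * z) ^+ 2 / 2)| <= 4 * `|t| ^+ 3.
  move=> hz.
  have htz : `|t * z| <= 1.
    rewrite normrM (le_trans (ler_pM _ _ ht hz))//; lra.
  rewrite (le_trans (expR_taylor2 htz))// normrM exprMn mulrC.
  rewrite ler_wpM2r ?exprn_ge0//.
  rewrite (@le_trans _ _ ((3 / 2) ^+ 3))//; last by lra.
  by rewrite lerXn2r ?nnegrE//; lra.
have b1 : `|1 - m| <= 3 / 2 by rewrite ler_norml; lra.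
have b2 : `|-1 - m| <= 3 / 2 by rewrite ler_norml; lra.
have := bnd _ b1; have := bnd _ b2; rewrite !ler_norml /sign_laplace.
set e1 := expR _; set e2 := expR _; set c := 4 * _ => /andP[h1 h2] /andP[h3 h4].
have -> : (1 + m) / 2 * e2 + (1 - m) / 2 * e1 - (1 + t ^+ 2 / 2 * (1 - m ^+ 2))
  = (1 + m) / 2 * (e2 - (1 + t * (1 - m) + (t * (1 - m)) ^+ 2 / 2)) +
    (1 - m) / 2 * (e1 - (1 + t * (-1 - m) + (t * (-1 - m)) ^+ 2 / 2)).
  by field.
have p1 : 0 <= (1 + m) / 2 by lra.
have p2 : 0 <= (1 - m) / 2 by lra.
have := ler_wpM2l p1 h4; have := ler_wpM2l p1 h3.
have := ler_wpM2l p2 h2; have := ler_wpM2l p2 h1.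
move=> *; apply/andP; split; lra.
Qed.

(** For small [t] the transform is Gaussian up to a factor [1 + e] in the
    variance; from below this also needs the drift [m] to be small, because the
    variance is [1 - m ^+ 2]. *)
Lemma sign_laplace_le e t m : 0 < e -> e <= 1 -> `|m| <= 1 / 2 -> `|t| <= e / 8 ->
  sign_laplace t m <= expR ((1 + e) * (t ^+ 2 / 2)).
Proof.
move=> e0 e1 hm ht.
have ht2 : `|t| <= 1 / 2 by lra.
have := sign_laplace_taylor hm ht2; rewrite ler_norml => /andP[_ h].
apply: le_trans (expR_ge1Dx _).
have t2 : t ^+ 2 = `|t| ^+ 2 by rewrite real_normK// num_real.
rewrite t2 in h *.
have := sqr_ge0 m; have : 0 <= `|t| by []; move: `|t| ht h => u; nra.
Qed.

Lemma sign_laplace_ge e t m : 0 < e -> e <= 1 -> `|m| <= 1 / 2 ->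
  m ^+ 2 <= e / 4 -> `|t| <= e / 32 ->
  expR ((1 - e) * (t ^+ 2 / 2)) <= sign_laplace t m.
Proof.
move=> e0 e1 hm hm2 ht.
have ht2 : `|t| <= 1 / 2 by lra.
have := sign_laplace_taylor hm ht2; rewrite ler_norml => /andP[h _].
have t2 : t ^+ 2 = `|t| ^+ 2 by rewrite real_normK// num_real.
rewrite t2 in h *.
have : 0 <= `|t| by []; move: `|t| ht ht2 h => u ht ht2 h u0.
pose y := u ^+ 2 / 2 * (1 - e / 2).
have y0 : 0 <= y by rewrite /y; nra.
apply: (@le_trans _ _ (1 + y)); last by rewrite /y; nra.
have hy : 0 < 1 + y by lra.
apply: (@le_trans _ _ (expR (y / (1 + y)))).
  rewrite ler_expR ler_pdivlMr// /y.
  have -> : (1 - e) * (u ^+ 2 / 2) * (1 + u ^+ 2 / 2 * (1 - e / 2)) =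
     (u ^+ 2 / 2) * ((1 - e) * (1 + u ^+ 2 / 2 * (1 - e / 2))) by ring.
  rewrite ler_wpM2l//; first by nra.
  nra.
have := expR_ge1Dx (- (y / (1 + y))).
rewrite expRN (_ : 1 - _ = (1 + y)^-1); last by field; rewrite gt_eqF.
by rewrite lef_pV2 ?posrE ?expR_gt0.
Qed.

End Exponential.

(** * Norming constants and the clock of the martingale *)

Section Normalization.
Context {R : realType}.
Implicit Types N : nat.

(** The expected position of the critical walk is multiplied by
    [1 + 1 / (2 * k)] when it makes its step number [k.+1]; this is the product
    of the inverses of these factors. *)
Definition wallis N : R := \prod_(1 <= k < N) (2 * k%:R / (2 * k%:R + 1)).

Lemma wallis_gt0 N : 0 < wallis N.
Proof.
rewrite /wallis big_nat; apply: prodr_gt0 => k /andP[k1 _].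
have k0 : 0 < k%:R :> R by rewrite ltr0n.
by rewrite divr_gt0//; lra.
Qed.

Lemma wallisS N : (0 < N)%N -> wallis N.+1 * (2 * N%:R + 1) = wallis N * (2 * N%:R).
Proof.
move=> N0; rewrite /wallis big_nat_recr//=.
by field; rewrite gt_eqF//; have := ler0n R N; lra.
Qed.

Let up N : R := N.+1%:R * wallis N.+1 ^+ 2.
Let low N : R := (N.+1%:R - 4^-1) * wallis N.+1 ^+ 2.

(** The two monotone quantities [up] and [low] squeeze [wallis N ^+ 2] between
    multiples of [N^-1] and [(N - 1/4)^-1] with the same constant, which gives
    the sharp bounds on [norming] without Stirling's formula. *)
Let up_decr : nonincreasing_seq up.
Proof.
apply/nonincreasing_seqP => N; rewrite /up.
have := @wallisS N.+1 isT; have := wallis_gt0 N.+2; have := wallis_gt0 N.+1.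
rewrite -[N.+2%:R]natr1.
move: (wallis N.+1) (wallis N.+2) => x y x0 y0 h.
have n1 : 1 <= N.+1%:R :> R by rewrite ler1n.
move: N.+1%:R n1 h => n n1 h.
have -> : x = y * (2 * n + 1) / (2 * n) by rewrite h mulfK// gt_eqF//; lra.
have -> : n * (y * (2 * n + 1) / (2 * n)) ^+ 2 = y ^+ 2 * ((2 * n + 1) ^+ 2 / (4 * n)).
  by field; rewrite gt_eqF//; lra.
by rewrite mulrC ler_wpM2l ?sqr_ge0// ler_pdivlMr; nra.
Qed.

Let low_incr : nondecreasing_seq low.
Proof.
apply/nondecreasing_seqP => N; rewrite /low.
have := @wallisS N.+1 isT; have := wallis_gt0 N.+2; have := wallis_gt0 N.+1.
rewrite -[N.+2%:R]natr1.
move: (wallis N.+1) (wallis N.+2) => x y x0 y0 h.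
have n1 : 1 <= N.+1%:R :> R by rewrite ler1n.
move: N.+1%:R n1 h => n n1 h.
have -> : x = y * (2 * n + 1) / (2 * n) by rewrite h mulfK// gt_eqF//; lra.
have -> : (n - 4^-1) * (y * (2 * n + 1) / (2 * n)) ^+ 2 =
    y ^+ 2 * ((n - 4^-1) * (2 * n + 1) ^+ 2 / (4 * n ^+ 2)).
  by field; rewrite gt_eqF//; lra.
rewrite [leRHS]mulrC ler_wpM2l ?sqr_ge0// ler_pdivrMr; last by nra.
nra.
Qed.

Let low_le_up n m : low n <= up m.
Proof.
apply: (@le_trans _ _ (low (maxn n m))); first by rewrite low_incr// leq_maxl.
apply: (@le_trans _ _ (up (maxn n m))); last by rewrite up_decr// leq_maxr.
by rewrite /low /up ler_wpM2r ?sqr_ge0//; lra.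
Qed.

Let low0 : 0 < low 0.
Proof. by rewrite /low mulr_gt0 ?exprn_gt0 ?wallis_gt0//; lra. Qed.

(** The limit of [N * wallis N ^+ 2]; it is [pi / 4], a value that only
    matters through its positivity. *)
Definition wallis_lim : R := limn up.

Let up_cvg : cvgn up.
Proof.
apply: nonincreasing_is_cvgn => //; exists (low 0) => _ [n _ <-].
exact: low_le_up.
Qed.

Lemma wallis_lim_gt0 : 0 < wallis_lim.
Proof.
by apply: (lt_le_trans low0); apply: limr_ge => //; near=> n; exact: low_le_up.
Unshelve. all: by end_near. Qed.

(** Normalized so that [N%:R * norming N ^+ 2] tends to 1. *)
Definition norming N : R := wallis N / Num.sqrt wallis_lim.

Lemma norming_gt0 N : 0 < norming N.
Proof. by rewrite divr_gt0 ?wallis_gt0 ?sqrtr_gt0 ?wallis_lim_gt0. Qed.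

Lemma normingS N : (0 < N)%N ->
  norming N = norming N.+1 * (1 + (2 * N%:R)^-1).
Proof.
move=> N0; have n0 : 0 < N%:R :> R by rewrite ltr0n.
have := wallisS N0; rewrite /norming; set c := (Num.sqrt _)^-1 => h.
have -> : wallis N = wallis N.+1 * (2 * N%:R + 1) / (2 * N%:R).
  by rewrite h mulfK// gt_eqF//; lra.
by field; rewrite gt_eqF//; lra.
Qed.

Lemma norming_sqr N : norming N ^+ 2 = wallis N ^+ 2 / wallis_lim.
Proof. by rewrite /norming exprMn exprVn sqr_sqrtr ?ltW ?wallis_lim_gt0. Qed.

Lemma norming_sqr_ge N : (0 < N)%N -> N%:R^-1 <= norming N ^+ 2.
Proof.
case: N => // N _; rewrite norming_sqr ler_pdivlMr ?wallis_lim_gt0//.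
rewrite mulrC ler_pdivrMr ?ltr0n//.
have := nonincreasing_cvgn_ge up_decr up_cvg N.
by rewrite /wallis_lim /up mulrC.
Qed.

Lemma norming_sqr_le N : (0 < N)%N -> norming N ^+ 2 <= (N%:R - 4^-1)^-1.
Proof.
case: N => // N _; have n1 : 1 <= N.+1%:R :> R by rewrite ler1n.
have p : 0 < N.+1%:R - 4^-1 :> R by lra.
rewrite norming_sqr ler_pdivrMr ?wallis_lim_gt0// mulrC ler_pdivlMr//.
rewrite mulrC; apply: limr_ge => //; near=> n; exact: low_le_up.
Unshelve. all: by end_near. Qed.

Lemma norming_le N : (0 < N)%N -> norming N <= 5 / 4.
Proof.
move=> N0; have n1 : 1 <= N%:R :> R by rewrite ler1n.
have := norming_sqr_le N0; have := norming_gt0 N.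
suff : (N%:R - 4^-1)^-1 <= 4 / 3 :> R.
  by nra.
have -> : 4 / 3 = (3 / 4)^-1 :> R by field.
by rewrite lef_pV2 ?posrE; lra.
Qed.

(** Up to the squares of the drifts, the quadratic variation of the
    martingale [mart] introduced below. The sum starts at 2 because the sign
    walk is considered from its first step on. *)
Definition clock N : R := \sum_(2 <= k < N.+1) norming k ^+ 2.

Lemma clock1 : clock 1 = 0.
Proof. by rewrite /clock big_geq. Qed.

Lemma clockS N : (0 < N)%N -> clock N.+1 = clock N + norming N.+1 ^+ 2.
Proof. by move=> N0; rewrite /clock big_nat_recr. Qed.

(** Comparison with the increments of the logarithm; the statements are
    strengthened by [N%:R^-1] for the induction. *)
Lemma clock_ge N : (0 < N)%N -> ln N%:R - 1 <= clock N.
Proof.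
move=> N0; suff : ln N%:R - 1 + N%:R^-1 <= clock N.
  by apply: le_trans; rewrite lerDl invr_ge0.
case: N N0 => // N _; elim: N => [|N ih]; first by rewrite clock1 ln1 invr1; lra.
rewrite clockS//.
apply: le_trans (lerD ih (norming_sqr_ge (ltn0Sn N.+1))).
have := @ln_increment_le R N.+1 isT.
by move: (ln _) (ln _) N.+1%:R^-1 N.+2%:R^-1 => *; lra.
Qed.

Lemma clock_le N : (0 < N)%N -> clock N <= ln N%:R + 1.
Proof.
move=> N0; suff : clock N <= ln N%:R + 1 - N%:R^-1.
  by move=> /le_trans; apply; rewrite gerBl invr_ge0.
case: N N0 => // N _; elim: N => [|N ih]; first by rewrite clock1 ln1 invr1; lra.
rewrite clockS//.
apply: (le_trans (lerD ih (norming_sqr_le (ltn0Sn N.+1)))).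
have := @ln_increment_ge R N.+1 isT.
rewrite -[N.+2%:R]natr1.
have n1 : 1 <= N.+1%:R :> R by rewrite ler1n.
move: N.+1%:R n1 => n n1 h.
have : (n + 1 - 4^-1)^-1 <= n^-1 by rewrite lef_pV2 ?posrE; lra.
lra.
Qed.

End Normalization.

(** * The walk of signs and its exponential martingales *)

Section SignWalk.
Context {R : realType}.
Implicit Types (g h : seq bool) (f : seq bool -> R) (n : nat).

Definition sign_of (b : bool) : R := if b then 1 else -1.

Definition walk g : R := \sum_(b <- g) sign_of b.

Lemma walk_nil : walk [::] = 0.
Proof. exact: big_nil. Qed.

Lemma walk_cons b g : walk (b :: g) = sign_of b + walk g.
Proof. exact: big_cons. Qed.

Lemma walk_le g : `|walk g| <= (size g)%:R.
Proof.
elim: g => [|b g ih]; first by rewrite walk_nil normr0.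
rewrite walk_cons /= -natr1 addrC (le_trans (ler_normD _ _))// lerD//.
by case: b; rewrite /sign_of ?normrN normr1.
Qed.

(** The conditional mean of the next sign: in the critical regime, the sign is
    a copy of a uniformly chosen earlier one with probability 1/2 and a fair
    coin otherwise. Histories list the latest sign first. *)
Definition drift g : R := walk g / (2 * (size g)%:R).

Lemma drift_le g : `|drift g| <= 1 / 2.
Proof.
rewrite /drift normrM normfV (@ger0_norm _ (2 * _)); last by rewrite mulr_ge0.
case: g => [|b g]; first by rewrite walk_nil normr0 mul0r; lra.
have := walk_le (b :: g); set n := (size _)%:R => hn.
have n0 : 0 < n by rewrite ltr0n.
by rewrite ler_pdivrMr; lra.
Qed.

Definition next_mean f g : R :=
  (1 + drift g) / 2 * f (true :: g) + (1 - drift g) / 2 * f (false :: g).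

Lemma drift_probs g : 0 <= (1 + drift g) / 2 /\ 0 <= (1 - drift g) / 2.
Proof. by have := drift_le g; rewrite ler_norml => /andP[? ?]; split; lra. Qed.

Lemma next_mean_le f f' g : (forall b, f (b :: g) <= f' (b :: g)) ->
  next_mean f g <= next_mean f' g.
Proof.
by move=> ff'; have [p1 p2] := drift_probs g; rewrite lerD// ler_wpM2l.
Qed.

Lemma iter_mean_le n f f' g : (forall h, size h = n -> f (h ++ g) <= f' (h ++ g)) ->
  iter n next_mean f g <= iter n next_mean f' g.
Proof.
elim: n g => [|n ih] g ff'; first exact: (ff' [::]).
rewrite !iterS; apply: next_mean_le => b; apply: ih => h hn.
by rewrite -cat_rcons; apply: ff'; rewrite size_rcons hn.
Qed.

Lemma iter_mean_eq n f f' g : (forall h, size h = n -> f (h ++ g) = f' (h ++ g)) ->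
  iter n next_mean f g = iter n next_mean f' g.
Proof.
by move=> ff'; apply/eqP; rewrite eq_le !iter_mean_le// => h hn; rewrite ff'.
Qed.

Lemma iter_meanZ n c f g :
  iter n next_mean (fun h => c * f h) g = c * iter n next_mean f g.
Proof.
elim: n g => // n ih g; rewrite !iterS [LHS]/next_mean !ih /next_mean; ring.
Qed.

Lemma iter_meanD n f f' g :
  iter n next_mean (fun h => f h + f' h) g =
  iter n next_mean f g + iter n next_mean f' g.
Proof.
elim: n g => // n ih g; rewrite !iterS [LHS]/next_mean !ih /next_mean; ring.
Qed.

Lemma iter_mean_cst n c g : iter n next_mean (fun=> c) g = c.
Proof. by elim: n g => // n ih g; rewrite iterS /next_mean !ih; field. Qed.

Lemma iter_mean_ge0 n f g : (forall h, 0 <= f h) -> 0 <= iter n next_mean f g.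
Proof.
by move=> f0; rewrite -(iter_mean_cst n 0 g); apply: iter_mean_le => h _.
Qed.

Lemma iter_mean_super n f g : (0 < size g)%N ->
  (forall h, (0 < size h)%N -> next_mean f h <= f h) -> iter n next_mean f g <= f g.
Proof.
move=> g0 ff; elim: n => // n; rewrite iterSr; apply: le_trans.
by apply: iter_mean_le => h _; apply: ff; rewrite size_cat ltn_addl.
Qed.

(** A martingale for the walk of signs: [norming] compensates the growth of the
    conditional mean of the position. *)
Definition mart g : R := norming (size g) * walk g.

(** The increments are centred signs weighted by [norming]. *)
Lemma mart_cons b g : (0 < size g)%N ->
  mart (b :: g) = mart g + norming (size g).+1 * (sign_of b - drift g).
Proof.
move=> g0; rewrite /mart walk_cons /= (normingS g0) /drift.
by field; rewrite gt_eqF// ltr0n.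
Qed.

Lemma next_mean_expR l g : (0 < size g)%N ->
  next_mean (fun h => expR (l * mart h)) g =
  expR (l * mart g) * sign_laplace (l * norming (size g).+1) (drift g).
Proof.
move=> g0; rewrite /next_mean /sign_laplace !mart_cons// /sign_of.
by rewrite !mulrDr !expRD !mulrA; ring.
Qed.

(** With [c] a little larger than [l ^+ 2 / 2], a supermartingale. *)
Definition exp_mart l c g : R := expR (l * mart g - c * clock (size g)).

Lemma exp_mart_super e l g : 0 < e -> e <= 1 -> `|l| <= e / 10 ->
  (0 < size g)%N ->
  next_mean (exp_mart l ((1 + e) * (l ^+ 2 / 2))) g
  <= exp_mart l ((1 + e) * (l ^+ 2 / 2)) g.
Proof.
move=> e0 e1 hl g0; rewrite /exp_mart; set f := fun h => _.
have -> : next_mean f g = expR (- ((1 + e) * (l ^+ 2 / 2) * clock (size g).+1)) *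
    next_mean (fun h => expR (l * mart h)) g.
  by rewrite /next_mean /f /= !expRD; ring.
rewrite next_mean_expR// clockS//.
have hl8 : `|l * norming (size g).+1| <= e / 8.
  have := @norming_le R (size g).+1 isT; have := @norming_gt0 R (size g).+1.
  rewrite normrM => a0 a1; rewrite (gtr0_norm a0).
  rewrite (le_trans (ler_wpM2r (ltW a0) hl))//; nra.
have := sign_laplace_le e0 e1 (drift_le g) hl8.
set a := norming _; set s := sign_laplace _ _ => hs.
rewrite mulrC -[leLHS]mulrA expRD ler_wpM2l ?expR_ge0//.
apply: (le_trans (ler_wpM2r (expR_ge0 _) hs)).
by rewrite -expRD ler_expR exprMn; lra.
Qed.

Lemma laplace_upper e l n g : 0 < e -> e <= 1 -> `|l| <= e / 10 ->
  (0 < size g)%N ->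
  iter n next_mean (fun h => expR (l * (mart h - mart g))) g
  <= expR ((1 + e) * (l ^+ 2 / 2) * (clock (n + size g) - clock (size g))).
Proof.
move=> e0 e1 hl g0.
pose c := (1 + e) * (l ^+ 2 / 2).
pose f := exp_mart l c.
rewrite (@iter_mean_eq _ _
  (fun h => expR (c * clock (n + size g) - l * mart g) * f h)); last first.
  by move=> h hn; rewrite /f /exp_mart size_cat hn -expRD; congr expR; ring.
rewrite iter_meanZ.
apply: (@le_trans _ _ (expR (c * clock (n + size g) - l * mart g) * f g)).
  rewrite ler_wpM2l ?expR_ge0// iter_mean_super// => h h0.
  exact: exp_mart_super.
by rewrite /f /exp_mart -expRD ler_expR -/c; lra.
Qed.

Lemma clock_mono n N : (0 < N)%N -> clock N <= clock (n + N) :> R.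
Proof.
move=> N0; elim: n => // n ih; rewrite addSn clockS ?addn_gt0 ?N0 ?orbT//.
by rewrite (le_trans ih)// lerDl sqr_ge0.
Qed.

(** The lower Gaussian bound on the Laplace transform holds step by step as long
    as the drift is small. Paths leaving this zone are handled by subtracting a
    multiple [c] of a supermartingale of much larger exponent [L]: where the
    drift is large the martingale is of order [Num.sqrt N] at least, so the
    subtracted term exceeds the main one and the bound is trivial; elsewhere the
    difference is a submartingale. Since [c] can be taken exponentially small in
    [Num.sqrt N], the correction is harmless. *)
Lemma laplace_lower e l L c N n g : 0 < e -> e <= 1 -> `|l| <= e / 40 ->
  L = e / 10 -> (0 < N)%N -> (N <= size g)%N ->
  let C := clock (n + size g) in
  expR (- (L / 2) * Num.sqrt (e * N%:R) + l ^+ 2 / 2 * (C - clock N)) <= c ->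
  expR (l * mart g + (1 - e) * (l ^+ 2 / 2) * (C - clock (size g)))
   - c * (expR ((1 + e) * (L ^+ 2 / 2) * (C - clock (size g)))
          * (expR (L * mart g) + expR (- L * mart g)))
  <= iter n next_mean (fun h => expR (l * mart h)) g.
Proof.
move=> e0 e1 hl hL N0.
have L0 : 0 < L by rewrite hL; lra.
elim: n g => [|n ih] g Ng C hc.
  rewrite /C add0n subrr !mulr0 !addr0 gerBl.
  apply: mulr_ge0; first exact: le_trans (expR_ge0 _) hc.
  by rewrite mulr_ge0 ?expR_ge0// addr_ge0 ?expR_ge0.
have g0 : (0 < size g)%N by exact: leq_trans Ng.
have c0 : 0 <= c by rewrite (le_trans _ hc) ?expR_ge0.
have Cg : 0 <= C - clock (size g) by rewrite subr_ge0 clock_mono.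
have CN : C - clock (size g) <= C - clock N.
  by rewrite lerB// -(subnK Ng) clock_mono.
have [good|bad] := leP (drift g ^+ 2) (e / 4); last first.
  (* the correction term dominates, hence the left-hand side is nonpositive *)
  apply: le_trans (iter_mean_ge0 _ _ (fun=> expR_ge0 _)).
  rewrite subr_le0 -[leLHS]mul1r.
  have n0 : 0 < (size g)%:R :> R by rewrite ltr0n.
  have hZ : Num.sqrt (e * N%:R) <= `|mart g|.
    rewrite -sqrtr_sqr ler_wsqrtr// /mart exprMn.
    have h1 : (size g)%:R^-1 * walk g ^+ 2 <= norming (size g) ^+ 2 * walk g ^+ 2.
      by rewrite ler_wpM2r ?sqr_ge0// norming_sqr_ge.
    apply: le_trans h1; rewrite [leRHS]mulrC ler_pdivlMr//.
    apply: (@le_trans _ _ (e * (size g)%:R ^+ 2)).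
      by rewrite -mulrA expr2 ler_wpM2l ?(ltW e0)// ler_wpM2r ?ler0n ?ler_nat.
    have := ltW bad; rewrite /drift expr_div_n ler_pdivlMr ?exprn_gt0//; last first.
      by rewrite mulr_gt0.
    by rewrite exprMn; lra.
  have h2 : expR (L * `|mart g|) <= expR (L * mart g) + expR (- L * mart g).
    have [p|p] := ger0P (mart g); first by rewrite lerDl expR_ge0.
    by rewrite mulrN mulNr lerDr expR_ge0.
  have h3 : l * mart g <= L / 2 * `|mart g|.
    apply: (@le_trans _ _ (`|l| * `|mart g|)).
      by rewrite -normrM ler_norm.
    by rewrite ler_wpM2r//; rewrite hL; lra.
  rewrite mul1r.
  apply: (@le_trans _ _ (c * (1 * expR (L * `|mart g|)))); last first.
    rewrite ler_wpM2l// ler_pM ?expR_ge0//.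
    rewrite -[leLHS]expR0 ler_expR mulr_ge0// mulr_ge0 ?divr_ge0 ?sqr_ge0//.
    lra.
  rewrite mul1r; apply: le_trans (ler_wpM2r (expR_ge0 _) hc).
  rewrite -expRD ler_expR.
  have hl2 : 0 <= l ^+ 2 / 2 by rewrite divr_ge0 ?sqr_ge0.
  have h4 : (1 - e) * (l ^+ 2 / 2) * (C - clock (size g)) <=
     (l ^+ 2 / 2) * (C - clock N).
    rewrite -mulrA mulrCA ler_wpM2l//.
    by move: (C - clock (size g)) (C - clock N) Cg CN => u v *; nra.
  have h5 : L / 2 * Num.sqrt (e * N%:R) <= L / 2 * `|mart g|.
    by rewrite ler_wpM2l//; lra.
  by move: (Num.sqrt _) (l ^+ 2 / 2 * _) h4 h5 h3 => u v *; lra.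
(* in the good zone the left-hand side is a submartingale *)
rewrite iterS.
pose W h := expR (l * mart h + (1 - e) * (l ^+ 2 / 2) * (C - clock (size h)))
   - c * (expR ((1 + e) * (L ^+ 2 / 2) * (C - clock (size h)))
          * (expR (L * mart h) + expR (- L * mart h))).
rewrite -/(W g); apply: (@le_trans _ _ (next_mean W g)); last first.
  apply: next_mean_le => b; have /= := ih (b :: g).
  by rewrite addnS -addSn; apply => //; rewrite ltnW.
pose a := norming (size g).+1 : R.
have a0 : 0 < a by exact: norming_gt0.
have a1 : a <= 5 / 4 by exact: norming_le.
have nW : next_mean W g =
   expR ((1 - e) * (l ^+ 2 / 2) * (C - clock (size g).+1)) *
     next_mean (fun h => expR (l * mart h)) g -
   c * (expR ((1 + e) * (L ^+ 2 / 2) * (C - clock (size g).+1)) *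
      (next_mean (fun h => expR (L * mart h)) g +
       next_mean (fun h => expR (- L * mart h)) g)).
  by rewrite /next_mean /W /= !(expRD (l * _)); ring.
rewrite nW !next_mean_expR// clockS// -/a.
rewrite /W; apply: lerB.
  have ha : `|l * a| <= e / 32.
    by rewrite normrM (gtr0_norm a0) (le_trans (ler_wpM2r (ltW a0) hl))//; nra.
  have hs := sign_laplace_ge e0 e1 (drift_le g) good ha.
  rewrite [leRHS]mulrCA expRD ler_wpM2l ?expR_ge0//.
  apply: le_trans (ler_wpM2l (expR_ge0 _) hs).
  by rewrite -expRD ler_expR (exprMn _ l); lra.
have ha s : `|s| = L -> `|s * a| <= e / 8.
  move=> sL; rewrite normrM (gtr0_norm a0) sL hL; nra.
have hs1 := sign_laplace_le e0 e1 (drift_le g) (ha L (gtr0_norm L0)).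
have hs2 : sign_laplace (- L * a) (drift g) <= expR ((1 + e) * ((L * a) ^+ 2 / 2)).
  rewrite -sqrrN -mulNr; apply: sign_laplace_le => //; first exact: drift_le.
  by apply: ha; rewrite normrN gtr0_norm.
rewrite ler_wpM2l//.
have hE : expR ((1 + e) * (L ^+ 2 / 2) * (C - (clock (size g) + a ^+ 2))) *
    expR ((1 + e) * ((L * a) ^+ 2 / 2)) =
    expR ((1 + e) * (L ^+ 2 / 2) * (C - clock (size g))).
  by rewrite -expRD; congr expR; ring.
rewrite -hE -[leRHS]mulrA ler_wpM2l ?expR_ge0// [leRHS]mulrDr.
by rewrite lerD// [leRHS]mulrC ler_wpM2l ?expR_ge0.
Qed.

End SignWalk.

(** * Large deviations of the walk of signs from below *)

Section Deviation.
Context {R : realType}.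
Implicit Types (g h : seq bool) (n : nat).

Lemma expRN3_le : expR (- 3) <= 1 / 8 :> R.
Proof.
rewrite expRN div1r lef_pV2 ?posrE ?expR_gt0//.
have h : 2 <= expR 1 :> R by have := expR_ge1Dx (1 : R); lra.
have -> : 3 = 1 + (1 + 1) :> R by lra.
by rewrite !expRD; nra.
Qed.

(** Trading the tilt [l] for [l1] below [y] and for [l2] above [y2] confines the
    Laplace transform to the window between [y] and [y2]. *)
Lemma expR_three_zones (l l1 l2 y y2 D : R) : l1 <= l -> l <= l2 -> 0 <= l ->
  expR (l * D) <= expR ((l - l1) * y) * expR (l1 * D) +
    expR (- ((l2 - l) * y2)) * expR (l2 * D) +
    expR (l * y2) * (y <= D)%R%:R.
Proof.
move=> l1l ll2 l0; rewrite -!expRD.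
have [yD|Dy] := leP y D; last first.
  rewrite mulr0 addr0 (@le_trans _ _ (expR ((l - l1) * y + l1 * D)))//.
    by rewrite ler_expR; nra.
  by rewrite lerDl expR_ge0.
rewrite mulr1.
have [Dy2|y2D] := leP D y2.
  rewrite (@le_trans _ _ (expR (l * y2)))//.
    by rewrite ler_expR ler_wpM2l.
  by rewrite lerDr addr_ge0 ?expR_ge0.
rewrite (@le_trans _ _ (expR (- ((l2 - l) * y2) + l2 * D)))//.
  by rewrite ler_expR; nra.
by rewrite -addrA addrCA lerDl addr_ge0 ?expR_ge0.
Qed.

(** Lower deviation bound, by Cramer's method: at the tilt
    [l = (1 + dl) * y / V], the Laplace transform of the increment is carried by
    increments between [y] and [(1 + 2 * dl) * y]. Indeed, by
    [expR_three_zones] with the tilts [y / V] and [(1 + 2 * dl) * y / V], the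
    contribution of the other increments is smaller by a factor
    [expR (- (dl ^+ 2 * x / 4))], where [x = y ^+ 2 / V]. The value
    [e = dl ^+ 2 / 26] makes the relative errors in the variance negligible
    with respect to this gain. *)
Lemma walk_deviation (dl y s : R) n g (V := clock (n + size g) - clock (size g))
    (e := dl ^+ 2 / 26) :
  0 < dl -> dl <= 1 -> `|s| = 1 -> (0 < size g)%N -> 0 < V -> 0 < y ->
  y / V <= e / 120 -> 12 <= dl ^+ 2 * (y ^+ 2 / V) ->
  expR (- (e / 20) * Num.sqrt (e * (size g)%:R) + 2 * (y ^+ 2 / V)
        + `|mart g| + V) <= 1 / 8 ->
  1 / 2 * expR (- (1 / 2 + 4 * dl) * (y ^+ 2 / V)) <=
  iter n next_mean (fun h => (y <= s * (mart h - mart g))%R%:R) g.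
Proof.
move=> dl0 dl1 s1 g0 V0 y0 yV; set x := y ^+ 2 / V => dlx tiny.
have e0 : 0 < e by rewrite /e; nra.
have e1 : e <= 1 / 26 by rewrite /e; nra.
have {}e1' : e <= 1 by lra.
pose u := y / V; have u0 : 0 < u by rewrite divr_gt0.
have uy : u * y = x by rewrite /u /x; ring.
have uV : u ^+ 2 * V = x by rewrite /u /x; field; rewrite gt_eqF.
have x0 : 0 < x by rewrite -uy mulr_gt0.
rewrite -/u in yV.
pose l := (1 + dl) * u; pose l1 := u; pose l2 := (1 + 2 * dl) * u.
pose y2 := (1 + 2 * dl) * y.
have l0 : 0 <= l by rewrite /l; nra.
have hl : l <= e / 60 by rewrite /l; nra.
have hl2 : l2 <= e / 40 by rewrite /l2; nra.
have l2p : 0 <= l2 by rewrite /l2; nra.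
pose D h := s * (mart h - mart g).
have s2 : s ^+ 2 = 1 by rewrite -real_normK ?num_real// s1 expr1n.
have key : iter n next_mean (fun h => expR (l * D h)) g <=
    expR ((l - l1) * y) * iter n next_mean (fun h => expR (l1 * D h)) g +
    expR (- ((l2 - l) * y2)) * iter n next_mean (fun h => expR (l2 * D h)) g +
    expR (l * y2) * iter n next_mean (fun h => (y <= D h)%R%:R) g.
  rewrite -!iter_meanZ -!iter_meanD; apply: iter_mean_le => h _.
  by apply: expR_three_zones => //; rewrite /l /l1 /l2; nra.
have up t : 0 <= t -> t <= e / 10 ->
    iter n next_mean (fun h => expR (t * D h)) g <=
    expR ((1 + e) * (t ^+ 2 / 2) * V).
  move=> t0 te.
  have hts : `|t * s| <= e / 10 by rewrite normrM s1 mulr1 ger0_norm.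
  have := laplace_upper n e0 e1' hts g0.
  rewrite exprMn s2 mulr1 -/V; apply: le_trans.
  by apply: iter_mean_le => h _; rewrite mulrA.
pose M := expR ((1 - e) * (l ^+ 2 / 2) * V).
have M1 : 1 <= M.
  rewrite -[leLHS]expR0 ler_expR mulr_ge0 ?(ltW V0)// mulr_ge0 ?divr_ge0 ?sqr_ge0//.
  by lra.
have low : M - 1 / 4 <= iter n next_mean (fun h => expR (l * D h)) g.
  have hls : `|l * s| <= e / 40 by rewrite normrM s1 mulr1 ger0_norm//; lra.
  pose c := expR (- (e / 10 / 2) * Num.sqrt (e * (size g)%:R) + l ^+ 2 / 2 * V).
  have hc : expR (- (e / 10 / 2) * Num.sqrt (e * (size g)%:R) +
      (l * s) ^+ 2 / 2 * V) <= c by rewrite exprMn s2 mulr1.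
  have hw := laplace_lower e0 e1' hls erefl g0 (leqnn _) hc.
  rewrite exprMn s2 mulr1 -/V in hw.
  set w := iter n _ _ _ in hw.
  have -> : iter n next_mean (fun h => expR (l * D h)) g =
      expR (- (l * s * mart g)) * w.
    rewrite /w -iter_meanZ; apply: iter_mean_eq => h _.
    by rewrite -expRD /D; congr expR; ring.
  apply: le_trans (ler_wpM2l (expR_ge0 _) hw).
  rewrite mulrBr -expRD addrA addNr add0r lerB// mulrDr mulrDr mulrDr.
  have bnd t : `|t| <= e / 10 ->
      expR (- (l * s * mart g)) * (c * (expR ((1 + e) * ((e / 10) ^+ 2 / 2) * V) *
       expR (t * mart g))) <= 1 / 8.
    move=> ht; rewrite -!expRD (le_trans _ tiny)// ler_expR.
    have a1 : - (l * s * mart g) + t * mart g <= `|mart g|.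
      rewrite -mulNr -mulrDl (le_trans (ler_norm _))// normrM ler_piMl//.
      rewrite (le_trans (ler_normD _ _))// normrN normrM s1 mulr1 ger0_norm//.
      lra.
    have a2 : l ^+ 2 / 2 * V <= 2 * x.
      have -> : l ^+ 2 / 2 * V = (1 + dl) ^+ 2 / 2 * x by rewrite -uV /l; ring.
      by rewrite ler_wpM2r ?(ltW x0)//; nra.
    have a3 : (1 + e) * ((e / 10) ^+ 2 / 2) * V <= V.
      by rewrite ler_piMl ?(ltW V0)//; nra.
    have -> : e / 10 / 2 = e / 20 by field.
    move: a1 a2 a3; rewrite -/x; lra.
  have b1 : `|e / 10| <= e / 10 by rewrite ger0_norm//; lra.
  have b2 : `|- (e / 10)| <= e / 10 by rewrite normrN.
  by have := bnd _ b1; have := bnd _ b2; lra.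
have e3 : expR (- (dl ^+ 2 * x / 4)) <= 1 / 8.
  by rewrite (le_trans _ expRN3_le)// ler_expR; lra.
have zone z : z <= (1 - e) * (l ^+ 2 / 2) * V - dl ^+ 2 * x / 4 -> expR z <= M / 8.
  move=> hz; have : expR z <= M * expR (- (dl ^+ 2 * x / 4)).
    by rewrite -expRD ler_expR.
  by move=> /le_trans; apply; rewrite ler_wpM2l ?expR_ge0//; lra.
have lV : l ^+ 2 / 2 * V = (1 + dl) ^+ 2 / 2 * x by rewrite -uV /l; ring.
have z1 : expR ((l - l1) * y) * iter n next_mean (fun h => expR (l1 * D h)) g <= M / 8.
  apply: (@le_trans _ _ (expR ((l - l1) * y) * expR ((1 + e) * (l1 ^+ 2 / 2) * V))).
    by rewrite ler_wpM2l ?expR_ge0// up// /l1; lra.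
  rewrite -expRD; apply: zone; rewrite -[_ * (l ^+ 2 / 2) * V]mulrA lV.
  have -> : (l - l1) * y = dl * x by rewrite -uy /l /l1; ring.
  have -> : (1 + e) * (l1 ^+ 2 / 2) * V = (1 + e) / 2 * x by rewrite -uV /l1; ring.
  rewrite -subr_ge0.
  have -> : (1 - e) * ((1 + dl) ^+ 2 / 2 * x) - dl ^+ 2 * x / 4 - (dl * x + (1 + e) / 2 * x)
    = x * ((1 - e) * ((1 + dl) ^+ 2 / 2) - dl ^+ 2 / 4 - dl - (1 + e) / 2) by ring.
  by rewrite mulr_ge0 ?(ltW x0)// /e; nra.
have z2 : expR (- ((l2 - l) * y2)) * iter n next_mean (fun h => expR (l2 * D h)) g
    <= M / 8.
  apply: (@le_trans _ _ (expR (- ((l2 - l) * y2)) *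
      expR ((1 + e) * (l2 ^+ 2 / 2) * V))).
    by rewrite ler_wpM2l ?expR_ge0// up//; lra.
  rewrite -expRD; apply: zone; rewrite -[_ * (l ^+ 2 / 2) * V]mulrA lV.
  have -> : (l2 - l) * y2 = dl * (1 + 2 * dl) * x by rewrite -uy /l /l2 /y2; ring.
  have -> : (1 + e) * (l2 ^+ 2 / 2) * V = (1 + e) * (1 + 2 * dl) ^+ 2 / 2 * x.
    by rewrite -uV /l2; ring.
  rewrite -subr_ge0.
  have -> : (1 - e) * ((1 + dl) ^+ 2 / 2 * x) - dl ^+ 2 * x / 4 -
    (- (dl * (1 + 2 * dl) * x) + (1 + e) * (1 + 2 * dl) ^+ 2 / 2 * x)
    = x * (dl ^+ 2 / 4 - e / 2 * ((1 + dl) ^+ 2 + (1 + 2 * dl) ^+ 2)) by field.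
  rewrite mulr_ge0 ?(ltW x0)// /e.
  have -> : dl ^+ 2 / 4 - dl ^+ 2 / 26 / 2 * ((1 + dl) ^+ 2 + (1 + 2 * dl) ^+ 2) =
    dl ^+ 2 * (1 / 4 - ((1 + dl) ^+ 2 + (1 + 2 * dl) ^+ 2) / 52) by field.
  by rewrite mulr_ge0 ?sqr_ge0//; nra.
have fin : M / 2 <= expR (l * y2) * iter n next_mean (fun h => (y <= D h)%R%:R) g.
  by move: low key z1 z2 M1; move: (iter _ _ _ _) (_ * iter _ _ _ _) (_ * iter _ _ _ _) (_ * iter _ _ _ _) => *; lra.
have : M / 2 * expR (- (l * y2)) <= iter n next_mean (fun h => (y <= D h)%R%:R) g.
  by rewrite expRN ler_pdivrMr ?expR_gt0// [leRHS]mulrC.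
apply: le_trans.
have -> : M / 2 * expR (- (l * y2)) = 1 / 2 * (M * expR (- (l * y2))) by ring.
rewrite ler_wpM2l ?divr_ge0// -expRD ler_expR -[_ * (l ^+ 2 / 2) * V]mulrA lV.
have -> : l * y2 = (1 + dl) * (1 + 2 * dl) * x by rewrite -uy /l /y2; ring.
rewrite -subr_ge0.
have -> : (1 - e) * ((1 + dl) ^+ 2 / 2 * x) - (1 + dl) * (1 + 2 * dl) * x -
   - (1 / 2 + 4 * dl) * x = x * (2 * dl - 3 / 2 * dl ^+ 2 - e * (1 + dl) ^+ 2 / 2) by field.
rewrite mulr_ge0 ?(ltW x0)// /e.
have -> : 2 * dl - 3 / 2 * dl ^+ 2 - dl ^+ 2 / 26 * (1 + dl) ^+ 2 / 2 =
  dl * (2 - 3 / 2 * dl - dl * (1 + dl) ^+ 2 / 52) by field.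
have h4 : (1 + dl) ^+ 2 <= 4 by nra.
have h5 : dl * (1 + dl) ^+ 2 <= 4 by have := sqr_ge0 (1 + dl); nra.
by rewrite mulr_ge0 ?(ltW dl0)//; lra.
Qed.

End Deviation.

(** * Histories of the walk with stops *)

Section Histories.
Context {R : realType}.
Implicit Types (h : seq (option bool)) (o : option bool) (n m : nat).
Implicit Type f : seq (option bool) -> R.

(** A history lists the latest step first; [None] is a stop. *)
Definition step_val o : R := if o is Some b then sign_of b else 0.

Definition step_code (x : R) : option bool :=
  if x == 1 then Some true else if x == -1 then Some false else None.

Lemma step_valK : cancel step_val step_code.
Proof.
have n11 : (-1 == 1 :> R) = false by apply/eqP; lra.
move=> [[]|]; rewrite /step_code /= ?eqxx ?n11 ?eqxx//.
by rewrite eq_sym oner_eq0 eq_sym oppr_eq0 oner_eq0.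
Qed.

Definition signs h : seq bool := pmap id h.

Lemma size_signs h : (size (signs h) <= size h)%N.
Proof. by elim: h => // -[b|] h ih //=; rewrite leqW. Qed.

Variables (beta s : R).

(** The conditional law of the next step given the history, for
    [p = 3 / 4 * beta] and [q = beta / 4]. *)
Definition step_kernel h o : R :=
  if h is [::] then (if o is Some b then (if b then s else 1 - s) else 0)
  else let N := (size (signs h))%:R in let n := (size h)%:R in
    if o is Some b then beta * N / n * ((1 + sign_of b * drift (signs h)) / 2)
    else 1 - beta * N / n.

Definition hist_mean f h : R :=
  step_kernel h None * f (None :: h) + step_kernel h (Some true) * f (Some true :: h)
  + step_kernel h (Some false) * f (Some false :: h).

Fixpoint weight h : R := if h is o :: h' then weight h' * step_kernel h' o else 1.

Fixpoint hists n : seq (seq (option bool)) :=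
  if n is n'.+1 then
    flatten [seq [:: None :: h; Some true :: h; Some false :: h] | h <- hists n']
  else [:: [::]].

Lemma mem_hists n h : (h \in hists n) = (size h == n).
Proof.
elim: n h => [|n ih] h; first by rewrite inE size_eq0.
apply/flatten_mapP/idP => [[h' + /=]|].
  by rewrite ih !inE => /eqP <- /or3P[] /eqP -> /=.
case: h => // o h; rewrite /= eqSS -ih => hn; exists h => //.
by case: o => [[]|]; rewrite !inE eqxx ?orbT.
Qed.

Lemma sum_hists n f :
  \sum_(h <- hists n) weight h * f h = iter n hist_mean f [::].
Proof.
elim: n f => [|n ih] f; first by rewrite big_seq1 mul1r.
rewrite iterSr -ih /= big_flatten big_map; apply: eq_bigr => h _.
by rewrite !big_cons big_nil /= /hist_mean; ring.
Qed.

Lemma iter_histZ n c f :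
  iter n hist_mean (fun h => c * f h) [::] =
  c * iter n hist_mean f [::].
Proof. by rewrite -!sum_hists mulr_sumr; apply: eq_bigr => h _; ring. Qed.

Hypothesis beta01 : 0 <= beta <= 1.
Hypothesis s01 : 0 <= s <= 1.

Lemma step_kernel_ge0 h o : 0 <= step_kernel h o.
Proof.
case: h => [|o' h']; rewrite /step_kernel.
  by case: o => [[]|] //; case/andP: s01 => *; lra.
case/andP: beta01 => b0 b1; set h := o' :: h'.
have hN : (size (signs h))%:R <= (size h)%:R :> R by rewrite ler_nat size_signs.
have n0 : 0 <= (size h)%:R :> R by [].
have c0 : 0 <= beta * (size (signs h))%:R / (size h)%:R.
  by rewrite !mulr_ge0 ?invr_ge0.
case: o => [b|].
  have [p1 p2] := @drift_probs R (signs h).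
  by rewrite mulr_ge0//; case: b; rewrite /sign_of ?mul1r ?mulN1r.
have [->|nz] := eqVneq (size h)%:R (0 : R); first by rewrite invr0 mulr0 subr0.
rewrite subr_ge0 ler_pdivrMr ?mul1r ?lt_def ?nz//.
by apply: le_trans hN; rewrite ler_piMl.
Qed.

Lemma weight_ge0 h : 0 <= weight h.
Proof. by elim: h => //= o h ih; rewrite mulr_ge0 ?step_kernel_ge0. Qed.

Lemma hist_mean_le f f' h : (forall o, f (o :: h) <= f' (o :: h)) ->
  hist_mean f h <= hist_mean f' h.
Proof. by move=> ff'; rewrite !lerD// ler_wpM2l ?step_kernel_ge0. Qed.

Lemma step_kernel_sum h : step_kernel h None + step_kernel h (Some true) + step_kernel h (Some false) = 1.
Proof.
case: h => [|o h]; rewrite /step_kernel /sign_of; first by ring.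
by rewrite mul1r mulN1r; move: (beta * _ / _) (drift _) => c m; field.
Qed.

Lemma iter_hist_le n f f' h :
  (forall h', size h' = n -> f (h' ++ h) <= f' (h' ++ h)) ->
  iter n hist_mean f h <= iter n hist_mean f' h.
Proof.
elim: n h => [|n ih] h ff'; first exact: (ff' [::]).
rewrite !iterS; apply: hist_mean_le => o; apply: ih => h' hn.
by rewrite -cat_rcons; apply: ff'; rewrite size_rcons hn.
Qed.

Lemma iter_hist_super m n f : (m <= n)%N ->
  (forall h, (m <= size h)%N -> hist_mean f h <= f h) ->
  iter n hist_mean f [::] <= iter m hist_mean f [::].
Proof.
move=> mn ff; rewrite -(subnK mn); elim: (n - m)%N => // k ih.
apply: le_trans ih; rewrite addSn iterSr; apply: iter_hist_le => h hk.
by apply: ff; rewrite cats0 hk leq_addl.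
Qed.

(** Steps of size zero leave the sign history unchanged, and the other ones
    follow the law of the sign walk: superharmonic functions of the sign
    history are superharmonic for the walk with stops. *)
Lemma hist_mean_signs (F : seq bool -> R) h : (0 < size h)%N ->
  ((0 < size (signs h))%N -> next_mean F (signs h) <= F (signs h)) ->
  hist_mean (F \o signs) h <= F (signs h).
Proof.
case: h => // o h _; rewrite /hist_mean /step_kernel /comp.
rewrite -[signs (None :: _)]/(signs (o :: h)).
rewrite -[signs (Some true :: _)]/(true :: signs (o :: h)).
rewrite -[signs (Some false :: _)]/(false :: signs (o :: h)).
have [->|N0] := posnP (size (signs (o :: h))).
  by rewrite !mulr0 !mul0r subr0 ?mul0r ?addr0 mul1r.
move=> /(_ isT); rewrite /next_mean /sign_of mul1r mulN1r.
set c := beta * _ / _; have c0 : 0 <= c.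
  by case/andP: beta01 => b0 _; rewrite !mulr_ge0 ?invr_ge0.
by move: (drift _) (F (true :: _)) (F (false :: _)) (F (signs _)) => m a b u; nra.
Qed.

Fixpoint hits f m h : bool :=
  ((m <= size h)%N && (1 <= f h)) || (if h is _ :: h' then hits f m h' else false).

Definition stopped f m h : R := if hits f m h then 1 else f h.

(** The maximal inequality, as an inequality between finite sums: once stopped
    when [f] reaches 1, the supermartingale is at least 1 on the histories along
    which this has happened. *)
Lemma stopped_bound f m n : (forall h, 0 <= f h) -> (m <= n)%N ->
  (forall h, (m <= size h)%N -> hist_mean f h <= f h) ->
  \sum_(h <- hists n | hits f m h) weight h <= iter m hist_mean f [::].
Proof.
move=> f0 mn ff.
apply: (@le_trans _ _ (\sum_(h <- hists n) weight h * stopped f m h)).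
  rewrite big_mkcond ler_sum// => h _; rewrite /stopped.
  by case: ifP => _; rewrite ?mulr1// mulr_ge0 ?weight_ge0.
rewrite sum_hists (le_trans (iter_hist_super mn _))//.
  move=> h mh; rewrite {2}/stopped; case: ifPn => hh.
    rewrite -[leRHS](step_kernel_sum h) /hist_mean /stopped.
    by rewrite /hits -/(hits f m) hh !orbT !mulr1.
  apply: le_trans (ff _ mh); apply: hist_mean_le => o.
  rewrite /stopped /hits -/(hits f m) (negbTE hh) orbF.
  by case: ifP => // /andP[].
apply: iter_hist_le => h; rewrite cats0 => hm; rewrite /stopped; case: ifP => //.
suff nh h' : (size h' < m)%N -> hits f m h' = false.
  case: h hm => [<-|o h hm]; first by rewrite /hits orbF.
  rewrite /hits -/(hits f m) nh; last by rewrite -hm.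
  by rewrite orbF => /andP[].
by elim: h' => [|o h' ih] /= hm'; rewrite leqNgt hm' //= ih// ltnW.
Qed.

Lemma hitsP f m h : reflect (exists2 k, (k <= size h - m)%N & (m <= size h)%N /\ 1 <= f (drop k h))
  (hits f m h).
Proof.
clear beta01 s01 beta s.
elim: h => [|o h ih].
  rewrite /hits /= orbF; apply: (iffP andP) => [[m0 f1]|[k _ [m0]]]; last by [].
  by exists 0%N.
rewrite /hits -/(hits f m); apply: (iffP orP).
  move=> [/andP[mh f1]|/ih[k kh [mh f1]]]; first by exists 0%N.
  by exists k.+1; [rewrite /= subSn//|split => //=; rewrite ltnW].
move=> [[|k] kh [mh f1]]; first by left; rewrite mh.
right; apply/ih; exists k; last split => //.
  by move: kh mh => /=; lia.
by move: kh mh => /=; lia.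
Qed.

End Histories.

(** * The law of one step *)

Section Law.
Context (d : measure_display) (T : measurableType d) (R : realType).
Variables (P : probability T R) (p q r s : R).
Variables (X : nat -> {RV P >-> R}) (K : nat -> {RV P >-> nat})
  (E : nat -> {RV P >-> R}).
Hypotheses (hr : 0 < r < 1) (hpqr : p + q + r = 1)
  (hs : 0 <= s <= 1) (hX : is_ERWS p q r s X K E) (hcrit : p / (1 - r) = 3 / 4).
Implicit Types (h : seq (option bool)) (n m : nat) (A B : set T).

Let beta := 1 - r.

Definition prob A : R := fine (P A).

Lemma probE A : measurable A -> P A = (prob A)%:E.
Proof. by move=> mA; rewrite /prob fineK// fin_num_measure. Qed.

Lemma prob_ge0 A : 0 <= prob A.
Proof. by rewrite /prob fine_ge0. Qed.

Lemma prob_le A B : measurable A -> measurable B -> A `<=` B -> prob A <= prob B.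
Proof. by move=> mA mB AB; rewrite -lee_fin -!probE// le_measure ?inE. Qed.

Lemma probU A B : measurable A -> measurable B -> A `&` B = set0 ->
  prob (A `|` B) = prob A + prob B.
Proof.
move=> mA mB AB; apply: EFin_inj; rewrite EFinD -!probE ?measureU//.
exact: measurableU.
Qed.

Lemma prob_subU A B : measurable A -> measurable B ->
  prob (A `|` B) <= prob A + prob B.
Proof.
move=> mA mB; rewrite -lee_fin EFinD -!probE ?measureU2//.
exact: measurableU.
Qed.

Section FiniteUnion.
Context {I : eqType}.
Variable F : I -> set T.
Hypothesis mF : forall i, measurable (F i).

Lemma prob_bigcup_le (l : seq I) (Q : pred I) :
  prob (\big[setU/set0]_(i <- l | Q i) F i) <= \sum_(i <- l | Q i) prob (F i).
Proof.
elim: l => [|i l ih]; first by rewrite !big_nil /prob measure0.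
rewrite !big_cons; case: ifP => // _.
apply: le_trans (lerD (lexx _) ih); apply: prob_subU => //.
exact: bigsetU_measurable.
Qed.

Lemma prob_bigcup (l : seq I) : uniq l ->
  (forall i j, i != j -> F i `&` F j = set0) ->
  prob (\big[setU/set0]_(i <- l) F i) = \sum_(i <- l) prob (F i).
Proof.
move=> + dF; elim: l => [|i l ih]; first by rewrite !big_nil /prob measure0.
move=> /= /andP[il ul]; rewrite !big_cons -ih// probU//.
  exact: bigsetU_measurable.
rewrite big_distrr /= big_seq big1// => j jl; apply: dF.
by apply: contraNneq il => ->.
Qed.

End FiniteUnion.

Lemma mem_bigsetU {I : eqType} (l : seq I) (Q : pred I) (F : I -> set T) i w :
  i \in l -> Q i -> F i w -> (\big[setU/set0]_(j <- l | Q j) F j) w.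
Proof.
elim: l => // j l ih; rewrite inE big_cons => /orP[/eqP <- Qi Fi|il Qi Fi].
  by rewrite Qi; left.
by case: ifP => _; [right|]; exact: ih.
Qed.

Definition path_val h (i : nat) : R := step_val (nth None h (size h - i)).

Definition atom h : set T :=
  [set w | forall i, (1 <= i <= size h)%N -> X i w = path_val h i].

Lemma atom_cons o h :
  atom (o :: h) = atom h `&` X (size h).+1 @^-1` [set step_val o].
Proof.
apply/seteqP; split => [w /= hw|w /= [hw Xw] i /=].
  split=> [i /andP[i1 ih]|].
    by rewrite hw ?i1 ?leqW// /path_val /= subSn.
  by rewrite hw ?leqnn// /path_val /= subnn.
move=> /andP[i1]; rewrite leq_eqVlt => /orP[/eqP ->|].
  by rewrite Xw /path_val /= subnn.
by rewrite ltnS => ih; rewrite hw ?i1// /path_val /= subSn.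
Qed.

Lemma measurable_atom h : measurable (atom h).
Proof.
elim: h => [|o h ih].
  rewrite (_ : atom _ = setT)//; apply/seteqP; split=> // w _ i /=.
  by case: i.
by rewrite atom_cons; apply: measurableI => //; exact: measurable_funPTI.
Qed.

(** A choice [c] is a remembered time and a multiplier; the cells are the events
    whose probabilities are prescribed. *)
Definition cell h (c : nat * R) : set T :=
  atom h `&` (K (size h) @^-1` [set c.1] `&` E (size h) @^-1` [set c.2]).

Lemma measurable_cell h c : measurable (cell h c).
Proof.
apply: measurableI; first exact: measurable_atom.
by apply: measurableI; exact: measurable_funPTI.
Qed.

Definition choices n : seq (nat * R) :=
  [seq (j, e) | j <- index_iota 1 n.+1, e <- [:: 1; -1; 0]].

Let n11 : (-1 == 1 :> R) = false.
Proof. by apply/eqP; lra. Qed.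

Let n10 : (1 == 0 :> R) = false. Proof. exact: oner_eq0. Qed.

Let nN10 : (-1 == 0 :> R) = false. Proof. by rewrite oppr_eq0 oner_eq0. Qed.

Let nN11 : (1 == -1 :> R) = false. Proof. by rewrite eq_sym. Qed.

Let n01 : (0 == 1 :> R) = false. Proof. by rewrite eq_sym. Qed.

Let n0N1 : (0 == -1 :> R) = false. Proof. by rewrite eq_sym. Qed.

Lemma uniq_choices n : uniq (choices n).
Proof.
apply: allpairs_uniq; first exact: iota_uniq.
  by rewrite /= !inE negb_or eq_sym n11 n10 nN10.
by move=> [a b] [a' b'] _ _ [-> ->].
Qed.

Lemma prob_cell h c : (0 < size h)%N -> c \in choices (size h) ->
  prob (cell h c) = prob (atom h) * ((size h)%:R^-1 * mult_law p q r c.2).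
Proof.
move=> h0 /allpairsP[[j e] /= [+ _ ->]]; rewrite mem_index_iota ltnS => hj /=.
apply: EFin_inj; rewrite EFinM -!probE; last 2 first.
- exact: measurable_atom.
- exact: measurable_cell.
rewrite -(erws_choice hX (path_val h) e hj); congr (P _).
by apply/seteqP; split => w [a]; [move=> [? ?]|move=> ? ?]; split.
Qed.

Lemma cell_disjoint h c c' : c != c' -> cell h c `&` cell h c' = set0.
Proof.
move=> cc; apply/seteqP; split => // w [[_ [/= k1 e1]] [_ [/= k2 e2]]].
by move/eqP: cc; apply; case: c c' k1 e1 k2 e2 => [a b] [a' b'] /= <- <- <- <-.
Qed.

Lemma law_sum : mult_law p q r 1 + (mult_law p q r (-1) + mult_law p q r 0) = 1.
Proof.
rewrite /mult_law !eqxx n11 n01 n0N1.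
by move: hpqr; lra.
Qed.

(** The probabilities of the cells of an atom add up to that of the atom, so
    that no other value of the choice occurs. *)
Lemma cells_cover h : (0 < size h)%N ->
  prob (atom h `\` \big[setU/set0]_(c <- choices (size h)) cell h c) = 0.
Proof.
move=> h0; set U := \big[_/_]_(_ <- _) _.
have mU : measurable U by apply: bigsetU_measurable => c _; exact: measurable_cell.
have mA := measurable_atom h.
have UA : U `<=` atom h.
  rewrite /U; elim/big_ind : _ => //; first by move=> A B hA hB w [/hA|/hB].
  by move=> c _ w [].
have : prob (atom h) = prob U + prob (atom h `\` U).
  rewrite -probU//; first by rewrite setDUK.
  - exact: measurableD.
  - by rewrite setDIK.
suff -> : prob U = prob (atom h) by lra.
rewrite prob_bigcup; last 3 first.
- exact: measurable_cell.
- exact: uniq_choices.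
- exact: cell_disjoint.
rewrite big_seq (eq_bigr (fun c => prob (atom h) *
  ((size h)%:R^-1 * mult_law p q r c.2))) -?big_seq; last first.
  by move=> c hc; exact: prob_cell.
rewrite -!mulr_sumr big_allpairs_dep /=.
rewrite (eq_bigr (fun=> 1)); last first.
  by move=> j _; rewrite !big_cons big_nil addr0 law_sum.
by rewrite sumr_const_nat subn1 /= mulVf ?mulr1// pnatr_eq0 -lt0n.
Qed.

Lemma path_val_cons o h i : (i <= size h)%N -> path_val (o :: h) i = path_val h i.
Proof. by move=> ih; rewrite /path_val /= subSn. Qed.

Lemma sum_path (F : R -> R) h :
  \sum_(1 <= i < (size h).+1) F (path_val h i) = \sum_(o <- h) F (step_val o).
Proof.
elim: h => [|o h ih]; first by rewrite big_geq// big_nil.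
rewrite [RHS]big_cons -ih /= big_nat_recr//= addrC; congr (_ + _).
  by rewrite /path_val /= subnn.
by apply: eq_big_nat => i /andP[_ hi]; rewrite path_val_cons.
Qed.

Lemma sum_step_val h : \sum_(o <- h) (step_val o : R) = walk (signs h).
Proof.
elim: h => [|o h ih]; first by rewrite big_nil walk_nil.
by rewrite big_cons ih; case: o => [b|] /=; rewrite ?walk_cons ?add0r.
Qed.

Lemma sum_step_val2 h : \sum_(o <- h) (step_val o : R) ^+ 2 = (size (signs h))%:R.
Proof.
elim: h => [|o h ih]; first by rewrite big_nil.
rewrite big_cons ih; case: o => [b|] /=; last by rewrite expr0n add0r.
by rewrite -natr1 addrC; case: b; rewrite /sign_of ?sqrrN expr1n.
Qed.

(** For [x] in -1, 0, 1, the probability that the multiplier sends [x] to a given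
    step is affine in [x] and [x ^+ 2]; its average over the past is thus a
    function of the position and of the number of ones. *)
Lemma step_kernel_law o h : (0 < size h)%N ->
  \sum_(c <- choices (size h) | c.2 * path_val h c.1 == step_val o)
    (size h)%:R^-1 * mult_law p q r c.2 = step_kernel beta s h o.
Proof.
move=> h0; have n0 : (size h)%:R != 0 :> R by rewrite pnatr_eq0 -lt0n.
have b0 : 1 - r != 0 by case/andP: hr => _ r1; rewrite subr_eq0 gt_eqF.
have hpb : p = 3 / 4 * beta by rewrite -hcrit -/beta divfK.
have hqb : q = beta / 4 by move: hpqr; rewrite hpb /beta; lra.
pose a (u : option bool) : R := if u is Some b then 2^-1 * beta else - beta.
pose b (u : option bool) : R := if u is Some e then sign_of e * beta / 4 else 0.
pose c (u : option bool) : R := if u is Some b then 0 else 1.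
rewrite -mulr_sumr big_mkcond big_allpairs_dep /=.
under eq_bigr => j _.
  have -> : \sum_(e <- [:: 1; -1; 0]) (if e * path_val h j == step_val o
      then mult_law p q r e else 0) =
     c o + a o * path_val h j ^+ 2 + b o * path_val h j.
    rewrite !big_cons big_nil addr0 mul1r mulN1r mul0r.
    rewrite /mult_law !eqxx n11 n01 n0N1.
    rewrite /path_val /a /b /c; case: (nth _ _ _) => [[]|]; case: o => [[]|];
      rewrite /= /sign_of ?oppr0 ?opprK ?eqxx ?n11 ?nN11 ?n01 ?n0N1 ?n10 ?nN10;
      move: hpqr; rewrite hpb hqb /beta; lra.
  over.
rewrite !big_split /= -!mulr_sumr (sum_path (fun x => x ^+ 2)) (sum_path id).
rewrite sum_step_val sum_step_val2 sumr_const_nat subn1 /=.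
have hd : walk (signs h) = 2 * (size (signs h))%:R * drift (signs h) :> R.
  rewrite /drift; have [/size0nil ->|] := posnP (size (signs h)).
    by rewrite walk_nil mul0r mulr0.
  by move=> N0; field; rewrite pnatr_eq0 -lt0n.
rewrite hd -mulr_natr /a /b /c.
case: h h0 n0 {hd} => // o' h' _ n0; rewrite /step_kernel.
case: o => [b'|]; field; exact: n0.
Qed.

End Law.
Arguments path_val {R} h i.

(** * From histories to probabilities *)

Section HistoryProcess.
Context (d : measure_display) (T : measurableType d) (R : realType).
Variables (P : probability T R) (p q r s : R).
Variables (X : nat -> {RV P >-> R}) (K : nat -> {RV P >-> nat})
  (E : nat -> {RV P >-> R}).
Hypotheses (hr : 0 < r < 1) (hpqr : p + q + r = 1)
  (hs : 0 <= s <= 1) (hX : is_ERWS p q r s X K E) (hcrit : p / (1 - r) = 3 / 4).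
Implicit Types (h : seq (option bool)) (n m : nat) (A B N : set T).

Fixpoint hist n w : seq (option bool) :=
  if n is n'.+1 then step_code (X n w) :: hist n' w else [::].

Lemma size_hist n w : size (hist n w) = n.
Proof. by elim: n => //= n ->. Qed.

Lemma hist_drop n m w : (m <= n)%N -> drop (n - m) (hist n w) = hist m w.
Proof.
move=> mn; rewrite -{2}(subnK mn); elim: (n - m)%N => [|k ih]; first by rewrite drop0.
by rewrite addSn.
Qed.

Lemma measurable_code n o : measurable [set w | step_code (X n w) = o].
Proof.
have nN11 : (-1 == 1 :> R) = false by apply/eqP; lra.
have -> : [set w | step_code (X n w) = o] =
    X n @^-1` (if o is Some b then [set sign_of b] else ~` ([set 1] `|` [set -1])).
  apply/seteqP; split => w /=; rewrite /step_code.
    case: eqP => [->|x1]; first by move=> <-.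
    by case: eqP => [->|x2] <- //= [].
  case: o => [[]|] /=; rewrite /sign_of.
  - by move=> ->; rewrite eqxx.
  - by move=> ->; rewrite nN11 eqxx.
  - by move=> /not_orP[/eqP/negbTE -> /eqP/negbTE ->].
apply: measurable_funPTI; case: o => [b|]; first exact: measurable_set1.
by apply: measurableC; apply: measurableU; exact: measurable_set1.
Qed.

Lemma measurable_hist n h : measurable [set w | hist n w = h].
Proof.
elim: n h => [|n ih] [|o h] /=.
- by rewrite (_ : [set w | _] = setT)//; apply/seteqP; split.
- by rewrite (_ : [set w | _] = set0)//; apply/seteqP; split.
- by rewrite (_ : [set w | _] = set0)//; apply/seteqP; split.
have -> : [set w | step_code (X n.+1 w) :: hist n w = o :: h] =
    [set w | step_code (X n.+1 w) = o] `&` [set w | hist n w = h].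
  by apply/seteqP; split => w /=; [case|case=> -> ->].
by apply: measurableI; [exact: measurable_code|exact: ih].
Qed.

Lemma measurable_hist_pred n (Q : pred (seq (option bool))) :
  measurable [set w | Q (hist n w)].
Proof.
have -> : [set w | Q (hist n w)] =
    \big[setU/set0]_(h <- hists n | Q h) [set w | hist n w = h].
  apply/seteqP; split => w.
    move=> Qw; apply: (@mem_bigsetU _ _ _ _ Q _ (hist n w)) => //.
    by rewrite mem_hists size_hist.
  elim/big_ind : _ => //; first by move=> A B hA hB [/hA|/hB].
  by move=> h Qh /= ->.
by apply: bigsetU_measurable => h _; exact: measurable_hist.
Qed.

Lemma prob_le_null A B N : measurable A -> measurable B -> P.-negligible N ->
  A `<=` B `|` N -> prob P A <= prob P B.
Proof.
move=> mA mB [N' [mN' N'0 NN']] ABN.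
have : prob P A <= prob P (B `|` N').
  apply: prob_le => //; first exact: measurableU.
  by move=> w /ABN[|/NN']; [left|right].
move=> /le_trans; apply; apply: le_trans (prob_subU _ mB mN') _.
by rewrite {2}/prob N'0 addr0.
Qed.

Lemma negligible_bigcup_seq {I : eqType} (l : seq I) (F : I -> set T) :
  (forall i, i \in l -> P.-negligible (F i)) ->
  P.-negligible (\big[setU/set0]_(i <- l) F i).
Proof.
move=> hF; rewrite big_seq; elim/big_ind : _ => //.
- exact: negligible_set0.
- exact: negligibleU.
Qed.

Lemma prob0_negligible A : measurable A -> prob P A = 0 -> P.-negligible A.
Proof. by move=> mA A0; have := probE P mA; rewrite A0 => PA; exact/negligibleP. Qed.

Lemma step_negligible n : (0 < n)%N ->
  P.-negligible [set w | X n.+1 w <> E n w * X (K n w) w].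
Proof. by move=> n0; exact: (erws_step hX n0). Qed.

Lemma cells_negligible h : (0 < size h)%N -> P.-negligible
  (atom X h `\` \big[setU/set0]_(c <- choices R (size h)) cell X K E h c).
Proof.
move=> h0; apply: (prob0_negligible _ (cells_cover hpqr hX h0)).
apply: measurableD; first exact: measurable_atom.
by apply: bigsetU_measurable => c _; exact: measurable_cell.
Qed.

Lemma atom_hist_step n w : atom X (hist n w) w ->
  X n.+1 w = step_val (step_code (X n.+1 w)) -> atom X (hist n.+1 w) w.
Proof. by move=> aw Xw; rewrite [hist _ _]/= atom_cons; split=> //=; rewrite size_hist. Qed.

Lemma step_val_mul o e : e \in [:: 1; -1; 0 : R] ->
  exists o', e * step_val o = step_val o' :> R.
Proof.
rewrite !inE => /or3P[] /eqP ->; rewrite ?mul1r ?mulN1r ?mul0r.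
- by exists o.
- exists (omap negb o); case: o => [[]|]; rewrite /= /sign_of ?oppr0 ?opprK//.
- by exists None.
Qed.

Lemma cell_step h c w : (0 < size h)%N -> c \in choices R (size h) ->
  cell X K E h c w -> X (size h).+1 w = E (size h) w * X (K (size h) w) w ->
  X (size h).+1 w = c.2 * path_val h c.1.
Proof.
move=> h0 /allpairsP[[j e] /= [+ _ ->]] [aw [/= Kw Ew]] ->.
by rewrite mem_index_iota Ew Kw => jh; rewrite aw.
Qed.

(** The steps almost surely belong to -1, 0, 1, although the values of the
    multipliers are only constrained through their law: the cells of the atom of
    a past with such values cover it up to a null set. *)
Lemma atom_hist_negligible n : P.-negligible [set w | ~ atom X (hist n w) w].
Proof.
elim: n => [|n ih].
  apply: negligibleS (negligible_set0 _) => w /=; apply.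
  by move=> i; case: i.
have [->|n0] := posnP n.
  pose B := X 1 @^-1` [set 1] `|` X 1 @^-1` [set -1].
  have m1 x : measurable (X 1 @^-1` [set x]) by exact: measurable_funPTI.
  have mB : measurable B by apply: measurableU.
  have PB : P B = 1%E.
    rewrite measureU//; last first.
      apply/seteqP; split => // w [/= -> /eqP].
      by rewrite eq_sym; move=> /eqP; lra.
    rewrite [X in (X + _)%E](erws_first_up hX) [X in (_ + X)%E](erws_first_down hX).
    by rewrite -EFinD subrKC.
  apply: (@negligibleS _ _ _ _ (~` B)).
    move=> w /= + Bw; apply; apply: atom_hist_step; first by case.
    have nN11 : (-1 == 1 :> R) = false by apply/eqP; lra.
    by case: Bw => /= ->; rewrite /step_code ?eqxx ?nN11.
  apply: prob0_negligible; first exact: measurableC.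
  by rewrite /prob probability_setC// PB subee.
apply: (@negligibleS _ _ _ _ ([set w | ~ atom X (hist n w) w] `|`
  [set w | X n.+1 w <> E n w * X (K n w) w] `|`
  \big[setU/set0]_(h <- hists n)
    (atom X h `\` \big[setU/set0]_(c <- choices R (size h)) cell X K E h c))).
  move=> w /= bad; apply: contrapT => /not_orP[/not_orP[/contrapT aw /contrapT Xw] cw].
  apply: bad; apply: atom_hist_step => //.
  have : (\big[setU/set0]_(c <- choices R (size (hist n w))) cell X K E (hist n w) c) w.
    apply: contrapT => nc; apply: cw.
    apply: (@mem_bigsetU _ _ _ _ xpredT _ (hist n w)) => //.
    by rewrite mem_hists size_hist.
  rewrite -bigcup_seq => -[c /= hc cc].
  have h0 : (0 < size (hist n w))%N by rewrite size_hist.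
  have := cell_step h0 hc cc; rewrite size_hist => /(_ Xw) ->.
  case/allpairsP : hc => -[j e] /= [_ he ->] /=.
  by have [u ->] := step_val_mul (nth None (hist n w) (size (hist n w) - j)) he;
    rewrite step_valK.
apply: negligibleU; first by apply: negligibleU => //; exact: step_negligible.
apply: negligible_bigcup_seq => h; rewrite mem_hists => /eqP hn.
by apply: cells_negligible; rewrite hn.
Qed.

(** Up to a null set, the atom of a longer history is covered by the cells that
    lead to its last step. *)
Lemma prob_atom_le h : prob P (atom X h) <= weight (1 - r) s h.
Proof.
elim: h => [|o h ih].
  by rewrite -lee_fin -probE ?probability_le1//; exact: measurable_atom.
have mA := measurable_atom X (o :: h).
have [h0|h0] := posnP (size h).
  rewrite (size0nil h0) /= mul1r.
  have : prob P (atom X [:: o]) <= prob P (X 1 @^-1` [set step_val o]).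
    apply: prob_le; [exact: measurable_atom|exact: measurable_funPTI|].
    by rewrite atom_cons => w [].
  move=> /le_trans; apply; rewrite /prob; case: o {mA} => [[]|] /=.
  - by rewrite (erws_first_up hX).
  - by rewrite (erws_first_down hX).
  have m1 x : measurable (X 1 @^-1` [set x]) by exact: measurable_funPTI.
  have := probability_le1 P (measurableU _ _ (m1 0) (measurableU _ _ (m1 1) (m1 (-1)))).
  rewrite !measureU//; first last.
  - apply/seteqP; split => // w [/= -> ].
    by case=> /= /eqP; rewrite eq_sym ?oppr_eq0 oner_eq0.
  - exact: measurableU.
  - by apply/seteqP; split => // w [/= -> /eqP]; rewrite eq_sym => /eqP; lra.
  rewrite [X in (_ + (X + _))%E](erws_first_up hX).
  rewrite [X in (_ + (_ + X))%E](erws_first_down hX).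
  rewrite -/(prob P (X 1 @^-1` [set 0])) [X in (X + _)%E](probE P (m1 0)).
  by rewrite -!EFinD lee_fin; lra.
pose F c := cell X K E h c.
pose Q (c : nat * R) := c.2 * path_val h c.1 == step_val o.
have mF c : measurable (F c) by exact: measurable_cell.
have : prob P (atom X (o :: h)) <=
    prob P (\big[setU/set0]_(c <- choices R (size h) | Q c) F c).
  apply: (prob_le_null mA _ (negligibleU (step_negligible h0) (cells_negligible h0))).
    exact: bigsetU_measurable.
  move=> w; rewrite atom_cons => -[aw /= Xo].
  apply: contrapT => /not_orP[nQ /not_orP[/contrapT Xw nC]].
  apply: nC; split => //; rewrite -bigcup_seq => -[c /= hc cc]; apply: nQ.
  apply: (mem_bigsetU hc) => //; apply/eqP.
  by rewrite -(cell_step h0 hc cc).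
move=> /le_trans; apply; apply: le_trans (prob_bigcup_le _ mF _ _) _.
rewrite /= -(step_kernel_law s hr hpqr hcrit)//.
rewrite big_seq_cond (eq_bigr (fun c => prob P (atom X h) *
  ((size h)%:R^-1 * mult_law p q r c.2))); last first.
  by move=> c /andP[hc _]; exact: (prob_cell hX h0 hc).
rewrite -big_seq_cond -[leLHS]mulr_sumr ler_wpM2r// (step_kernel_law s hr hpqr hcrit)//.
apply: step_kernel_ge0 => //; case/andP: hr => *; apply/andP; split; lra.
Qed.

Lemma prob_hist_le n h : prob P [set w | hist n w = h] <= weight (1 - r) s h.
Proof.
apply: le_trans (prob_atom_le h).
apply: (prob_le_null _ _ (atom_hist_negligible n)).
- exact: measurable_hist.
- exact: measurable_atom.
- by move=> w /= <-; have [|] := pselect (atom X (hist n w) w); [left|right].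
Qed.

(** Doob's maximal inequality for nonnegative supermartingales, obtained from
    [stopped_bound] by letting the time horizon tend to infinity. *)
Lemma doob_maximal m (f : seq (option bool) -> R) : (forall h, 0 <= f h) ->
  (forall h, (m <= size h)%N -> hist_mean (1 - r) s f h <= f h) ->
  measurable [set w | exists2 n, (m <= n)%N & 1 <= f (hist n w)] /\
  (P [set w | exists2 n, (m <= n)%N & (1 <= f (hist n w))%R]
   <= (iter m (hist_mean (1 - r) s) f [::])%:E)%E.
Proof.
move=> f0 ff.
have b01 : 0 <= 1 - r <= 1 by case/andP: hr => *; apply/andP; split; lra.
pose A n := [set w | hits f m (hist n w)].
have mA n : measurable (A n) by exact: measurable_hist_pred.
have AE : [set w | exists2 n, (m <= n)%N & 1 <= f (hist n w)] = \bigcup_n A n.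
  apply/seteqP; split => w /=.
    move=> [n mn f1]; exists n => //; apply/hitsP; exists 0%N => //.
    by rewrite drop0 size_hist.
  move=> [n _ /hitsP[k]]; rewrite size_hist => kn [mn f1].
  exists (n - k)%N; first by lia.
  by rewrite -(hist_drop w (leq_subr k n)) subKn//; lia.
have mU : measurable (\bigcup_n A n) by exact: bigcupT_measurable.
rewrite AE; split => //.
have ndA : nondecreasing_seq A.
  apply/nondecreasing_seqP => n; apply/subsetPset => w /= hw.
  by rewrite /A /= /hits -/(hits f m) hw orbT.
have := nondecreasing_cvg_mu mA mU ndA.
have bnd n : (m <= n)%N -> (P (A n) <= (iter m (hist_mean (1 - r) s) f [::])%:E)%E.
  move=> mn; rewrite probE// lee_fin.
  apply: le_trans (stopped_bound b01 hs f0 mn ff).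
  apply: (@le_trans _ _ (prob P (\big[setU/set0]_(h <- hists n | hits f m h)
     [set w | hist n w = h]))).
    apply: prob_le => //; first by apply: bigsetU_measurable => h _; exact: measurable_hist.
    move=> w Aw; apply: (@mem_bigsetU _ _ _ _ (hits f m) _ (hist n w)) => //.
    by rewrite mem_hists size_hist.
  apply: le_trans (prob_bigcup_le _ (measurable_hist n) _ _) _.
  by apply: ler_sum => h _; exact: prob_hist_le.
move=> /(_ _ P) cv; rewrite -(cvg_lim _ cv)//; apply: lime_le; first exact: (cvgP _ cv).
by exists m => // n /= mn; exact: bnd.
Qed.

End HistoryProcess.

(** * Supermartingales built on the number of ones *)

Section Ones.
Context {R : realType}.
Variables (beta s : R).
Hypotheses (beta01 : 0 < beta <= 1) (s01 : 0 <= s <= 1).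
Implicit Types (h : seq (option bool)) (n m : nat).

Definition ones_of h : R := (size (signs h))%:R.

Lemma ones_of_cons o h : ones_of (o :: h) = (if o is Some _ then 1 else 0) + ones_of h.
Proof. by case: o => [b|]; rewrite /ones_of /= ?add0r// -natr1 addrC. Qed.

Lemma hist_mean_ones (F : R -> nat -> R) h : (0 < size h)%N ->
  hist_mean beta s (fun h => F (ones_of h) (size h)) h =
  (1 - beta * ones_of h / (size h)%:R) * F (ones_of h) (size h).+1 +
  beta * ones_of h / (size h)%:R * F (1 + ones_of h) (size h).+1.
Proof.
case: h => // o h _; rewrite /hist_mean !(ones_of_cons _ (o :: h)) add0r.
rewrite /step_kernel /sign_of mul1r mulN1r -/(ones_of (o :: h)).
rewrite -![size (_ :: o :: h)]/(size (o :: h)).+1.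
by move: (_ * _ / _) (drift _) => c m; field.
Qed.

(** The mean of the inverse of the number of ones is thus at most of order
    [n `^ (- beta / 2)], which makes the number of ones unbounded. *)
Lemma inv_ones_mean h : (0 < size h)%N ->
  hist_mean beta s (fun h => (ones_of h)^-1) h <=
  (1 - beta / 2 / (size h)%:R) * (ones_of h)^-1.
Proof.
move=> h0; rewrite (hist_mean_ones (fun x _ => x^-1))//.
have n0 : 0 < (size h)%:R :> R by rewrite ltr0n.
have [N0|N0] := posnP (size (signs h)).
  by rewrite /ones_of N0 !(mulr0, mul0r, invr0) add0r.
have N1 : 1 <= ones_of h by rewrite ler1n.
case/andP: beta01 => b0 b1.
rewrite -subr_ge0; move: (ones_of h) ((size h)%:R) N1 n0 => N n N1 n0.
have -> : (1 - beta / 2 / n) * N^-1 - ((1 - beta * N / n) * N^-1 + beta * N / n * (1 + N)^-1)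
   = beta / n * (N - 1) / (2 * N * (1 + N)).
  by field; rewrite !gt_eqF//=; lra.
by rewrite !mulr_ge0 ?invr_ge0 ?mulr_ge0 ?(ltW b0) ?(ltW n0)//; lra.
Qed.

Lemma iter_inv_ones n :
  iter n.+1 (hist_mean beta s) (fun h => (ones_of h)^-1) [::] <=
  expR (- (beta / 2 * ln n.+1%:R)).
Proof.
have b01 : 0 <= beta <= 1 by case/andP: beta01 => *; apply/andP; split=> //; exact: ltW.
elim: n => [|n ih].
  rewrite ln1 mulr0 oppr0 expR0 /= /hist_mean /= mul0r add0r.
  by rewrite /ones_of /= invr1 !mulr1 subrKC.
rewrite iterSr.
apply: (@le_trans _ _ (iter n.+1 (hist_mean beta s)
    (fun h => (1 - beta / 2 / n.+1%:R) * (ones_of h)^-1) [::])).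
  apply: (iter_hist_le b01 s01) => h hn; rewrite cats0.
  by have := @inv_ones_mean h; rewrite hn; exact.
have -> : iter n.+1 (hist_mean beta s)
    (fun h => (1 - beta / 2 / n.+1%:R) * (ones_of h)^-1) [::] =
  (1 - beta / 2 / n.+1%:R) *
  iter n.+1 (hist_mean beta s) (fun h => (ones_of h)^-1) [::].
  by rewrite -!sum_hists mulr_sumr; apply: eq_bigr => h _; ring.
case/andP: beta01 => b0 b1.
have n1 : 1 <= n.+1%:R :> R by rewrite ler1n.
have c0 : 0 <= 1 - beta / 2 / n.+1%:R.
  by rewrite subr_ge0 ler_pdivrMr; lra.
apply: le_trans (ler_wpM2l c0 ih) _.
apply: le_trans (ler_wpM2r (expR_ge0 _) (expR_ge1Dx _)) _.
rewrite -expRD ler_expR.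
have := @ln_increment_le R n.+1 isT; have := ltW b0.
by move: (ln _) (ln _) n.+1%:R^-1 => x y z *; nra.
Qed.

(** The factor by which the expected number of ones grows up to time [n]. *)
Definition ones_norm n : R := \prod_(1 <= k < n) (1 + beta / k%:R).

Lemma ones_norm1 : ones_norm 1 = 1.
Proof. by rewrite /ones_norm big_geq. Qed.

Lemma ones_normS n : (0 < n)%N -> ones_norm n.+1 = ones_norm n * (1 + beta / n%:R).
Proof. by move=> n0; rewrite /ones_norm big_nat_recr. Qed.

Lemma ones_norm_gt0 n : 0 < ones_norm n.
Proof.
case/andP: beta01 => b0 _.
apply: prodr_gt0 => k _; rewrite (lt_le_trans ltr01)// lerDl divr_ge0// ltW//.
Qed.

(** Bernoulli's inequality for an exponent in [0, 1]. *)
Lemma powR_convex (u : R) : expR (beta * u) <= 1 + beta * (expR u - 1).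
Proof.
case/andP: beta01 => b0 b1.
have := convex_expR (Itv01 (ltW b0) b1) u 0.
rewrite !convRE /= mulr0 addr0 expR0 mulr1 => /le_trans; apply.
by rewrite /= /unstable.onem; lra.
Qed.

(** This is [ones_norm n.+1] divided by the power [beta] of [n.+1]. It increases
    by Bernoulli's inequality and is bounded. *)
Definition norm_ratio n : R := ones_norm n.+1 * expR (- (beta * ln n.+1%:R)).

Lemma norm_ratio_incr : nondecreasing_seq norm_ratio.
Proof.
apply/nondecreasing_seqP => n; rewrite /norm_ratio (ones_normS (ltn0Sn n)).
rewrite -mulrA ler_wpM2l ?(ltW (ones_norm_gt0 _))//.
have n1 : 0 < n.+1%:R :> R by rewrite ltr0n.
have -> : - (beta * ln n.+1%:R) =
    beta * ln (n.+2%:R / n.+1%:R) + - (beta * ln n.+2%:R) :> R.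
  by rewrite ln_div ?posrE ?ltr0n//; ring.
rewrite expRD ler_wpM2r ?expR_ge0// (le_trans (powR_convex _))//.
rewrite lnK ?posrE ?divr_gt0 ?ltr0n// -[n.+2%:R]natr1.
have -> : (n.+1%:R + 1) / n.+1%:R - 1 = n.+1%:R^-1 :> R by field; rewrite gt_eqF.
by [].
Qed.

Lemma norm_ratio_le n : norm_ratio n <= expR 1.
Proof.
case/andP: beta01 => b0 b1.
suff : norm_ratio n <= expR (beta * (1 - n.+1%:R^-1)).
  move=> /le_trans; apply; rewrite ler_expR.
  have : 0 <= n.+1%:R^-1 :> R by [].
  by move: n.+1%:R^-1 => x; nra.
elim: n => [|n ih].
  by rewrite /norm_ratio ones_norm1 ln1 invr1 subrr !mulr0 oppr0 mul1r.
rewrite /norm_ratio (ones_normS (ltn0Sn n)).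
have -> : ones_norm n.+1 * (1 + beta / n.+1%:R) * expR (- (beta * ln n.+2%:R)) =
   norm_ratio n * ((1 + beta / n.+1%:R) * expR (- (beta * (ln n.+2%:R - ln n.+1%:R)))).
  rewrite /norm_ratio.
  have -> : - (beta * ln n.+2%:R) =
     - (beta * ln n.+1%:R) + - (beta * (ln n.+2%:R - ln n.+1%:R)) :> R by ring.
  by rewrite expRD; ring.
have h : (1 + beta / n.+1%:R) * expR (- (beta * (ln n.+2%:R - ln n.+1%:R))) <=
    expR (beta / n.+1%:R - beta / n.+2%:R).
  apply: le_trans (ler_wpM2r (expR_ge0 _) (expR_ge1Dx _)) _.
  rewrite -expRD ler_expR lerD2l lerN2 ler_wpM2l ?(ltW b0)//.
  exact: ln_increment_ge.
have r0 : 0 <= norm_ratio n.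
  by rewrite mulr_ge0 ?expR_ge0// ltW// ones_norm_gt0.
apply: le_trans (ler_wpM2l r0 h) _.
apply: le_trans (ler_wpM2r (expR_ge0 _) ih) _.
by rewrite -expRD ler_expR le_eqVlt; apply/orP; left; apply/eqP; ring.
Qed.

Lemma norm_ratio_cvg : cvgn norm_ratio.
Proof.
apply: nondecreasing_is_cvgn; first exact: norm_ratio_incr.
by exists (expR 1) => _ [n _ <-]; exact: norm_ratio_le.
Qed.

Lemma ones_norm_ge n : expR (beta * ln n.+1%:R) <= ones_norm n.+1.
Proof.
have := norm_ratio_incr (leq0n n).
rewrite /norm_ratio ones_norm1 ln1 mulr0 oppr0 expR0 mulr1 expRN.
by rewrite ler_pdivlMr ?expR_gt0// mul1r.
Qed.

Definition ones_mart h : R := ones_of h / ones_norm (size h).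

Lemma ones_mart_mean h : (0 < size h)%N -> hist_mean beta s ones_mart h = ones_mart h.
Proof.
move=> h0; rewrite (hist_mean_ones (fun x n => x / ones_norm n))//.
rewrite /ones_mart ones_normS//.
have b0 := ones_norm_gt0 (size h).
have n0 : 0 < (size h)%:R :> R by rewrite ltr0n.
have nb : (size h)%:R + beta != 0 by case/andP: beta01 => *; rewrite gt_eqF//; lra.
move: (ones_of h) b0 n0 nb; move: (ones_norm _) (size h)%:R => b n N b0 n0 nb.
by field; rewrite nb !gt_eqF.
Qed.

(** The tail variance of [ones_mart] is at most [ones_mart / ones_norm], so
    that adding it to the squared distance to the value [ones_mart] had at time [m]
    gives a supermartingale. *)
Definition ones_spread m h : R :=
  (ones_mart h - ones_mart (drop (size h - m) h)) ^+ 2 +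
  ones_mart h / ones_norm (size h).

Lemma ones_spread_super m h : (0 < m)%N -> (m <= size h)%N ->
  hist_mean beta s (ones_spread m) h <= ones_spread m h.
Proof.
move=> m0 mh; have h0 : (0 < size h)%N by exact: leq_trans mh.
set w := ones_mart (drop (size h - m) h).
have -> : hist_mean beta s (ones_spread m) h = hist_mean beta s (fun h' =>
    (ones_of h' / ones_norm (size h') - w) ^+ 2 +
    ones_of h' / ones_norm (size h') / ones_norm (size h')) h.
  by rewrite /hist_mean /ones_spread /ones_mart /= subSn.
rewrite (hist_mean_ones (fun x n => (x / ones_norm n - w) ^+ 2 +
  x / ones_norm n / ones_norm n))//.
rewrite /ones_spread -/w /ones_mart ones_normS//.
have b0 := ones_norm_gt0 (size h).
have n0 : 0 < (size h)%:R :> R by rewrite ltr0n.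
have N0 : 0 <= ones_of h by [].
case/andP: beta01 => be0 be1.
move: (ones_of h) w N0 b0 n0; move: (ones_norm _) (size h)%:R => b n N w N0 b0 n0.
have nb : 0 < n + beta by lra.
rewrite -subr_ge0.
rewrite [X in 0 <= X](_ : _ = N * beta ^+ 2 * (1 + N) / (b ^+ 2 * (n + beta) ^+ 2)).
  by rewrite divr_ge0 ?mulr_ge0 ?sqr_ge0//; lra.
by field; rewrite !gt_eqF.
Qed.

Lemma iter_ones_spread m : (0 < m)%N ->
  iter m (hist_mean beta s) (ones_spread m) [::] <= (ones_norm m)^-1.
Proof.
move=> m0; have b01 : 0 <= beta <= 1 by case/andP: beta01 => *; rewrite ltW.
have -> : iter m (hist_mean beta s) (ones_spread m) [::] =
    (ones_norm m)^-1 * iter m (hist_mean beta s) ones_mart [::].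
  rewrite -!sum_hists mulr_sumr big_seq [RHS]big_seq; apply: eq_bigr => h.
  rewrite mem_hists => /eqP hm; rewrite /ones_spread hm subnn drop0 subrr.
  by rewrite expr0n /=; ring.
rewrite ler_piMr ?invr_ge0 ?(ltW (ones_norm_gt0 _))//.
apply: le_trans (iter_hist_super b01 s01 m0 _) _.
  by move=> h h0; rewrite ones_mart_mean.
rewrite /= /hist_mean /ones_mart /= mul0r add0r ones_norm1 /ones_of /=.
by rewrite !divr1 !mulr1 subrKC.
Qed.

End Ones.

(** * Almost sure behaviour of the number of ones *)

Section AlmostSure.
Context (d : measure_display) (T : measurableType d) (R : realType).
Variables (P : probability T R) (p q r s : R).
Variables (X : nat -> {RV P >-> R}) (K : nat -> {RV P >-> nat})
  (E : nat -> {RV P >-> R}).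
Hypotheses (hr : 0 < r < 1) (hpqr : p + q + r = 1)
  (hs : 0 <= s <= 1) (hX : is_ERWS p q r s X K E) (hcrit : p / (1 - r) = 3 / 4).
Implicit Types (h : seq (option bool)) (n m : nat) (A B N : set T).

Lemma negligible_small A :
  (forall e : R, 0 < e -> exists B, [/\ measurable B, A `<=` B & (P B <= e%:E)%E]) ->
  P.-negligible A.
Proof.
move=> hA; have p0 n : 0 < n.+1%:R^-1 :> R by rewrite invr_gt0.
pose B n := projT1 (cid (hA _ (p0 n))).
have hB n : [/\ measurable (B n), A `<=` B n & (P (B n) <= n.+1%:R^-1%:E)%E].
  by rewrite /B; case: cid.
exists (\bigcap_n B n); split.
- by apply: bigcapT_measurable => n; case: (hB n).
- apply/eqP; rewrite -measure_le0; apply/lee_addgt0Pr => e e0.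
  rewrite add0e.
  have [n hn] := invS_le e0.
  have [mB _ PB] := hB n.
  apply: (@le_trans _ _ (P (B n))).
    rewrite le_measure ?inE//; last by move=> w /(_ n); exact.
    by apply: bigcapT_measurable => k; case: (hB k).
  by apply: le_trans PB _; rewrite lee_fin.
- by move=> w Aw n _; have [_ AB _] := hB n; exact: AB.
Qed.

Lemma doob_maximalZ m (f : seq (option bool) -> R) c : (forall h, 0 <= f h) ->
  (forall h, (m <= size h)%N -> hist_mean (1 - r) s f h <= f h) -> 0 < c ->
  measurable [set w | exists2 n, (m <= n)%N & c <= f (hist X n w)] /\
  (P [set w | exists2 n, (m <= n)%N & (c <= f (hist X n w))%R]
   <= (c^-1 * iter m (hist_mean (1 - r) s) f [::])%:E)%E.
Proof.
move=> f0 ff c0.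
have cf h : (c <= f h) = (1 <= c^-1 * f h) by rewrite mulrC ler_pdivlMr// mul1r.
rewrite (_ : [set w | _] = [set w | exists2 n, (m <= n)%N & 1 <= c^-1 * f (hist X n w)]).
  rewrite -iter_histZ.
  pose cf' h := c^-1 * f h; rewrite -/cf'.
  have h1 h : 0 <= cf' h by rewrite mulr_ge0// invr_ge0 ltW.
  apply: (doob_maximal hr hpqr hs hX hcrit h1) => h mh.
  rewrite /cf'; have -> : hist_mean (1 - r) s (fun h => c^-1 * f h) h =
      c^-1 * hist_mean (1 - r) s f h by rewrite /hist_mean; ring.
  by rewrite ler_wpM2l ?ff// invr_ge0 ltW.
by apply/seteqP; split => w [n mn]; rewrite ?cf => hn; exists n; rewrite ?cf.
Qed.

Let beta01 : 0 < 1 - r <= 1.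
Proof. by case/andP: hr => r0 r1; rewrite subr_gt0 r1 gerBl ltW. Qed.

Lemma first_step_negligible :
  P.-negligible [set w | size (signs (hist X 1 w)) = 0%N].
Proof.
apply: (@negligibleS _ _ _ _ [set w | hist X 1 w = [:: None]]).
  by move=> w /=; case: (step_code _).
apply: prob0_negligible; first exact: measurable_hist.
apply/eqP; rewrite eq_le prob_ge0 andbT.
apply: le_trans (prob_hist_le hr hpqr hs hX hcrit _ _) _.
by rewrite /= mulr0.
Qed.

Lemma signs_mono n m w : (n <= m)%N ->
  (size (signs (hist X n w)) <= size (signs (hist X m w)))%N.
Proof.
move=> nm; rewrite -(subnK nm); elim: (m - n)%N => // k ih.
by rewrite addSn /=; case: (step_code _) => [b|] //=; rewrite (leq_trans ih).
Qed.

Lemma ones_unbounded_ae :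
  P.-negligible [set w | exists M, forall n, (size (signs (hist X n w)) <= M)%N].
Proof.
suff bounded M :
    P.-negligible [set w | forall n, (size (signs (hist X n w)) <= M)%N].
  apply: (@negligibleS _ _ _ _ (\bigcup_M
     [set w | forall n, (size (signs (hist X n w)) <= M)%N])).
    by move=> w [M hM]; exists M.
  exact: negligible_bigcup.
apply: (@negligibleS _ _ _ _
  ([set w | size (signs (hist X 1 w)) = 0%N] `|`
   [set w | (forall n, (size (signs (hist X n w)) <= M.+1)%N) /\
            size (signs (hist X 1 w)) != 0%N])).
  move=> w hw /=; have [->|nz] := eqVneq (size (signs (hist X 1 w))) 0%N; first by left.
  by right; split => // n; rewrite leqW.
apply: negligibleU; first exact: first_step_negligible.
apply: negligible_small => e e0.
pose b := 1 - r; have b0 : 0 < b by case/andP: beta01.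
have [n0 hn0] := ln_natr_ge (- ln (e / M.+1%:R) * (b / 2)^-1 : R).
have M0 : 0 < M.+1%:R :> R by rewrite ltr0n.
have f0 h : 0 <= (ones_of h)^-1 :> R by rewrite invr_ge0.
have ff h : (n0.+1 <= size h)%N ->
    hist_mean (1 - r) s (fun h => (ones_of h)^-1) h <= (ones_of h)^-1 :> R.
  move=> hh; have h0 : (0 < size h)%N by exact: leq_trans hh.
  apply: le_trans (inv_ones_mean s beta01 h0) _.
  rewrite ler_piMl// gerBl divr_ge0//; move: b0; rewrite /b; lra.
have Mi : 0 < M.+1%:R^-1 :> R by rewrite invr_gt0.
have [mB PB] := doob_maximalZ f0 ff Mi.
eexists; split; first exact: mB.
  move=> w [hM nz]; exists n0.+1 => //=.
  have N0 : (0 < size (signs (hist X n0.+1 w)))%N.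
    by rewrite (leq_trans _ (signs_mono _ (ltn0Sn n0)))// lt0n.
  rewrite /ones_of lef_pV2 ?posrE ?ltr0n// ler_nat; exact: (hM n0.+1).
apply: le_trans PB _; rewrite lee_fin invrK.
apply: le_trans (ler_wpM2l (ltW M0) (iter_inv_ones beta01 hs n0)) _.
rewrite mulrC -ler_pdivlMr// -[leRHS]lnK ?posrE ?divr_gt0// ler_expR.
have := hn0 _ (leqnSn n0); rewrite ler_pdivrMr ?divr_gt0// -/b.
set x := ln (e / _); set y := ln _; lra.
Qed.

(** Along [ones_spread m], whose mean at time [m] is at most the inverse of
    [ones_norm m], the maximal inequality controls all later oscillations at
    once. Since [ones_norm m] tends to infinity, the martingale is almost surely
    a Cauchy sequence. *)
Lemma ones_mart_cvg_ae :
  P.-negligible [set w | ~ cvgn (fun n => ones_mart (1 - r) (hist X n w))].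
Proof.
pose M n w := ones_mart (1 - r) (hist X n w).
suff osc (e : R) : 0 < e ->
    P.-negligible [set w | forall m, exists2 n, (m <= n)%N & e <= `|M n w - M m w|].
  apply: (@negligibleS _ _ _ _ (\bigcup_k
     [set w | forall m, exists2 n, (m <= n)%N & k.+1%:R^-1 <= `|M n w - M m w|])).
    move=> w /= ncv; apply: contrapT => hw; apply: ncv.
    apply/cauchy_cvgP/cauchy_exP => e e0.
    have [k hk] := invS_le e0.
    apply: contrapT => hx; apply: hw; exists k => // m.
    apply: contrapT => hm; apply: hx; exists (M m w).
    exists m => // n /= mn; rewrite /ball /= distrC ltNge; apply/negP => he.
    by apply: hm; exists n => //; exact: le_trans he.
  by apply: negligible_bigcup => k; apply: osc; rewrite invr_gt0.
move=> e0; apply: negligible_small => a a0.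
have b0 : 0 < 1 - r by case/andP: beta01.
have [m hm] := ln_natr_ge (- ln (a * e ^+ 2) / (1 - r)).
have f0 h : 0 <= ones_spread (1 - r) m.+1 h.
  rewrite addr_ge0 ?sqr_ge0// /ones_mart !mulr_ge0 ?invr_ge0//;
  exact: ltW (ones_norm_gt0 beta01 _).
have ff h : (m.+1 <= size h)%N ->
    hist_mean (1 - r) s (ones_spread (1 - r) m.+1) h <= ones_spread (1 - r) m.+1 h.
  exact: ones_spread_super.
have e2 : 0 < e ^+ 2 by rewrite exprn_gt0.
have [mB PB] := doob_maximalZ f0 ff e2.
eexists; split; first exact: mB.
  move=> w /(_ m.+1) [n mn hn]; exists n => //.
  rewrite /ones_spread size_hist hist_drop//.
  rewrite (le_trans (_ : _ <= `|M n w - M m.+1 w| ^+ 2))//.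
    by rewrite lerXn2r ?nnegrE// ltW.
  rewrite real_normK ?num_real// lerDl /ones_mart !mulr_ge0 ?invr_ge0//;
  exact: ltW (ones_norm_gt0 beta01 _).
apply: le_trans PB _; rewrite lee_fin mulrC ler_pdivrMr//.
apply: le_trans (iter_ones_spread beta01 hs (ltn0Sn m)) _.
rewrite -[leRHS]invrK lef_pV2 ?posrE ?invr_gt0 ?mulr_gt0 ?ones_norm_gt0//.
apply: le_trans (ones_norm_ge beta01 m).
rewrite -[leLHS]lnK ?posrE ?invr_gt0 ?mulr_gt0// ler_expR lnV ?posrE ?mulr_gt0//.
have := hm _ (leqnSn m); rewrite ler_pdivrMr//; rewrite [ln m.+1%:R * _]mulrC; exact.
Qed.

Lemma position_hist n w : atom X (hist X n w) w ->
  position X n w = walk (signs (hist X n w)).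
Proof.
move=> aw; rewrite /position -sum_step_val -(sum_path id) size_hist.
by apply: eq_big_nat => i hi; rewrite aw// size_hist.
Qed.

Lemma number_of_ones_hist n w : atom X (hist X n w) w ->
  number_of_ones X n w = ones_of (hist X n w).
Proof.
move=> aw; rewrite /number_of_ones /ones_of -sum_step_val2.
rewrite -(sum_path (fun x => x ^+ 2)) size_hist.
by apply: eq_big_nat => i hi; rewrite aw// size_hist.
Qed.

End AlmostSure.

(** * The upper half of the law for the martingale *)

Section UpperBound.
Context {R : realType}.

Definition iterlog_scale (b : R) : R := Num.sqrt (2 * b * ln (ln b)).

Lemma le_geometric (a rho : R) : 1 < rho ->
  exists k0, forall k, (k0 <= k)%N -> a * k%:R <= rho ^+ k.
Proof.
move=> rho1; have l0 : 0 < ln rho by exact: ln_gt0.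
have rho0 : 0 < rho by exact: lt_trans rho1.
exists (Num.truncn (2 * a / ln rho ^+ 2)).+1 => k hk.
have kk : 2 * a / ln rho ^+ 2 < k%:R.
  by apply: lt_le_trans (real_truncnS_gt (num_real _)) _; rewrite ler_nat.
have -> : rho ^+ k = expR (k%:R * ln rho) by rewrite expRM_natl lnK.
have kl : 0 <= k%:R * ln rho by rewrite mulr_ge0// ltW.
apply: le_trans (expR_ge1Dxn 1 kl).
rewrite ltr_pdivrMr ?exprn_gt0// in kk.
have k0 : 0 <= k%:R :> R by [].
have -> : (2`! = 2)%N by [].
by rewrite exprMn; move: k%:R (ln rho) kk k0 => x y; nra.
Qed.

(** The exponent adapted to the values of the clock between [rho ^+ k] and
    [rho ^+ k.+1]. *)
Definition upper_slope (rho : R) (k : nat) : R := Num.sqrt (2 * ln k%:R / rho ^+ k).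

Lemma upper_slope_small (rho e : R) : 1 < rho -> 0 < e ->
  exists k0, forall k, (k0 <= k)%N -> upper_slope rho k <= e.
Proof.
move=> rho1 e0; have [k0 hk0] := le_geometric (2 / e ^+ 2) rho1.
exists k0.+1 => k hk.
have rk : 0 < rho ^+ k by rewrite exprn_gt0// (lt_trans _ rho1).
have k1 : 0 < k%:R :> R by rewrite ltr0n; exact: leq_trans hk.
rewrite -[leRHS]gtr0_norm// -sqrtr_sqr ler_wsqrtr// ler_pdivrMr//.
have := hk0 k (ltnW hk); rewrite mulrAC ler_pdivrMr ?exprn_gt0//.
by have := ln_sublinear k1; rewrite [rho ^+ k * _]mulrC; lra.
Qed.

(** The series of the [k `^ (- (1 + e))] is bounded by a telescoping one. *)
Lemma zeta_telescope (e : R) k : 0 < e -> e <= 1 ->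
  expR (- ((1 + e) * ln k.+2%:R)) <=
  e^-1 * (expR (- (e * ln k.+1%:R)) - expR (- (e * ln k.+2%:R))).
Proof.
move=> e0 e1; rewrite ler_pdivlMl//.
have -> : - ((1 + e) * ln k.+2%:R) = - (e * ln k.+2%:R) + - ln k.+2%:R :> R by ring.
rewrite expRD expRN [expR (- ln _)]expRN lnK ?posrE ?ltr0n//.
have -> : - (e * ln k.+1%:R) =
    - (e * ln k.+2%:R) + e * (ln k.+2%:R - ln k.+1%:R) :> R by ring.
rewrite expRD [expR (- (e * _))]expRN; set c := (expR _)^-1.
have c0 : 0 <= c by rewrite invr_ge0 expR_ge0.
have h := @ln_increment_ge R k.+1 isT.
rewrite mulrCA -{3}[c]mulr1 -mulrBr ler_wpM2l//.
apply: le_trans (ler_wpM2l (ltW e0) h) _.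
by rewrite lerBrDl; exact: expR_ge1Dx.
Qed.

(** Each [k] gives an upper bound on [Z] that is affine in the clock [b]. The one
    adapted to [b] has for [k] the integer part of [ln b / ln rho], so that
    [ln k] is close to [ln (ln b)]. *)
Lemma iterlog_upper (e Z b : R) (k1 : nat) : 0 < e -> e <= 1 ->
  let rho := 1 + e in
  expR (expR (k1.+2%:R * ln rho + (- ln (ln rho)) / e + 1)) <= b ->
  (forall k, (k1 <= k)%N ->
     upper_slope rho k * Z - (1 + e) * (upper_slope rho k ^+ 2 / 2) * b
       < (1 + e) * ln k%:R) ->
  Z <= (1 + e) ^+ 3 * iterlog_scale b.
Proof.
move=> e0 e1 rho hb hZ.
have rho1 : 1 < rho by rewrite /rho; lra.
have rho0 : 0 < rho by lra.
have lr0 : 0 < ln rho by exact: ln_gt0.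
have lr1 : ln rho <= 1 by apply: le_trans e1; apply: le_ln1Dx; lra.
have llr : 0 <= (- ln (ln rho)) / e.
  by rewrite divr_ge0 ?(ltW e0)// oppr_ge0 ln_le0.
set y := _ + 1 in hb.
have y1 : 1 <= y by rewrite /y lerDr addr_ge0// mulr_ge0// ltW.
have b0 : 0 < b by apply: lt_le_trans hb; exact: expR_gt0.
have lb : expR y <= ln b by rewrite -[leLHS]expRK ler_ln ?posrE ?expR_gt0.
have lb0 : 0 < ln b by apply: lt_le_trans lb; exact: expR_gt0.
have llb : y <= ln (ln b) by rewrite -[leLHS]expRK ler_ln ?posrE ?expR_gt0.
pose k := Num.truncn (ln b / ln rho).
have /andP[kle klt] := @truncn_itv _ (ln b / ln rho) (ltW (divr_gt0 lb0 lr0)).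
rewrite -/k ler_pdivlMr// ltr_pdivrMr// in kle klt.
have hk : (k1.+2 <= k)%N.
  rewrite -ltnS -(ltr_nat R) -(ltr_pM2r lr0) (le_lt_trans _ klt)//.
  apply: le_trans lb; apply: le_trans (expR_ge1Dx _).
  by move: llr; rewrite /y; set c := _ / e; lra.
have k2 : 2 <= k%:R :> R by rewrite ler_nat (leq_trans _ hk).
have k0 : 0 < k%:R :> R by lra.
pose r2 := rho ^+ k.
have r20 : 0 < r2 by rewrite exprn_gt0.
have r2b : r2 <= b by rewrite -ler_ln ?posrE// lnXn// -mulr_natl.
have br2 : b <= rho * r2.
  by rewrite -exprS -ler_ln ?posrE ?exprn_gt0// lnXn// -mulr_natl ltW.
have lnk0 : 0 < ln k%:R :> R by rewrite ln_gt0//; lra.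
have lnk : ln k%:R <= (1 + e) * ln (ln b).
  have : ln k%:R + ln (ln rho) <= ln (ln b).
    by rewrite -lnM ?posrE// ler_ln ?posrE ?mulr_gt0.
  have : - ln (ln rho) <= e * ln (ln b).
    rewrite mulrC -ler_pdivrMr//; apply: le_trans llb.
    rewrite /y; set c := _ / e.
    suff : 0 <= k1.+2%:R * ln rho by lra.
    by rewrite mulr_ge0// ltW.
  lra.
have {hk}/hZ : (k1 <= k)%N by exact: leq_trans (leqW (leqnSn _)) hk.
have hl : upper_slope rho k = Num.sqrt (2 * ln k%:R) / Num.sqrt r2.
  by rewrite /upper_slope sqrtrM ?sqrtrV// ?mulr_ge0 ?(ltW lnk0)// ltW.
rewrite hl; set sk := Num.sqrt _; pose rk := Num.sqrt r2; rewrite -/rk.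
have sk0 : 0 < sk by rewrite sqrtr_gt0 mulr_gt0.
have rk0 : 0 < rk by rewrite sqrtr_gt0.
have sk2 : sk ^+ 2 = 2 * ln k%:R by rewrite sqr_sqrtr// mulr_ge0// ltW.
have rk2 : rk ^+ 2 = r2 by rewrite sqr_sqrtr// ltW.
pose bb := Num.sqrt b.
have bb0 : 0 < bb by rewrite sqrtr_gt0.
have bb2 : bb ^+ 2 = b by rewrite sqr_sqrtr// ltW.
have rkbb : rk <= bb by rewrite ler_wsqrtr.
have bbrk : bb <= rho * rk by nra.
have -> : ln k%:R = sk ^+ 2 / 2 :> R by rewrite sk2; field.
move=> h.
have {}h : Z <= (1 + e) * (sk / 2) * (b / rk + rk).
  have : sk / rk * Z < (1 + e) * ((sk / rk) ^+ 2 / 2 * b + sk ^+ 2 / 2) by lra.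
  rewrite mulrAC -mulrA -ltr_pdivlMl// ltr_pdivrMr//.
  have -> : sk^-1 * ((1 + e) * ((sk / rk) ^+ 2 / 2 * b + sk ^+ 2 / 2)) * rk =
    (1 + e) * (sk / 2) * (b / rk + rk) by field; rewrite !gt_eqF.
  exact: ltW.
apply: le_trans h _.
have h1 : b / rk + rk <= (2 + e) * bb.
  have : b / rk <= rho * bb by rewrite ler_pdivrMr// -bb2; nra.
  by rewrite /rho; lra.
have h2 : sk <= (1 + e) * Num.sqrt (2 * ln (ln b)).
  rewrite /sk -[1 + e]gtr0_norm; last by lra.
  rewrite -sqrtr_sqr -sqrtrM ?sqr_ge0// ler_wsqrtr//.
  have : 1 <= ln (ln b) by lra.
  by move: lnk; move: (ln k%:R) (ln (ln b)) => u v; nra.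
have -> : iterlog_scale b = Num.sqrt (2 * ln (ln b)) * bb.
  by rewrite /iterlog_scale mulrAC sqrtrM// mulr_ge0//; lra.
set L := Num.sqrt _ in h2 *.
have L0 : 0 <= L by rewrite sqrtr_ge0.
apply: (@le_trans _ _ ((1 + e) * (((1 + e) * L) / 2) * ((2 + e) * bb))).
  apply: ler_pM => //.
  - by rewrite mulr_ge0 ?divr_ge0//; lra.
  - by rewrite addr_ge0 ?divr_ge0 ?ltW.
  - by rewrite ler_wpM2l ?ler_wpM2r//; lra.
have Lb : 0 <= L * bb by rewrite mulr_ge0// ltW.
have -> : (1 + e) * ((1 + e) * L / 2) * ((2 + e) * bb) =
  ((1 + e) ^+ 2 * (1 + e / 2)) * (L * bb) by field.
by rewrite ler_wpM2r// (exprSr _ 2) ler_wpM2l ?sqr_ge0//; lra.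
Qed.

End UpperBound.

Section UpperAlmostSure.
Context (d : measure_display) (T : measurableType d) (R : realType).
Variables (P : probability T R) (p q r s : R).
Variables (X : nat -> {RV P >-> R}) (K : nat -> {RV P >-> nat})
  (E : nat -> {RV P >-> R}).
Hypotheses (hr : 0 < r < 1) (hpqr : p + q + r = 1)
  (hs : 0 <= s <= 1) (hX : is_ERWS p q r s X K E) (hcrit : p / (1 - r) = 3 / 4).
Implicit Types (g : seq bool) (n m k : nat).

Definition sign_hist n w : seq bool := signs (hist X n w).

Lemma doob_signs (F : seq bool -> R) c t : (forall g, 0 <= F g) ->
  (forall g, (0 < size g)%N -> next_mean F g <= F g) ->
  (forall b, F [:: b] <= c) -> 0 < t ->
  measurable [set w | exists2 n, (1 <= n)%N & t <= F (sign_hist n w)] /\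
  (P [set w | exists2 n, (1 <= n)%N & (t <= F (sign_hist n w))%R] <= (c / t)%:E)%E.
Proof.
move=> F0 Fs Fc t0.
have b01 : 0 <= 1 - r <= 1.
  by case/andP: hr => r0 r1; rewrite subr_ge0 (ltW r1) gerBl ltW.
have f0 h : 0 <= (F \o signs) h by exact: F0.
have ff h : (1 <= size h)%N -> hist_mean (1 - r) s (F \o signs) h <= (F \o signs) h.
  by move=> h0; apply: hist_mean_signs => // hh; exact: Fs.
have [mB PB] := doob_maximalZ hr hpqr hs hX hcrit f0 ff t0.
split; first exact: mB.
apply: le_trans PB _; rewrite lee_fin mulrC ler_wpM2r ?invr_ge0 ?(ltW t0)//.
rewrite /= /hist_mean /= mul0r add0r; case/andP: hs => s0 s1.
by have := Fc true; have := Fc false; nra.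
Qed.

(** Each exponential supermartingale exceeds [expR ((1 + e) * ln k)] with
    probability at most of order [k `^ (- (1 + e))], a summable sequence. *)
Lemma upper_borel_cantelli (e sg : R) : 0 < e -> e <= 1 -> `|sg| = 1 ->
  P.-negligible [set w | ~ exists k1, forall n k, (0 < n)%N -> (k1 <= k)%N ->
    upper_slope (1 + e) k * (sg * mart (sign_hist n w))
      - (1 + e) * (upper_slope (1 + e) k ^+ 2 / 2) * clock (size (sign_hist n w))
    < (1 + e) * ln k%:R].
Proof.
move=> e0 e1 sg1.
have rho1 : 1 < 1 + e by lra.
have e10 : 0 < e / 10 by lra.
have [k0 hk0] := upper_slope_small rho1 e10.
have sg2 : sg ^+ 2 = 1 by rewrite -real_normK ?num_real// sg1 expr1n.
pose l k := upper_slope (1 + e) (k + k0).+2.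
have l0 k : 0 <= l k by exact: sqrtr_ge0.
have le k : l k <= e / 10 by apply: hk0; rewrite -addn2 addnAC leq_addl.
pose f k := exp_mart (sg * l k) ((1 + e) * ((sg * l k) ^+ 2 / 2)).
pose t k := expR ((1 + e) * ln (k + k0).+2%:R) : R.
have t0 k : 0 < t k by exact: expR_gt0.
have hsl k : `|sg * l k| <= e / 10 by rewrite normrM sg1 mul1r ger0_norm.
have fs k g : (0 < size g)%N -> next_mean (f k) g <= f k g.
  by move=> g0; apply: exp_mart_super.
have fc k b : f k [:: b] <= expR 1.
  rewrite /f /exp_mart clock1 mulr0 subr0 ler_expR /mart walk_cons walk_nil addr0 /=.
  have := @norming_gt0 R 1; have := @norming_le R 1 isT.
  move: (norming 1) => a a1 a0.
  have sb : `|sign_of b| = 1 :> R by case: b; rewrite /sign_of ?normrN normr1.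
  apply: le_trans (ler_norm _) _.
  rewrite !normrM sg1 sb mul1r mulr1 (ger0_norm (l0 k)) (gtr0_norm a0).
  by apply: le_trans (ler_pM (l0 k) (ltW a0) (le k) a1) _; lra.
pose F k := [set w | exists2 n, (1 <= n)%N & t k <= f k (sign_hist n w)].
have mPF k := doob_signs (fun g => expR_ge0 _) (fs k) (fc k) (t0 k).
have mF k : measurable (F k) by case: (mPF k).
pose u k := expR (- (e * ln (k + k0).+1%:R)) : R.
pose C : R := expR 1 * e^-1.
have C0 : 0 < C by rewrite mulr_gt0 ?expR_gt0 ?invr_gt0.
have PF k : (P (F k) <= (C * (u k - u k.+1))%:E)%E.
  case: (mPF k) => _ /le_trans; apply; rewrite lee_fin /t -expRN /C -mulrA.
  by rewrite ler_wpM2l ?expR_ge0//; exact: zeta_telescope.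
have sumF : (\sum_(n <oo) P (F n) < +oo)%E.
  apply: (@le_lt_trans _ _ (C * u 0)%:E); last exact: ltry.
  apply: lime_le; first by apply: is_cvg_nneseries.
  apply: nearW => n; apply: (@le_trans _ _ (C * (u 0 - u n))%:E).
    elim: n => [|n ih]; first by rewrite big_geq// subrr mulr0.
    rewrite big_nat_recr//=; apply: (le_trans (leeD ih (PF n))).
    by rewrite -EFinD lee_fin; lra.
  by rewrite lee_fin ler_wpM2l ?(ltW C0)// gerBl expR_ge0.
have PL := lim_sup_set_cvg0 mF sumF.
exists (lim_sup_set F); split => //.
  by apply: bigcapT_measurable => n; apply: bigcup_measurable.
move=> w nw m _; apply: contrapT => nF; apply: nw; exists (m + k0).+2 => n k n0 hk.
have [j jm kE] : exists2 j, (m <= j)%N & k = (j + k0).+2.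
  by exists (k - k0.+2)%N; lia.
rewrite kE ltNge; apply/negP => hle; apply: nF; exists j => //.
exists n => //; rewrite /t /f /exp_mart ler_expR.
apply: le_trans hle _; rewrite exprMn sg2 mul1r /l.
by rewrite mulrA [upper_slope _ _ * sg]mulrC.
Qed.

Lemma mart_upper_ae (e sg : R) : 0 < e -> e <= 1 -> `|sg| = 1 ->
  P.-negligible [set w | ~ exists b0 : R, forall n, (0 < n)%N ->
    b0 <= clock (size (sign_hist n w)) ->
    sg * mart (sign_hist n w) <=
      (1 + e) ^+ 3 * iterlog_scale (clock (size (sign_hist n w)))].
Proof.
move=> e0 e1 sg1; apply: negligibleS (upper_borel_cantelli e0 e1 sg1).
move=> w nw [k1 hk1]; apply: nw.
exists (expR (expR (k1.+2%:R * ln (1 + e) + (- ln (ln (1 + e))) / e + 1))) => n n0 hb.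
by apply: (iterlog_upper e0 e1 hb) => k hk; have := hk1 n k n0 hk.
Qed.

End UpperAlmostSure.

(** * The lower half of the law for the martingale *)

Section Blocks.
Context {R : realType}.
Implicit Types (rho k : nat) (g h : seq bool).

(** The clock at the level [2 ^ (rho ^ k)] is of order [rho ^ k], so that a
    block, from one level to the next, is much longer for the clock than all the
    previous ones when [rho] is large. *)
Definition level rho k : nat := 2 ^ (rho ^ k).

Lemma level_gt0 rho k : (0 < level rho k)%N.
Proof. by rewrite expn_gt0. Qed.

Lemma level_mono rho k : (1 < rho)%N -> (level rho k <= level rho k.+1)%N.
Proof. by move=> r1; rewrite leq_exp2l// leq_exp2l. Qed.

Lemma ln2_bounds : 1 / 2 <= (ln 2 : R) <= 1.
Proof.
apply/andP; split; last by have := @le_ln1Dx R 1; rewrite (_ : 1 + 1 = 2 :> R)//; apply; lra.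
have := @le_ln1Dx R (- (1 / 2)); rewrite (_ : 1 + - (1 / 2) = 2^-1 :> R); last by field.
by rewrite lnV ?posrE// => h; lra.
Qed.

Lemma clock_level rho k :
  (rho ^ k)%:R / 2 - 1 <= (clock (level rho k) : R) <= (rho ^ k)%:R + 1.
Proof.
have l0 := level_gt0 rho k; have := @clock_ge R _ l0; have := @clock_le R _ l0.
rewrite /level natrX lnXn// -[ln 2 *+ _]mulr_natr.
have /andP[] := ln2_bounds; have : 0 <= (rho ^ k)%:R :> R by [].
by move: (rho ^ k)%:R (ln _) => M l *; apply/andP; split; nra.
Qed.

Definition block_var rho k : R := clock (level rho k.+1) - clock (level rho k).

Definition block_log rho k : R := ln (ln (clock (level rho k))).

Definition block_gain rho (kap : R) k : R :=
  Num.sqrt (2 * kap * block_log rho k.+1 * block_var rho k).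

Lemma le_power (a : R) rho : (1 < rho)%N ->
  exists k0, forall k, (k0 <= k)%N -> a * k%:R <= (rho ^ k)%:R.
Proof.
move=> r1; have r1' : 1 < rho%:R :> R by rewrite ltr1n.
have [k0 hk0] := le_geometric a r1'.
by exists k0 => k hk; rewrite natrX; exact: hk0.
Qed.

Lemma block_log_large rho (a : R) : (1 < rho)%N ->
  exists k0, forall k, (k0 <= k)%N -> a <= block_log rho k.
Proof.
move=> r1; have [k0 hk0] := le_power (2 * (expR (expR a) + 1)) r1.
exists k0.+1 => k hk; have := hk0 k (ltnW hk) => h.
have k1 : 1 <= k%:R :> R by rewrite ler1n; exact: leq_trans hk.
have /andP[c1 _] := clock_level rho k.
have e0 := expR_gt0 (expR a).
have : expR (expR a) <= clock (level rho k).
  by move: (expR (expR a)) (clock _) (_ ^ _)%:R k%:R h c1 k1 e0 => x y M z *; nra.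
move=> hc; rewrite /block_log -[leLHS]expRK ler_ln ?posrE ?expR_gt0//.
  by rewrite -[leLHS]expRK ler_ln ?posrE ?expR_gt0// (lt_le_trans e0).
rewrite (@lt_le_trans _ _ (expR a)) ?expR_gt0//.
by rewrite -[leLHS]expRK ler_ln ?posrE ?expR_gt0// (lt_le_trans e0).
Qed.

(** Divergence of the harmonic series. *)
Lemma prod_avoid_small rho (m : nat) (e : R) : (0 < rho)%N -> 0 < e ->
  exists j, \prod_(i < j) (1 - (2 * rho%:R * (m + i).+2%:R)^-1) <= e.
Proof.
move=> r0 e0.
have rr : 0 < rho%:R :> R by rewrite ltr0n.
have r1 : 1 <= rho%:R :> R by rewrite ler1n.
have bnd j : \prod_(i < j) (1 - (2 * rho%:R * (m + i).+2%:R)^-1) <=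
    expR (- ((2 * rho%:R)^-1 * (ln (m + j).+2%:R - ln m.+2%:R))) :> R.
  elim: j => [|j ih]; first by rewrite big_ord0 addn0 subrr mulr0 oppr0 expR0.
  rewrite big_ord_recr /=.
  have n1 : 1 <= (m + j).+2%:R :> R by rewrite ler1n.
  have q0 : 0 <= 1 - (2 * rho%:R * (m + j).+2%:R)^-1 :> R.
    by rewrite subr_ge0 invf_le1 ?mulr_gt0//; nra.
  apply: le_trans (ler_wpM2r q0 ih) _.
  apply: le_trans (ler_wpM2l (expR_ge0 _) (expR_ge1Dx _)) _.
  rewrite -expRD ler_expR [(2 * _ * _)^-1]invfM addnS.
  have c0 : 0 <= (2 * rho%:R)^-1 :> R by rewrite invr_ge0; lra.
  have := ler_wpM2l c0 (@ln_increment_le R (m + j).+2 isT).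
  move: (ln (m + j).+3%:R) (ln (m + j).+2%:R) (ln m.+2%:R) ((m + j).+2%:R^-1) ((2 * rho%:R)^-1) => *; lra.
have [n0 hn0] := ln_natr_ge (- ln e * (2 * rho%:R) + ln m.+2%:R).
exists n0; apply: le_trans (bnd n0) _.
rewrite -[leRHS]lnK ?posrE// ler_expR lerNl mulrC ler_pdivlMr; last by lra.
by rewrite lerBrDr; apply: hn0; lia.
Qed.

(** The increment over the block number [k] exceeds [block_gain rho kap k] with
    probability at least of order [k^-1]: in [walk_deviation] the exponent [x] is
    [2 * kap * ln (ln b)], where [b] is the clock at the end of the block, and
    [ln b] is of order [k]. The other conditions there hold for large [k]
    because the variance of the block grows geometrically, while the error term
    is exponentially small in the square root of the level. *)
Lemma block_success rho (kap dl : R) : (4 <= rho)%N -> 0 < kap -> kap < 1 ->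
  0 < dl -> dl <= 1 -> kap * (1 + 8 * dl) <= 1 ->
  exists k0, forall k (sg : R) g, (k0 <= k)%N -> `|sg| = 1 -> size g = level rho k ->
    `|mart g| <= 8 * iterlog_scale (clock (level rho k)) :> R ->
    (2 * rho%:R * k.+2%:R)^-1 <=
    iter (level rho k.+1 - level rho k) next_mean
      (fun h => (block_gain rho kap k <= sg * (mart h - mart g))%R%:R) g :> R.
Proof.
move=> r4 kap0 kap1 dl0 dl1 kd.
have r1 : (1 < rho)%N by exact: leq_trans r4.
pose e := dl ^+ 2 / 26.
have e0 : 0 < e by rewrite /e; nra.
have e1 : e <= 1 by rewrite /e; nra.
have e120 : 0 <= e / 120 by lra.
have E1 : (e / 120) ^+ 2 <= 1 by nra.
have ek : 1 <= (120 / e) ^+ 2 by rewrite exprn_ege1// ler_pdivlMr//; lra.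
have s2 : 1 < Num.sqrt 2 :> R by rewrite -[ltLHS]sqrtr1 ltr_sqrt; lra.
have rr : 4 <= rho%:R :> R by rewrite ler_nat.
pose A := 24 * rho%:R * (120 / e) ^+ 2.
pose c := e / 20 * Num.sqrt e.
have c0 : 0 < c by rewrite mulr_gt0 ?sqrtr_gt0//; lra.
have [k1 hk1] := le_power A r1.
have [k2 hk2] := le_power 4 r1.
have [k3 hk3] := block_log_large 1 r1.
have [k4 hk4] := block_log_large (6 / (dl ^+ 2 * kap)) r1.
have [k5 hk5] := le_geometric ((34 + 2 * rho%:R) / c) s2.
have [k6 hk6] := le_power k5%:R r1.
exists (1 + (k1 + (k2 + (k3 + (k4 + k6)))))%N => k sg g hk sg1 gk gm.
have [kp q1 q2 q3 [q4 q5 q6 q7]] : [/\ 1 <= k, k1 <= k, k2 <= k, k3 <= k &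
    [/\ k3 <= k.+1, k4 <= k.+1, k6 <= k & k.+2 <= 3 * k]]%N.
  by clear -hk; repeat split; lia.
have kR : 1 <= k%:R :> R by rewrite ler1n.
have {}hk1 := hk1 k q1.
have {}hk2 := hk2 k q2.
have hL := hk3 k q3.
have hL' := hk3 k.+1 q4.
have {}hk4 := hk4 k.+1 q5.
have {}hk6 := hk6 k q6.
have {}hk5 : (34 + 2 * rho%:R) / c * (rho ^ k)%:R <= Num.sqrt 2 ^+ (rho ^ k).
  apply: hk5; rewrite -(ler_nat R); apply: le_trans hk6.
  by rewrite ler_peMr.
have /andP[b1 b2] := clock_level rho k.
have /andP[b3 b4] := clock_level rho k.+1.
rewrite [(rho ^ k.+1)%N]expnS natrM in b3 b4.
have hsq : Num.sqrt (e * (level rho k)%:R) = Num.sqrt e * Num.sqrt 2 ^+ (rho ^ k).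
  rewrite sqrtrM ?(ltW e0)// /level natrX; congr (_ * _).
  by rewrite -[RHS]ger0_norm ?exprn_ge0// -sqrtr_sqr -exprM mulnC exprM sqr_sqrtr.
have hMk : (rho ^ k.+2)%:R = rho%:R * (rho%:R * (rho ^ k)%:R) :> R.
  by rewrite !expnS !natrM.
have lnk : ln ((rho ^ k.+2)%:R : R) <= k.+2%:R * rho%:R.
  rewrite natrX lnXn ?ltr0n ?(leq_trans _ r4)// -[ln _ *+ _]mulr_natl ler_wpM2l//.
  by rewrite ltW// ln_sublinear// ltr0n (leq_trans _ r4).
rewrite hMk in lnk.
set M := (rho ^ k)%:R : R in hk1 hk2 hk5 hk6 b1 b2 b3 b4 lnk hMk.
have M4 : 4 <= M by apply: le_trans hk2; lra.
set b := clock (level rho k) in b1 b2 gm.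
set b' := clock (level rho k.+1) in b3 b4.
have hVE : block_var rho k = b' - b by [].
set V := block_var rho k in hVE.
have V1 : M / 2 <= V by rewrite hVE; nra.
have V2 : V <= 2 * rho%:R * M by rewrite hVE; nra.
have V0 : 0 < V by lra.
set L := block_log rho k.+1 in hL' hk4.
have b'0 : 1 < b' by nra.
have lnb' : ln b' <= k.+2%:R * rho%:R.
  have M0 : 0 < M by move: M4; clear; lra.
  have rh0 : 0 < rho%:R :> R by rewrite ltr0n (leq_trans _ r4).
  apply: le_trans lnk; rewrite ler_ln ?posrE ?mulr_gt0 ?(lt_trans _ b'0)//.
  apply: le_trans b4 _; have : 4 <= rho%:R * M by move: M4 rr; clear; nra.
  by move: (rho%:R * M) rr => z; clear; nra.
have L3 : L <= k.+2%:R * rho%:R.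
  apply: le_trans lnb'; rewrite /L /block_log -/b'.
  by rewrite ltW// ln_sublinear// ln_gt0.
have k3R : k.+2%:R <= 3 * k%:R :> R.
  by rewrite -natrM ler_nat.
pose x := 2 * kap * L.
have x0 : 0 < x by rewrite /x !mulr_gt0// (lt_le_trans ltr01).
set y := block_gain rho kap k.
have yE : y = Num.sqrt (x * V) by [].
have y0 : 0 < y by rewrite yE sqrtr_gt0 mulr_gt0.
have y2 : y ^+ 2 = x * V by rewrite yE sqr_sqrtr// mulr_ge0// ltW.
have xE : y ^+ 2 / V = x by rewrite y2 mulfK// gt_eqF.
have lsub : (level rho k.+1 - level rho k + size g = level rho k.+1)%N.
  by rewrite gk subnK// level_mono.
have xL : x <= 2 * L.
  by rewrite /x -mulrA ler_wpM2l// ler_piMl ?(ltW kap1)// (le_trans ler01).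
have rk0 : 0 <= rho%:R * k%:R :> R by rewrite mulr_ge0.
have xM : 4 * x <= M * (e / 120) ^+ 2.
  have -> : (e / 120) ^+ 2 = ((120 / e) ^+ 2)^-1 by rewrite -exprVn invf_div.
  rewrite ler_pdivlMr ?(lt_le_trans ltr01)//.
  apply: le_trans hk1.
  apply: (@le_trans _ _ (8 * (3 * k%:R * rho%:R) * (120 / e) ^+ 2)).
    rewrite ler_wpM2r ?sqr_ge0//.
    have : k.+2%:R * rho%:R <= 3 * k%:R * rho%:R :> R by rewrite ler_wpM2r.
    by move: L3 xL; clear; lra.
  by rewrite /A; clear; move: (_ ^+ 2) => z; lra.
have dev := @walk_deviation R dl y sg (level rho k.+1 - level rho k) g.
cbv zeta in dev; rewrite lsub gk -/b -/b' -hVE xE -/e in dev.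
have {}dev := dev dl0 dl1 sg1 (level_gt0 _ _) V0 y0.
have yV : y / V <= e / 120.
  have yV0 : 0 <= y / V by rewrite divr_ge0 ?ltW.
  rewrite -(@ler_pXn2r _ 2)// expr_div_n y2.
  have -> : x * V / V ^+ 2 = x / V by field; rewrite gt_eqF.
  rewrite ler_pdivrMr// mulrC; apply: (@le_trans _ _ (M / 2 * (e / 120) ^+ 2)).
    by move: xM x0; clear; move: (_ ^+ 2) => z; lra.
  by rewrite ler_wpM2r// sqr_ge0.
have dx : 12 <= dl ^+ 2 * x.
  have p0 : 0 < dl ^+ 2 * kap by rewrite mulr_gt0// exprn_gt0.
  by move: hk4; rewrite ler_pdivrMr// /x; clear; lra.
have tiny : expR (- (e / 20) * Num.sqrt (e * (level rho k)%:R) + 2 * x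
    + `|mart g| + V) <= 1 / 8.
  apply: le_trans expRN3_le; rewrite ler_expR hsq.
  have s1 : iterlog_scale b <= 2 * b.
    have b0 : 0 < b by move: b1 M4; clear; lra.
    rewrite /iterlog_scale -[leRHS]gtr0_norm ?mulr_gt0//.
    rewrite -sqrtr_sqr ler_wsqrtr// exprMn.
    have lnb0 : 0 < ln b.
      rewrite ltNge; apply/negP => lnb.
      by have := hL; rewrite /block_log -/b (ln0 lnb) ler10.
    have : ln (ln b) <= b.
      by apply: ltW; apply: lt_trans (ln_sublinear lnb0) _; exact: ln_sublinear.
    by move: b0; clear; move: (ln (ln b)) => z; nra.
  have h1 : c * (Num.sqrt 2 ^+ (rho ^ k)) >= (34 + 2 * rho%:R) * M.
    by move: hk5; rewrite mulrAC ler_pdivrMr// mulrC [_ ^+ _ * c]mulrC.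
  have h2 : 2 * x <= M.
    apply: (@le_trans _ _ (4 * x)); first by rewrite ler_wpM2r ?(ltW x0)// ler_nat.
    by apply: le_trans xM _; rewrite ler_piMr// ler0n.
  have h3 : - (e / 20) * (Num.sqrt e * Num.sqrt 2 ^+ (rho ^ k)) =
      - (c * Num.sqrt 2 ^+ (rho ^ k)) by rewrite /c; ring.
  rewrite h3; move: gm h1 h2 V2 s1 b2 M4; clear.
  move: (c * _) `|mart g| (iterlog_scale b) (2 * x) => u z sc xx; lra.
apply: le_trans (dev yV dx tiny).
have lnb'0 : 0 < ln b' by exact: ln_gt0.
apply: (@le_trans _ _ (1 / 2 * expR (- L))).
  rewrite expRN /L /block_log -/b' lnK ?posrE// div1r -invfM.
  rewrite lef_pV2 ?posrE ?mulr_gt0// ?ltr0n// ?(leq_trans _ r4)//.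
  by rewrite -mulrA ler_wpM2l// mulrC.
rewrite ler_wpM2l ?divr_ge0// ler_expR mulNr lerN2 /x.
have -> : (1 / 2 + 4 * dl) * (2 * kap * L) = (kap * (1 + 8 * dl)) * L by field.
by rewrite ler_piMl// (le_trans ler01).
Qed.

End Blocks.

Section AvoidingPaths.
Context {R : realType}.
Variables (rho : nat) (kap sg : R).
Implicit Types (g h u : seq bool) (m j k n : nat).

(** Only the blocks which do not start too far from 0 are counted as failing. *)
Definition block_failure k g : bool :=
  let g' := drop (level rho k.+1 - level rho k) g in
  (`|mart g'| <= 8 * iterlog_scale (clock (level rho k)) :> R) &&
  ~~ (block_gain rho kap k <= sg * (mart g - mart g')).

Fixpoint all_failures m j g : bool :=
  if j is j'.+1 then
    all_failures m j' (drop (level rho (m + j').+1 - level rho (m + j')) g)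
    && block_failure (m + j') g
  else true.

(** Conditioning at the beginning of each block makes the probabilities of
    failure multiply. *)
Lemma all_failures_prob m j g (q : nat -> R) :
  (1 < rho)%N -> size g = level rho m ->
  (forall k, (m <= k)%N -> q k <= 1) ->
  (forall k h, (m <= k)%N -> size h = level rho k ->
    `|mart h| <= 8 * iterlog_scale (clock (level rho k)) :> R ->
    q k <= iter (level rho k.+1 - level rho k) next_mean
      (fun u => (block_gain rho kap k <= sg * (mart u - mart h))%R%:R) h) ->
  iter (level rho (m + j) - level rho m) next_mean (fun u => (all_failures m j u)%:R) g
  <= \prod_(i < j) (1 - q (m + i)%N).
Proof.
move=> r1 gm q1 hq; elim: j => [|j ih].
  by rewrite addn0 subnn big_ord0.
set a := level rho (m + j) in ih.
have ma : (level rho m <= a)%N by rewrite leq_exp2l// leq_exp2l// leq_addr.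
have ab : (a <= level rho (m + j).+1)%N by exact: level_mono.
have -> : (level rho (m + j.+1) - level rho m =
    (a - level rho m) + (level rho (m + j).+1 - a))%N.
  by rewrite addnS; lia.
rewrite iterD; set c := (level rho (m + j).+1 - a)%N.
rewrite big_ord_recr /= mulrC.
have q0 : 0 <= 1 - q (m + j)%N by rewrite subr_ge0 q1// leq_addr.
apply: le_trans (ler_wpM2l q0 ih).
rewrite -iter_meanZ; apply: iter_mean_le => h hs.
set v := h ++ g.
have vs : size v = level rho (m + j) by rewrite size_cat hs gm subnK.
have [good|notgood] := boolP (all_failures m j v &&
  (`|mart v| <= 8 * iterlog_scale (clock (level rho (m + j))) :> R)); last first.
  apply: (@le_trans _ _ 0); last by rewrite mulr_ge0.
  rewrite -(iter_mean_cst c 0 v); apply: iter_mean_le => u us.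
  rewrite /block_failure -/a -/c drop_size_cat//.
  by move: notgood; rewrite andbA; case: (_ && _).
have /andP[av gv] := good; rewrite av mulr1.
apply: (@le_trans _ _ (1 + -1 * iter c next_mean
    (fun u => (block_gain rho kap (m + j) <= sg * (mart u - mart v))%R%:R) v)).
  rewrite -iter_meanZ -[X in X + _](iter_mean_cst c 1 v) -iter_meanD.
  apply: iter_mean_le => u us; rewrite /block_failure -/a -/c drop_size_cat//.
  by rewrite av gv /=; case: (block_gain _ _ _ <= _); rewrite /= ?mulr1 ?mulr0 ?subrr ?addr0.
by rewrite mulN1r lerD2l lerN2; apply: hq => //; rewrite leq_addr.
Qed.

End AvoidingPaths.

Section LowerAlmostSure.
Context (d : measure_display) (T : measurableType d) (R : realType).
Variables (P : probability T R) (p q r s : R).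
Variables (X : nat -> {RV P >-> R}) (K : nat -> {RV P >-> nat})
  (E : nat -> {RV P >-> R}).
Hypotheses (hr : 0 < r < 1) (hpqr : p + q + r = 1)
  (hs : 0 <= s <= 1) (hX : is_ERWS p q r s X K E) (hcrit : p / (1 - r) = 3 / 4).
Implicit Types (g : seq bool) (n m j k : nat).

(** Events depending on the first [L] signs are at most as probable for the walk
    with stops as for the walk of signs. The conditional probability [F] of the
    event given the signs already known is harmonic for the walk of signs, and
    the event is that [F] reaches 1. *)
Lemma sign_hist_path_prob (A : pred (seq bool)) L (c : R) : (0 < L)%N ->
  (forall b, iter (L - 1) next_mean (fun u => (A u)%:R) [:: b] <= c) ->
  exists B, [/\ measurable B,
    [set w | exists2 n, size (sign_hist X n w) = L & A (sign_hist X n w)] `<=` B &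
    (P B <= c%:E)%E].
Proof.
move=> L0 hc.
pose F g : R := iter (L - size g) next_mean (fun u => (A u)%:R) (drop (size g - L) g).
have F0 g : 0 <= F g by apply: iter_mean_ge0.
have Fs g : (0 < size g)%N -> next_mean F g <= F g.
  move=> _; rewrite /F; have [gL|Lg] := ltnP (size g) L.
    rewrite (eqP (ltnW gL)) drop0 -(subnSK gL) iterS.
    by apply: next_mean_le => b /=; rewrite (eqP gL) drop0.
  rewrite (eqP Lg) /= /next_mean /= !subSn// !(eqP (leqW Lg)) /=.
  by move: (drift g) ((A _)%:R) => dd y; lra.
have Fc b : F [:: b] <= c by rewrite /F /= (eqP L0) /=; exact: hc.
have [mB PB] := doob_signs hr hpqr hs hX hcrit F0 Fs Fc ltr01.
eexists; split; first exact: mB.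
  move=> w [n nL An]; exists n.
    by case: n nL {An} => //= L00; rewrite -L00 in L0.
  by rewrite /F nL subnn /= drop0 An.
by rewrite divr1 in PB.
Qed.

Lemma sign_hist_drop n m w : (m <= n)%N ->
  drop (size (sign_hist X n w) - size (sign_hist X m w)) (sign_hist X n w) =
  sign_hist X m w.
Proof.
move=> mn; rewrite -(subnK mn); elim: (n - m)%N => [|k ih].
  by rewrite subnn drop0.
have hm := @signs_mono _ _ _ _ X m (k + m) w (leq_addl k m).
rewrite addSn /sign_hist /=; case: (step_code _) => [b|] //=.
by rewrite subSn.
Qed.

(** The number of signs starts at 0 and increases by at most 1, so it takes
    every value. *)
Lemma sign_hist_level w L :
  (forall M, exists n, (M < size (sign_hist X n w))%N) ->
  exists n, size (sign_hist X n w) = L.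
Proof.
move=> unb; have ex : exists n, (L <= size (sign_hist X n w))%N.
  by have [n hn] := unb L; exists n; exact: ltnW.
case: (ex_minnP ex) => -[|n] hL hmin.
  by exists 0%N; move: hL; rewrite leqn0 => /eqP ->.
exists n.+1; apply/eqP; rewrite eqn_leq hL andbT.
have : (size (sign_hist X n w) < L)%N.
  by rewrite ltnNge; apply/negP => /hmin; rewrite ltnn.
by rewrite /sign_hist /=; case: (step_code _) => [b|] //= h; rewrite ltnW.
Qed.

(** Failing in all the blocks from some level on has probability zero, since the
    probabilities of success have a divergent sum. *)
Lemma block_success_ae (rho : nat) (kap sg dl : R) : (4 <= rho)%N ->
  0 < kap -> kap < 1 -> 0 < dl -> dl <= 1 -> kap * (1 + 8 * dl) <= 1 -> `|sg| = 1 ->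
  P.-negligible [set w | ~ forall m, exists k n n', [/\ (m <= k)%N,
    size (sign_hist X n' w) = level rho k, size (sign_hist X n w) = level rho k.+1 &
    (`|mart (sign_hist X n' w)| <= 8 * iterlog_scale (clock (level rho k)) :> R) ->
    block_gain rho kap k <= sg * (mart (sign_hist X n w) - mart (sign_hist X n' w))]].
Proof.
move=> r4 kap0 kap1 dl0 dl1 kd sg1.
have r1 : (1 < rho)%N by exact: leq_trans r4.
have [k0 hk0] := block_success r4 kap0 kap1 dl0 dl1 kd.
pose N m := [set w | forall j, exists2 n, size (sign_hist X n w) = level rho (m + j) &
  all_failures rho kap sg m j (sign_hist X n w)].
have Nneg m : (k0 <= m)%N -> P.-negligible (N m).
  move=> k0m; apply: negligible_small => e e0.
  have [j hj] := @prod_avoid_small R rho m e (ltnW r1) e0.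
  have hq k h : (m <= k)%N -> size h = level rho k ->
      `|mart h| <= 8 * iterlog_scale (clock (level rho k)) :> R ->
      (2 * rho%:R * k.+2%:R)^-1 <= iter (level rho k.+1 - level rho k) next_mean
      (fun u => (block_gain rho kap k <= sg * (mart u - mart h))%R%:R) h :> R.
    by move=> mk hs' hm; apply: hk0 => //; exact: leq_trans mk.
  have q1 k : (m <= k)%N -> (2 * rho%:R * k.+2%:R)^-1 <= 1 :> R.
    move=> _; rewrite invf_le1 ?mulr_gt0 ?ltr0n// ?(leq_trans _ r4)//.
    by rewrite -!natrM ler1n !muln_gt0 (leq_trans _ r4).
  have l0 := level_gt0 rho (m + j).
  have [|B [mB AB PB]] := @sign_hist_path_prob (all_failures rho kap sg m j)
      (level rho (m + j)) e l0.
    move=> b; apply: le_trans hj.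
    have lm := level_gt0 rho m.
    have lmj : (level rho m <= level rho (m + j))%N.
      by rewrite leq_exp2l// leq_exp2l// leq_addr.
    have -> : (level rho (m + j) - 1 =
       (level rho m - 1) + (level rho (m + j) - level rho m))%N by clear -lm lmj; lia.
    rewrite iterD; rewrite -[leRHS](iter_mean_cst (level rho m - 1) _ [:: b]).
    apply: iter_mean_le => h hs'.
    apply: (@all_failures_prob _ rho kap sg m j _
      (fun k => (2 * rho%:R * k.+2%:R)^-1) r1 _ q1 hq).
    by rewrite size_cat hs' /= subnK.
  by exists B; split => // w hw; apply: AB; exact: hw.
apply: (@negligibleS _ _ _ _
  ([set w | exists M, forall n, (size (signs (hist X n w)) <= M)%N] `|`
   \bigcup_i N (k0 + i)%N)); last first.
  apply: negligibleU; first exact: (ones_unbounded_ae hr hpqr hs hX hcrit).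
  by apply: negligible_bigcup => i; apply: Nneg; rewrite leq_addr.
move=> w nw /=; apply: contrapT => /not_orP[nM nN]; apply: nw => m.
have unb M : exists n, (M < size (sign_hist X n w))%N.
  apply: contrapT => hM; apply: nM; exists M => n; rewrite leqNgt; apply/negP => h.
  by apply: hM; exists n.
apply: contrapT => fails; apply: nN; exists m => // j.
suff : forall n, size (sign_hist X n w) = level rho (k0 + m + j) ->
    all_failures rho kap sg (k0 + m) j (sign_hist X n w).
  by have [n hn] := sign_hist_level (level rho (k0 + m + j)) unb; exists n; auto.
elim: j => // j ih n hn /=.
have [n' hn'] := sign_hist_level (level rho (k0 + m + j)) unb.
rewrite addnS in hn.
have n'n : (n' <= n)%N.
  rewrite leqNgt; apply/negP => nn'.
  have := signs_mono X w (ltnW nn'); rewrite -/(sign_hist X n w) -/(sign_hist X n' w).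
  by rewrite hn hn' leqNgt ltn_exp2l// ltn_exp2l// ltnSn.
have hd := sign_hist_drop w n'n; rewrite hn hn' in hd.
rewrite /block_failure hd ih//=; apply: contrapT => hb; apply: fails.
exists (k0 + m + j)%N, n, n'; split => //.
  by rewrite addnAC leq_addl.
by move=> hm; apply: contrapT => hg; apply: hb; rewrite hm; apply/negP.
Qed.

End LowerAlmostSure.

Section LowerBound.
Context {R : realType}.

(** The parameters of the blocks. The loss due to [kap], to the time before the
    block and to the position at its beginning are each a small fraction of [e];
    the last two are of order [1 / rho] and [1 / Num.sqrt rho], whence the choice of
    a square [rho] of order [e ^- 2]. *)
Lemma block_gain_large (e : R) : 0 < e -> e <= 1 ->
  exists (rho : nat) (kap dl : R),
  [/\ (4 <= rho)%N, 0 < kap < 1, 0 < dl <= 1, kap * (1 + 8 * dl) <= 1 &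
   exists k0, forall k, (k0 <= k)%N ->
     (1 - e) * iterlog_scale (clock (level rho k.+1))
       + 8 * iterlog_scale (clock (level rho k)) <= block_gain rho kap k].
Proof.
move=> e0 e1.
pose n := (Num.truncn (48 / e)).+1.
have ne : 48 / e < n%:R by exact: real_truncnS_gt (num_real _).
have n48 : 48 <= n%:R :> R.
  by apply: le_trans (ltW ne); rewrite ler_pdivlMr//; lra.
have ne' : 48 < n%:R * e by rewrite -ltr_pdivrMr.
have [rho rhoE] : exists rho : nat, rho%:R = n%:R ^+ 2 :> R.
  by exists (n ^ 2)%N; rewrite natrX.
have rr : 2304 <= rho%:R :> R by rewrite rhoE; nra.
have re : 20 <= rho%:R * e by rewrite rhoE; nra.
have r4 : (4 <= rho)%N by rewrite -(ler_nat R); lra.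
have r1 : (1 < rho)%N by exact: leq_trans r4.
pose u := 1 - e / 4.
have u0 : 3 / 4 <= u by rewrite /u; lra.
have u1 : u < 1 by rewrite /u; lra.
exists rho, (u ^+ 2), (e / 64); split => //.
- by apply/andP; split; nra.
- by apply/andP; split; lra.
- have : u ^+ 2 <= 1 - e / 4 by rewrite /u; nra.
  have : 0 < 1 + 8 * (e / 64) by lra.
  move: (u ^+ 2) => z; nra.
have [k1 hk1] := @le_power R 4 rho r1.
have [k2 hk2] := @block_log_large R rho 1 r1.
exists (1 + (k1 + k2))%N => k hk.
have [q0 q1 q2 q3] : [/\ 1 <= k, k1 <= k, k2 <= k & k2 <= k.+1]%N.
  by clear -hk; split; lia.
have kR : 1 <= k%:R :> R by rewrite ler1n.
have {}hk1 := hk1 k q1.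
have L1 := hk2 k q2; have L2 := hk2 k.+1 q3.
have /andP[b1 b2] := @clock_level R rho k.
have /andP[b3 b4] := @clock_level R rho k.+1.
rewrite expnS natrM in b3 b4.
have cm : clock (level rho k) <= clock (level rho k.+1) :> R.
  have := @clock_mono R (level rho k.+1 - level rho k) _ (level_gt0 rho k).
  by rewrite subnK// level_mono.
rewrite /block_gain /iterlog_scale /block_var /block_log in L1 L2 *.
move: (clock (level rho k)) (clock (level rho k.+1)) (rho ^ k)%:R
  hk1 L1 L2 b1 b2 b3 b4 cm => b b' M hk1 L1 L2 b1 b2 b3 b4 cm {hk2 k1 k2 hk q1 q2 q3}.
have LL : ln (ln b) <= ln (ln b').
  have lnpos (x : R) : 1 <= ln (ln x) -> 0 < ln x.
    move=> h; rewrite ltNge; apply/negP => lx; move: h; rewrite (ln0 lx) ler10.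
    by [].
  have c0 (x : R) : 0 < ln x -> 0 < x.
    by move=> lx; rewrite ltNge; apply/negP => /ln0 h; rewrite h ltxx in lx.
  have p1 := lnpos _ L1; have p2 := lnpos _ L2.
  have P1 := c0 _ p1; have P2 := c0 _ p2.
  by rewrite !ler_ln ?posrE.
move: (ln (ln b)) (ln (ln b')) L1 L2 LL => l l' L1 L2 LL.
have M4 : 4 <= M by lra.
have bb : rho%:R * b <= 5 * b'.
  by move: b2 b3 M4 rr; clear; nra.
have b0 : 0 < b by move: b1 M4; clear; lra.
have b'0 : 0 < b' by exact: lt_le_trans cm.
have l0 : 0 < l by exact: lt_le_trans L1.
have l'0 : 0 < l' by exact: lt_le_trans L2.
set S := Num.sqrt (2 * b' * l').
have S0 : 0 <= S by exact: sqrtr_ge0.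
have h1 : Num.sqrt (2 * b * l) <= 3 / n%:R * S.
  rewrite /S -[3 / _]ger0_norm ?divr_ge0// -sqrtr_sqr -sqrtrM ?sqr_ge0//.
  have rho0 : 0 < rho%:R :> R by rewrite ltr0n (leq_trans _ r4).
  rewrite ler_wsqrtr// expr_div_n -rhoE [leRHS]mulrAC ler_pdivlMr//.
  have rb0 : 0 <= rho%:R * b by rewrite mulr_ge0 ?ltW.
  have : rho%:R * b * l <= 5 * b' * l' by apply: ler_pM => //; exact: ltW.
  have : 0 < b' * l' by rewrite mulr_gt0.
  by clear; lra.
have h2 : u ^+ 2 * S <= Num.sqrt (2 * u ^+ 2 * l' * (b' - b)).
  rewrite /S -[u ^+ 2 in leLHS]ger0_norm ?sqr_ge0// -sqrtr_sqr -sqrtrM ?sqr_ge0//.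
  rewrite ler_wsqrtr//.
  have h3 : u ^+ 2 * b' <= b' - b.
    have : b <= e / 4 * b'.
      rewrite -(@ler_pM2l _ rho%:R); last by rewrite ltr0n (leq_trans _ r4).
      apply: le_trans bb _; rewrite mulrA ler_wpM2r ?(ltW b'0)//.
      by move: re; clear; lra.
    have : u ^+ 2 <= 1 - e / 4 by rewrite /u; move: e0 e1; clear; nra.
    by move: b'0; clear; move: (u ^+ 2) => z; nra.
  have -> : (u ^+ 2) ^+ 2 * (2 * b' * l') = 2 * u ^+ 2 * l' * (u ^+ 2 * b') by ring.
  have c0 : 0 <= 2 * u ^+ 2 * l' by rewrite mulr_ge0 ?(ltW l'0)// mulr_ge0 ?sqr_ge0.
  exact: ler_wpM2l.
apply: le_trans h2.
have h4 : 8 * (3 / n%:R * S) <= e / 2 * S.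
  have -> : 8 * (3 / n%:R * S) = 24 / n%:R * S by ring.
  rewrite ler_wpM2r// ler_pdivrMr; last by rewrite (lt_le_trans _ n48).
  by move: ne'; clear; lra.
have h5 : (1 - e / 2) * S <= u ^+ 2 * S.
  by rewrite ler_wpM2r// /u; move: e0 e1; clear; nra.
by move: h1 h4 h5; clear; lra.
Qed.

End LowerBound.

Section MartLower.
Context (d : measure_display) (T : measurableType d) (R : realType).
Variables (P : probability T R) (p q r s : R).
Variables (X : nat -> {RV P >-> R}) (K : nat -> {RV P >-> nat})
  (E : nat -> {RV P >-> R}).
Hypotheses (hr : 0 < r < 1) (hpqr : p + q + r = 1)
  (hs : 0 <= s <= 1) (hX : is_ERWS p q r s X K E) (hcrit : p / (1 - r) = 3 / 4).

(** At the end of a successful block, the martingale is at least the gain of the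
    block minus its absolute value at the beginning, which the upper half of the
    law bounds; the constant 8 is the value of [(1 + e) ^+ 3] at [e = 1]. *)
Lemma mart_lower_ae (e sg : R) : 0 < e -> e <= 1 -> `|sg| = 1 ->
  P.-negligible [set w | ~ forall m, exists2 n, (m <= n)%N &
    (1 - e) * iterlog_scale (clock (size (sign_hist X n w))) <=
    sg * mart (sign_hist X n w)].
Proof.
move=> e0 e1 sg1.
have [rho [kap [dl [r4 /andP[kap0 kap1] /andP[dl0 dl1] kd [k0 hk0]]]]] :=
  block_gain_large e0 e1.
have r1 : (1 < rho)%N by exact: leq_trans r4.
have n1 : `|1 : R| = 1 by rewrite normr1.
have nN1 : `|-1 : R| = 1 by rewrite normrN normr1.
apply: negligibleS (negligibleU (negligibleU
  (mart_upper_ae hr hpqr hs hX hcrit ltr01 (lexx _) n1)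
  (mart_upper_ae hr hpqr hs hX hcrit ltr01 (lexx _) nN1))
  (block_success_ae hr hpqr hs hX hcrit r4 kap0 kap1 dl0 dl1 kd sg1)).
move=> w nw /=; apply: contrapT => /not_orP[/not_orP[/contrapT[c1 U1] /contrapT[c2 U2]]].
move=> /contrapT succ; apply: nw => m.
have [k1 hk1] := @le_power R (2 * (Num.max c1 c2 + 1)) rho r1.
have [k [n [n' [hk hn' hn hg]]]] := succ (1 + (k0 + (k1 + m)))%N.
have [q0 q1 q2 q3] : [/\ 1 <= k, k0 <= k, k1 <= k & m <= k]%N.
  by clear -hk; split; lia.
have kR : 1 <= k%:R :> R by rewrite ler1n.
have nsize : (size (sign_hist X n w) <= n)%N.
  by rewrite -{2}(size_hist X n w) size_signs.
have lev j : (j <= level rho j)%N.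
  exact: leq_trans (ltnW (ltn_expl j r1)) (ltnW (ltn_expl _ (ltnSn 1))).
have n'0 : (0 < n')%N.
  by case: n' hn' {hg} => // h; have := level_gt0 rho k; rewrite -h.
exists n.
  by rewrite (leq_trans _ nsize)// hn (leq_trans q3)// (leq_trans (lev k))// level_mono.
have cl : Num.max c1 c2 <= clock (level rho k).
  have /andP[b1 _] := @clock_level R rho k.
  have := hk1 k q2.
  have [|neg] := leP 0 (Num.max c1 c2 + 1); last first.
    move=> _; apply: le_trans b1; have : 0 <= (rho ^ k)%:R :> R by [].
    by move: (Num.max c1 c2) neg => z; lra.
  by move: (Num.max c1 c2) b1 => z; nra.
have c1l : c1 <= clock (size (sign_hist X n' w)).
  by rewrite hn'; apply: le_trans cl; rewrite le_max lexx.
have c2l : c2 <= clock (size (sign_hist X n' w)).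
  by rewrite hn'; apply: le_trans cl; rewrite le_max lexx orbT.
have m1 := U1 n' n'0 c1l; have m2 := U2 n' n'0 c2l.
rewrite hn' mul1r mulN1r in m1 m2.
have e8 : (1 + 1) ^+ 3 = 8 :> R by ring.
rewrite e8 in m1 m2.
have habs : `|mart (sign_hist X n' w)| <= 8 * iterlog_scale (clock (level rho k)) :> R.
  by rewrite ler_norml m1 andbT lerNl.
have := hg habs; rewrite mulrBr => hgain.
have hmm : sg * mart (sign_hist X n' w) >= - `|mart (sign_hist X n' w)|.
  by rewrite lerNl -mulrN (le_trans (ler_norm _))// normrM sg1 mul1r normrN.
have := hk0 k q1; rewrite hn; move: hgain hmm habs; lra.
Qed.

End MartLower.

(** * Limits superior and the change of scale *)

Section Limsup.
Context {R : realType}.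
Implicit Types (a b c u v : nat -> R) (l : R).

(** The limit superior of a real sequence, when finite. *)
Definition has_limsup a l :=
  (forall e, 0 < e -> exists m, forall n, (m <= n)%N -> a n <= l + e) /\
  (forall e, 0 < e -> forall m, exists2 n, (m <= n)%N & l - e <= a n).

Lemma limn_esup_EFin a l : has_limsup a l -> limn_esup (fun n => (a n)%:E) = l%:E.
Proof.
move=> [up low]; rewrite limn_esup_lim; apply/eqP; rewrite eq_le; apply/andP; split.
  apply/lee_addgt0Pr => e e0; rewrite -EFinD.
  have [m hm] := up e e0.
  apply: lime_le; first exact: is_cvg_esups.
  exists m => // n /= mn; apply: ge_ereal_sup => _ [k /= nk <-].
  by rewrite lee_fin hm// (leq_trans mn).
apply/lee_subgt0Pr => e e0; rewrite -EFinB.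
apply: lime_ge; first exact: is_cvg_esups.
apply: nearW => n; have [k nk hk] := low e e0 n.
by apply: le_trans (ereal_sup_ubound _); [|by exists k; first exact: nk];
  rewrite lee_fin.
Qed.

Lemma limn_einf_EFin a l : has_limsup (fun n => - a n) l ->
  (- limn_einf (fun n => (a n)%:E))%E = l%:E.
Proof. by move=> h; rewrite /limn_einf oppeK; exact: limn_esup_EFin. Qed.

Lemma has_limsup_eq a b l m : (forall n, (m <= n)%N -> a n = b n) ->
  has_limsup a l -> has_limsup b l.
Proof.
move=> ab [up low]; split=> e e0.
  have [k hk] := up e e0; exists (maxn m k) => n; rewrite geq_max => /andP[mn kn].
  by rewrite -ab// hk.
move=> k; have [n] := low e e0 (maxn m k); rewrite geq_max => /andP[mn kn] h.
by exists n => //; rewrite -ab.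
Qed.

Lemma has_limsupM a c (c0 : R) : has_limsup a 1 -> has_limsup (fun n => - a n) 1 ->
  0 <= c0 -> c n @[n --> \oo] --> c0 -> has_limsup (fun n => a n * c n) c0.
Proof.
move=> [up low] [up' _] c00 /cvgrPdist_le hc.
have [m1 h1] := up 1 ltr01; have [m2 h2] := up' 1 ltr01.
have key e : 0 < e -> exists m, forall n, (m <= n)%N -> `|a n * (c n - c0)| <= e.
  move=> e0; have e2 : 0 < e / 2 by lra.
  have [m3 _ h3] := hc _ e2.
  exists (maxn m1 (maxn m2 m3)) => n; rewrite !geq_max => /and3P[n1 n2 n3].
  rewrite normrM.
  have ha : `|a n| <= 2.
    by have := h1 n n1; have := h2 n n2; rewrite ler_norml => *; apply/andP; split; lra.
  have hd : `|c n - c0| <= e / 2 by rewrite distrC; exact: h3.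
  by apply: le_trans (ler_pM _ _ ha hd) _ => //; lra.
have c1 : 0 < 2 * (c0 + 1) by lra.
have small e : 0 < e -> e / (2 * (c0 + 1)) * c0 <= e / 2.
  move=> e0; rewrite -subr_ge0.
  have -> : e / 2 - e / (2 * (c0 + 1)) * c0 = e / (2 * (c0 + 1)).
    by field; rewrite gt_eqF//; lra.
  by rewrite divr_ge0 ?ltW.
split=> e e0.
  have e2 : 0 < e / 2 by lra.
  have e' : 0 < e / (2 * (c0 + 1)) by rewrite divr_gt0.
  have [k1 g1] := key _ e2; have [k2 g2] := up _ e'.
  exists (maxn k1 k2) => n; rewrite geq_max => /andP[n1 n2].
  have -> : a n * c n = a n * c0 + a n * (c n - c0) by ring.
  have := g1 n n1; rewrite ler_norml => /andP[_ h].
  have := ler_wpM2r c00 (g2 n n2).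
  have := small e e0.
  by move: (a n * (c n - c0)) h => z *; lra.
move=> m.
have e2 : 0 < e / 2 by lra.
have e' : 0 < e / (2 * (c0 + 1)) by rewrite divr_gt0.
have [k1 g1] := key _ e2; have [n] := low _ e' (maxn m k1).
rewrite geq_max => /andP[n1 n2] h; exists n => //.
have -> : a n * c n = a n * c0 + a n * (c n - c0) by ring.
have := g1 n n2; rewrite ler_norml => /andP[h' _].
have := ler_wpM2r c00 h.
have := small e e0.
by move: (a n * (c n - c0)) h' => z *; lra.
Qed.

Lemma has_limsup_sqr a l : 0 <= l -> has_limsup a l -> has_limsup (fun n => - a n) l ->
  has_limsup (fun n => a n ^+ 2) (l ^+ 2).
Proof.
move=> l0 [up low] [up' _]; split=> e e0; pose e' := Num.min 1 (e / (2 * l + 1)).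
all: have l1 : 0 < 2 * l + 1 by lra.
all: have e'0 : 0 < e' by rewrite lt_min ltr01 divr_gt0.
all: have e'1 : e' <= 1 by rewrite ge_min lexx.
all: have e'2 : e' * (2 * l + 1) <= e
  by rewrite -ler_pdivlMr// ge_min lexx orbT.
  have [m1 h1] := up e' e'0; have [m2 h2] := up' e' e'0.
  exists (maxn m1 m2) => n; rewrite geq_max => /andP[n1 n2].
  by have := h1 n n1; have := h2 n n2; move: (a n) => x *; nra.
move=> m; have [n mn h] := low e' e'0 m; exists n => //.
have [p|p] := leP 0 (l - e'); last by have := sqr_ge0 (a n); nra.
by move: (a n) h => x *; nra.
Qed.

Definition oscillates (a : nat -> R) (l : R) :=
  has_limsup a l /\ has_limsup (fun n => - a n) l.

Lemma oscillatesM a c (c0 : R) : oscillates a 1 -> 0 <= c0 ->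
  c n @[n --> \oo] --> c0 -> oscillates (fun n => a n * c n) c0.
Proof.
move=> [a1 a2] c00 hc; split; first exact: has_limsupM.
have a1' : has_limsup (fun n => - - a n) 1.
  by apply: (@has_limsup_eq a _ _ 0) => // n _; rewrite opprK.
apply: (@has_limsup_eq (fun n => - a n * c n) _ _ 0) => [n _|].
  by rewrite mulNr.
exact: has_limsupM.
Qed.

Lemma oscillates_eq a b l m : (forall n, (m <= n)%N -> a n = b n) ->
  oscillates a l -> oscillates b l.
Proof.
move=> ab [a1 a2]; split; first exact: has_limsup_eq ab a1.
by apply: (has_limsup_eq (m := m) _ a2) => n mn; rewrite (ab n mn).
Qed.

Lemma oscillates_sqr (a c : nat -> R) l : 0 <= l ->
  (exists m, forall n, (m <= n)%N -> 0 <= c n) ->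
  oscillates (fun n => a n / Num.sqrt (c n)) l ->
  limn_esup (fun n => (a n ^+ 2 / c n)%:E) = (l ^+ 2)%:E.
Proof.
move=> l0 [m hm] [up low]; apply: limn_esup_EFin.
apply: (has_limsup_eq (m := m) _ (has_limsup_sqr l0 up low)) => n mn.
by rewrite expr_div_n sqr_sqrtr// hm.
Qed.

End Limsup.

Section Ratios.
Context {R : realType}.
Implicit Types (u v : nat -> R).

Lemma cvgy_ln u : u n @[n --> \oo] --> +oo -> ln (u n) @[n --> \oo] --> +oo.
Proof.
move=> /cvgryPge hu; apply/cvgryPge => A; have [m _ hm] := hu (expR A).
exists m => // n /= mn; have := hm n mn => h.
by rewrite -[A]expRK ler_ln ?posrE ?expR_gt0// (lt_le_trans (expR_gt0 A)).
Qed.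

Lemma cvgy_inv u : u n @[n --> \oo] --> +oo -> (u n)^-1 @[n --> \oo] --> (0 : R).
Proof.
move=> uy; apply/cvgrPdist_le => e e0; have /cvgryPge/(_ e^-1)[m _ hm] := uy.
exists m => // n /= mn; have h := hm n mn.
have l0 : 0 < u n by apply: lt_le_trans h; rewrite invr_gt0.
rewrite sub0r normrN gtr0_norm ?invr_gt0//.
by rewrite -[leRHS]invrK lef_pV2 ?posrE ?invr_gt0.
Qed.

(** A logarithm turns asymptotic proportionality into asymptotic equivalence. *)
Lemma ln_ratio u v (c : R) : 0 < c -> v n @[n --> \oo] --> +oo ->
  u n / v n @[n --> \oo] --> c -> ln (u n) / ln (v n) @[n --> \oo] --> (1 : R).
Proof.
move=> c0 vy uv.
have luv : ln (u n / v n) @[n --> \oo] --> ln c.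
  by apply: continuous_cvg => //; exact: continuous_ln.
have lv := cvgy_ln vy.
have lvi := cvgy_inv lv.
have h : 1 + ln (u n / v n) * (ln (v n))^-1 @[n --> \oo] --> 1 + ln c * 0.
  by apply: cvgD; [exact: cvg_cst|exact: cvgM].
rewrite mulr0 addr0 in h; apply: cvg_trans h; apply: near_eq_cvg.
have /cvgryPge/(_ 1)[m1 _ h1] := vy; have /cvgryPge/(_ 1)[m2 _ h2] := lv.
have [m3 _ h3] : \forall n \near \oo, 0 < u n / v n by exact: (cvgr_gt c uv).
exists (maxn m1 (maxn m2 m3)) => // n /=; rewrite !geq_max => /and3P[n1 n2 n3].
have v0 : 0 < v n by apply: lt_le_trans (h1 n n1).
have l0 : 0 < ln (v n) by apply: lt_le_trans (h2 n n2).
have u0 : 0 < u n by have := h3 n n3; rewrite /= pmulr_lgt0// invr_gt0.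
by rewrite ln_div ?posrE//; field; rewrite gt_eqF.
Qed.

Lemma cvgy_natr (N : nat -> nat) : (forall M, exists m, forall n, (m <= n)%N -> (M <= N n)%N) ->
  (N n)%:R @[n --> \oo] --> (+oo : set_system R).
Proof.
move=> hN; apply/cvgryPge => A; have [m hm] := hN (Num.truncn A).+1.
exists m => // n /= mn; apply: ltW; apply: lt_le_trans (real_truncnS_gt (num_real A)) _.
by rewrite ler_nat hm.
Qed.

Lemma cvgy_nat_comp (N : nat -> nat) :
  (forall M, exists m, forall n, (m <= n)%N -> (M <= N n)%N) ->
  N n @[n --> \oo] --> \oo.
Proof.
by move=> hN; apply/cvgnyPge => M; have [m hm] := hN M; exists m.
Qed.

Lemma cvgy_idn : (n%:R : R) @[n --> \oo] --> +oo.
Proof. by apply: cvgy_natr => M; exists M. Qed.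

Lemma clock_equiv : (clock n : R) / ln n%:R @[n --> \oo] --> (1 : R).
Proof.
apply/cvgrPdist_le => e e0.
have /cvgryPge/(_ (e^-1 + 1))[m _ hm] := cvgy_ln cvgy_idn.
exists m.+1 => // n /= mn; have h := hm n (ltnW mn); rewrite /= in h.
have ei : 0 < e^-1 by rewrite invr_gt0.
have l0 : 0 < ln n%:R :> R by lra.
have n0 : (0 < n)%N by exact: leq_trans mn.
have := @clock_ge R n n0; have := @clock_le R n n0 => c1 c2.
have -> : 1 - clock n / ln n%:R = (ln n%:R - clock n) / ln n%:R :> R.
  by field; rewrite gt_eqF.
rewrite normrM normfV (gtr0_norm l0) ler_pdivrMr//.
have : `|ln n%:R - clock n| <= 1 :> R by rewrite ler_norml; apply/andP; split; lra.
move=> /le_trans; apply; rewrite -ler_pdivrMl// mulr1; lra.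
Qed.

Lemma norming_equiv : (n%:R * (norming n : R) ^+ 2)^-1 @[n --> \oo] --> (1 : R).
Proof.
have h : 1 - 4^-1 * n%:R^-1 @[n --> \oo] --> (1 - 4^-1 * 0 : R).
  apply: cvgB; first exact: cvg_cst.
  by apply: cvgM; [exact: cvg_cst|exact: (cvgy_inv cvgy_idn)].
rewrite mulr0 subr0 in h; apply: (@squeeze_cvgr _ _ _ _ _ (fun=> 1) _ _ _ h); last exact: cvg_cst.
exists 1%N => // n /= n0; have n1 : 1 <= n%:R :> R by rewrite ler1n.
have a0 := @norming_gt0 R n.
have p0 : 0 < n%:R * norming n ^+ 2 :> R by rewrite mulr_gt0 ?exprn_gt0//; lra.
have := @norming_sqr_ge R n n0; have := @norming_sqr_le R n n0 => c1 c2.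
apply/andP; split.
  rewrite -[leRHS]div1r ler_pdivlMr//.
  have -> : (1 - 4^-1 / n%:R) * (n%:R * norming n ^+ 2) =
     (n%:R - 4^-1) * norming n ^+ 2 :> R by field; rewrite gt_eqF//; lra.
  rewrite -ler_pdivlMl ?mulr1//; lra.
by rewrite invf_le1//; move: c2; rewrite -div1r ler_pdivrMr ?(mulrC n%:R)//; lra.
Qed.

(** The scale of the martingale, brought back to the walk. *)
Definition walk_ratio (n : nat) : R :=
  iterlog_scale (clock n) / (norming n * Num.sqrt (critical_scale n%:R n%:R)).

(** The clock is equivalent to the logarithm, and so are their iterated
    logarithms. *)
Lemma walk_ratio_cvg : walk_ratio n @[n --> \oo] --> (1 : R).
Proof.
have l1 := cvgy_ln cvgy_idn; have l2 := cvgy_ln l1; have l3 := cvgy_ln l2.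
have c1 := clock_equiv.
have c2 := ln_ratio ltr01 l1 c1.
have c3 := ln_ratio ltr01 l2 c2.
have cc : (n%:R * (norming n : R) ^+ 2)^-1 * ((clock n : R) / ln n%:R) *
    (ln (ln (clock n)) / ln (ln (ln n%:R))) @[n --> \oo] --> (1 * 1 * 1 : R).
  by apply: cvgM c3; exact: cvgM norming_equiv c1.
rewrite !mulr1 in cc.
have : Num.sqrt ((n%:R * (norming n : R) ^+ 2)^-1 * ((clock n : R) / ln n%:R) *
    (ln (ln (clock n)) / ln (ln (ln n%:R)))) @[n --> \oo] --> (Num.sqrt 1 : R).
  by apply: continuous_cvg => //; exact: sqrt_continuous.
rewrite sqrtr1; apply: cvg_trans; apply: near_eq_cvg.
have /cvgryPge/(_ 1)[m1 _ h1] := l1; have /cvgryPge/(_ 1)[m2 _ h2] := l2.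
have /cvgryPge/(_ 1)[m3 _ h3] := l3.
exists (maxn 1 (maxn m1 (maxn m2 m3))) => // n /=.
rewrite !geq_max => /and4P[n0 n1 n2 n3].
have a0 := @norming_gt0 R n.
have L1 := h1 n n1; have L2 := h2 n n2; have L3 := h3 n n3; rewrite /= in L1 L2 L3.
have nR : 0 < n%:R :> R by rewrite ltr0n.
rewrite /walk_ratio /iterlog_scale /critical_scale.
rewrite -[norming n in RHS]gtr0_norm// -sqrtr_sqr -sqrtrM ?sqr_ge0// -sqrtrV; last first.
  by rewrite mulr_ge0 ?sqr_ge0// !mulr_ge0// ?ltW//; lra.
rewrite [RHS]mulrC -sqrtrM; last first.
  rewrite invr_ge0 mulr_ge0 ?sqr_ge0// !mulr_ge0// ?ltW//; lra.
congr Num.sqrt.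
have g1 : ln n%:R != 0 :> R by rewrite gt_eqF//; lra.
have g3 : ln (ln (ln n%:R)) != 0 :> R by rewrite gt_eqF//; lra.
by field; rewrite g1 g3 !gt_eqF.
Qed.

Lemma iterlog_scale_gt0 (b : R) : expR (expR 1) <= b -> 0 < iterlog_scale b.
Proof.
move=> hb; have b0 : 0 < b by apply: lt_le_trans hb; exact: expR_gt0.
have h1 : expR 1 <= ln b by rewrite -[leLHS]expRK ler_ln ?posrE ?expR_gt0.
have l0 : 0 < ln b by apply: lt_le_trans h1; exact: expR_gt0.
have h2 : 1 <= ln (ln b) by rewrite -[leLHS]expRK ler_ln ?posrE ?expR_gt0.
by rewrite sqrtr_gt0 !mulr_gt0// (lt_le_trans ltr01).
Qed.

Lemma clock_large (N : nat -> nat) (A : R) :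
  (forall M, exists m, forall n, (m <= n)%N -> (M <= N n)%N) ->
  exists m, forall n, (m <= n)%N -> (0 < N n)%N /\ A <= clock (N n).
Proof.
move=> hN; have [m0 h0] := ln_natr_ge (A + 1); have [m hm] := hN m0.+1.
exists m => n mn; have n0 : (0 < N n)%N by exact: leq_trans (hm n mn).
by split => //; have := h0 _ (ltnW (hm n mn)); have := @clock_ge R _ n0; lra.
Qed.

(** When [S = 0], the ratios of the logarithms are only known to be bounded, which
    is enough since the first factor vanishes. *)
Lemma critical_scale_ratio (N : nat -> nat) (beta S : R) : 0 < beta -> 0 <= S ->
  (forall n, (N n <= n)%N) ->
  (forall M, exists m, forall n, (m <= n)%N -> (M <= N n)%N) ->
  n%:R `^ (- beta) * (N n)%:R @[n --> \oo] --> S ->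
  Num.sqrt (critical_scale (N n)%:R (N n)%:R) /
  Num.sqrt (critical_scale (n%:R `^ beta) n%:R) @[n --> \oo] --> Num.sqrt (beta * S).
Proof.
move=> b0 S0 Nn hN hS.
have l1 := cvgy_ln cvgy_idn; have l2 := cvgy_ln l1; have l3 := cvgy_ln l2.
have Ny := cvgy_natr hN.
have k1 := cvgy_ln Ny; have k2 := cvgy_ln k1; have k3 := cvgy_ln k2.
pose x n : R := n%:R `^ (- beta) * (N n)%:R * (ln (N n)%:R / ln n%:R) *
  (ln (ln (ln (N n)%:R)) / ln (ln (ln n%:R))).
have /cvgryPge/(_ 1)[m1 _ h1] := l1; have /cvgryPge/(_ 1)[m2 _ h2] := l2.
have /cvgryPge/(_ 1)[m3 _ h3] := l3; have /cvgryPge/(_ 1)[p1 _ g1] := k1.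
have /cvgryPge/(_ 1)[p2 _ g2] := k2; have /cvgryPge/(_ 1)[p3 _ g3] := k3.
have [p0 g0] := hN 1%N.
pose m := maxn p0 (maxn m1 (maxn m2 (maxn m3 (maxn p1 (maxn p2 p3))))).
have big n : (m <= n)%N -> [/\ 1 <= (N n)%:R :> R, 1 <= ln (N n)%:R :> R,
    1 <= ln (ln (N n)%:R) :> R & 1 <= ln (ln (ln (N n)%:R)) :> R].
  rewrite /m !geq_max => /and5P[q0 q1 q2 q3 /and3P[q4 q5 q6]]; split.
  - by rewrite ler1n g0.
  - exact: g1.
  - exact: g2.
  - exact: g3.
have mono n : (m <= n)%N -> [/\ (N n)%:R <= n%:R :> R,
    ln (N n)%:R <= ln n%:R :> R, ln (ln (N n)%:R) <= ln (ln n%:R) :> R &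
    ln (ln (ln (N n)%:R)) <= ln (ln (ln n%:R)) :> R].
  move=> mn; have [z0 z1 z2 z3] := big n mn.
  have y0 : (N n)%:R <= n%:R :> R by rewrite ler_nat.
  have y1 : ln (N n)%:R <= ln n%:R :> R by rewrite ler_ln ?posrE//; lra.
  have y2 : ln (ln (N n)%:R) <= ln (ln n%:R) :> R by rewrite ler_ln ?posrE//; lra.
  by split => //; rewrite ler_ln ?posrE//; lra.
have xS : x n @[n --> \oo] --> beta * S.
  have [Sp|Sz] := ltP 0 S; last first.
    have -> : S = 0 by apply/eqP; rewrite eq_le Sz.
    rewrite mulr0.
    have S00 : S = 0 by apply/eqP; rewrite eq_le Sz.
    rewrite S00 in hS; apply: (squeeze_cvgr _ (cvg_cst 0) hS).
    exists m => // n /= mn; have [z0 z1 z2 z3] := big n mn.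
    have [y0 y1 y2 y3] := mono n mn.
    have w0 : 0 <= n%:R `^ (- beta) * (N n)%:R :> R by rewrite mulr_ge0 ?powR_ge0.
    have w1 : 0 <= (ln (N n)%:R / ln n%:R : R) <= 1.
      by apply/andP; split; [rewrite divr_ge0|rewrite ler_pdivrMr]; lra.
    have w2 : 0 <= (ln (ln (ln (N n)%:R)) / ln (ln (ln n%:R)) : R) <= 1.
      by apply/andP; split; [rewrite divr_ge0|rewrite ler_pdivrMr]; lra.
    rewrite /x; case/andP: w1 => w1 w1'; case/andP: w2 => w2 w2'.
    apply/andP; split; first by apply: mulr_ge0 => //; exact: mulr_ge0.
    by rewrite -[leLHS]mulrA ler_piMr// mulr_ile1.
  have vy : (n%:R `^ beta : R) @[n --> \oo] --> +oo.
    apply/cvgryPge => A; have /cvgryPge/(_ (A / beta))[j _ hj] := l1.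
    exists j.+1 => // n /= jn; have n0 : (0 < n)%N by exact: leq_trans jn.
    have := hj n (ltnW jn); rewrite /= ler_pdivrMr// => h.
    have -> : n%:R `^ beta = expR (beta * ln n%:R) :> R by rewrite /powR gt_eqF ?ltr0n.
    by apply: le_trans (expR_ge1Dx _); lra.
  have r0 : (N n)%:R / n%:R `^ beta @[n --> \oo] --> S.
    by under eq_fun do rewrite mulrC -powRN.
  have r1 := ln_ratio Sp vy r0.
  have r1' : (ln (N n)%:R : R) / ln n%:R @[n --> \oo] --> beta.
    have : beta * ((ln (N n)%:R : R) / ln (n%:R `^ beta)) @[n --> \oo] --> beta * 1.
      by apply: cvgM => //; exact: cvg_cst.
    rewrite mulr1; apply: cvg_trans; apply: near_eq_cvg.
    exists m1 => // n /= mn; have := h1 n mn; rewrite /= => ln1.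
    by rewrite ln_powR; field; rewrite !gt_eqF//; lra.
  have r2 := ln_ratio b0 l1 r1'.
  have r3 := ln_ratio ltr01 l2 r2.
  have : n%:R `^ (- beta) * (N n)%:R * (ln (N n)%:R / ln n%:R) *
      (ln (ln (ln (N n)%:R)) / ln (ln (ln n%:R))) @[n --> \oo] --> S * beta * (1 : R).
    by apply: cvgM r3; exact: cvgM.
  by rewrite mulr1 mulrC.
have : Num.sqrt (x n) @[n --> \oo] --> Num.sqrt (beta * S).
  by apply: continuous_cvg => //; exact: sqrt_continuous.
apply: cvg_trans; apply: near_eq_cvg.
exists m => // n /= mn; have [z0 z1 z2 z3] := big n mn.
have [y0 y1 y2 y3] := mono n mn.
have n0 : 0 < n%:R :> R by lra.
have pw : 0 < n%:R `^ beta :> R by exact: powR_gt0.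
have d0 : 0 < critical_scale (n%:R `^ beta) n%:R :> R.
  by rewrite /critical_scale !mulr_gt0//; lra.
rewrite -sqrtrV ?(ltW d0)// mulrC -sqrtrM ?invr_ge0 ?(ltW d0)//; congr Num.sqrt.
rewrite /x /critical_scale powRN.
by field; rewrite !gt_eqF//; lra.
Qed.

End Ratios.

(** * The law for the walk with stops *)

Section Conclusion.
Context (d : measure_display) (T : measurableType d) (R : realType).
Variables (P : probability T R) (p q r s : R).
Variables (X : nat -> {RV P >-> R}) (K : nat -> {RV P >-> nat})
  (E : nat -> {RV P >-> R}).
Hypotheses (hr : 0 < r < 1) (hpqr : p + q + r = 1)
  (hs : 0 <= s <= 1) (hX : is_ERWS p q r s X K E) (hcrit : p / (1 - r) = 3 / 4).

Lemma sign_hist_large w : (forall M, exists n, (M < size (sign_hist X n w))%N) ->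
  forall M, exists m, forall n, (m <= n)%N -> (M <= size (sign_hist X n w))%N.
Proof.
move=> unb M; have [m hm] := unb M; exists m => n mn.
by rewrite (leq_trans (ltnW hm))//; exact: signs_mono.
Qed.

(** Both halves of the law, applied to the countably many values
    [e = j.+1%:R^-1]. *)
Lemma mart_limsup_ae (sg : R) : `|sg| = 1 ->
  P.-negligible [set w | ~ has_limsup (fun n => sg * mart (sign_hist X n w) /
    iterlog_scale (clock (size (sign_hist X n w)))) 1].
Proof.
move=> sg1.
have t0 j : 0 < j.+1%:R^-1 :> R by rewrite invr_gt0.
have t1 j : j.+1%:R^-1 <= 1 :> R by rewrite invf_le1 ?ler1n.
apply: negligibleS (negligibleU (negligibleU
  (negligible_bigcup (fun j => mart_upper_ae hr hpqr hs hX hcrit (t0 j) (t1 j) sg1))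
  (negligible_bigcup (fun j => mart_lower_ae hr hpqr hs hX hcrit (t0 j) (t1 j) sg1)))
  (ones_unbounded_ae hr hpqr hs hX hcrit)).
move=> w nw /=; apply: contrapT => /not_orP[/not_orP[nU nL] nM]; apply: nw.
have unb M : exists n, (M < size (sign_hist X n w))%N.
  apply: contrapT => hM; apply: nM; exists M => n; rewrite leqNgt; apply/negP => h.
  by apply: hM; exists n.
have hN := sign_hist_large unb.
have [m0 h0] := clock_large (expR (expR 1) : R) hN.
split=> e e0.
  have e7 : 0 < e / 7 by lra.
  have [j hj] := invS_le e7.
  have [b0 hb] : exists b0 : R, forall n, (0 < n)%N ->
      b0 <= clock (size (sign_hist X n w)) -> sg * mart (sign_hist X n w) <=
      (1 + j.+1%:R^-1) ^+ 3 * iterlog_scale (clock (size (sign_hist X n w))).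
    by apply: contrapT => hb; apply: nU; exists j.
  have [m1 h1] := clock_large b0 hN.
  exists (maxn 1 (maxn m0 m1)) => n; rewrite !geq_max => /and3P[n0 n1 n2].
  have [_ c1] := h0 n n1; have [_ c2] := h1 n n2.
  have sc := iterlog_scale_gt0 c1.
  rewrite ler_pdivrMr//; apply: le_trans (hb n n0 c2) _.
  rewrite ler_wpM2r ?(ltW sc)//.
  by have := t0 j; have := t1 j; move: j.+1%:R^-1 hj => t *; nra.
move=> m; have [j hj] := invS_le e0.
have hl : forall m, exists2 n, (m <= n)%N &
    (1 - j.+1%:R^-1) * iterlog_scale (clock (size (sign_hist X n w))) <=
    sg * mart (sign_hist X n w).
  by apply: contrapT => hl; apply: nL; exists j.
have [n] := hl (maxn m m0); rewrite geq_max => /andP[mn m0n] hn.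
exists n => //; have [_ c1] := h0 n m0n; have sc := iterlog_scale_gt0 c1.
rewrite ler_pdivlMr//; apply: le_trans hn.
by rewrite ler_wpM2r ?(ltW sc)// lerD2l lerN2.
Qed.

Definition typical w :=
  [/\ forall n, atom X (hist X n w) w,
      forall M, exists n, (M < size (sign_hist X n w))%N,
      cvgn (fun n => ones_mart (1 - r) (hist X n w)) &
      oscillates (fun n => mart (sign_hist X n w) /
        iterlog_scale (clock (size (sign_hist X n w))) : R) 1].

Lemma typical_ae : P.-negligible [set w | ~ typical w].
Proof.
have n1 : `|1 : R| = 1 by rewrite normr1.
have nN1 : `|-1 : R| = 1 by rewrite normrN normr1.
have g1 := negligible_bigcup (atom_hist_negligible hpqr hX).
have g2 := ones_unbounded_ae hr hpqr hs hX hcrit.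
have g3 := ones_mart_cvg_ae hr hpqr hs hX hcrit.
apply: negligibleS (negligibleU (negligibleU g1 (negligibleU g2 g3))
  (negligibleU (mart_limsup_ae n1) (mart_limsup_ae nN1))).
move=> w nw /=; apply: contrapT => /not_orP[/not_orP[nA /not_orP[nM /contrapT cv]]].
move=> /not_orP[/contrapT l1 /contrapT l2]; apply: nw; split => //.
- by move=> n; apply: contrapT => h; apply: nA; exists n.
- move=> M; apply: contrapT => hM; apply: nM; exists M => n.
  by rewrite leqNgt; apply/negP => h; apply: hM; exists n.
- split; first by apply: (has_limsup_eq (m := 0) _ l1) => n _; rewrite mul1r.
  by apply: (has_limsup_eq (m := 0) _ l2) => n _; rewrite mulN1r mulNr.
Qed.

Section Typical.
Variable w : T.
Hypothesis hw : typical w.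
Let N n := size (sign_hist X n w).

Let hN : forall M, exists m, forall n, (m <= n)%N -> (M <= N n)%N.
Proof. by case: hw => _ unb _ _; exact: sign_hist_large. Qed.

Let posE n : position X n w = walk (sign_hist X n w).
Proof. by case: hw => ha _ _ _; exact: position_hist. Qed.

Let onesE n : number_of_ones X n w = (N n)%:R.
Proof. by case: hw => ha _ _ _; exact: number_of_ones_hist. Qed.

Let NE n : (N n <= n)%N.
Proof. by rewrite /N -{2}(size_hist X n w) size_signs. Qed.

Let scale_large : exists m, forall n, (m <= n)%N ->
  [/\ (0 < N n)%N, 0 < iterlog_scale (clock (N n) : R) &
      0 < critical_scale (N n)%:R (N n)%:R :> R].
Proof.
have [m0 h0] := clock_large (expR (expR 1) : R) hN.
have /cvgryPge/(_ 1)[m1 _ h1] := cvgy_ln (cvgy_natr hN : _ --> (+oo : set_system R)).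
have l2 := cvgy_ln (cvgy_ln (cvgy_natr hN : _ --> (+oo : set_system R))).
have /cvgryPge/(_ 1)[m2 _ h2] := cvgy_ln l2.
exists (maxn m0 (maxn m1 m2)) => n; rewrite !geq_max => /and3P[n0 n1 n2].
have [N0 c0] := h0 n n0; split => //; first exact: iterlog_scale_gt0.
rewrite /critical_scale !mulr_gt0 ?ltr0n//.
  exact: lt_le_trans (h1 n n1).
exact: lt_le_trans (h2 n n2).
Qed.

Lemma position_oscillates : oscillates (fun n => position X n w /
  Num.sqrt (critical_scale (number_of_ones X n w) (number_of_ones X n w))) 1.
Proof.
have [_ _ _ osc] := hw.
have wr : walk_ratio (N n) @[n --> \oo] --> (1 : R).
  by apply: (cvg_comp N _ (cvgy_nat_comp hN)); exact: walk_ratio_cvg.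
have [m hm] := scale_large.
apply: (oscillates_eq (m := m) _ (oscillatesM osc ler01 wr)) => n mn.
have [N0 s0 c0] := hm n mn.
rewrite posE onesE /walk_ratio -/(N n) /mart -/(N n).
have a0 := @norming_gt0 R (N n).
have c1 : 0 < Num.sqrt (critical_scale (N n)%:R (N n)%:R) :> R by rewrite sqrtr_gt0.
move: (walk _) (norming _) (iterlog_scale _) (Num.sqrt _) a0 s0 c1 => z a i c a0 i0 c1.
by field; rewrite !gt_eqF.
Qed.

Lemma scaled_ones_cvg : scaled_ones X r w n @[n --> \oo] --> ones_limit X r w.
Proof.
have [_ _ cv _] := hw.
have b01 : 0 < 1 - r <= 1.
  by case/andP: hr => r0 r1; rewrite subr_gt0 r1 gerBl ltW.
suff : cvgn (scaled_ones X r w) by [].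
apply/cvg_ex; have /cvg_ex[l1 h1] := cv; have /cvg_ex[l2 h2] := norm_ratio_cvg b01.
exists (l1 * l2); rewrite -cvg_shiftS.
rewrite -cvg_shiftS in h1.
apply: cvg_trans (cvgM h1 h2); apply: near_eq_cvg; apply: nearW => n.
rewrite /mk_sequence /scaled_ones onesE /norm_ratio /ones_mart.
have -> : n.+1%:R `^ (- (1 - r)) = expR (- ((1 - r) * ln n.+1%:R)) :> R.
  by rewrite /powR gt_eqF ?ltr0n// mulNr.
rewrite -[LHS]/(ones_of (hist X n.+1 w) / ones_norm (1 - r) (size (hist X n.+1 w)) *
  (ones_norm (1 - r) n.+1 * expR (- ((1 - r) * ln n.+1%:R)))) size_hist.
have := ones_norm_gt0 b01 n.+1; rewrite -/(N n.+1) /ones_of -/(N n.+1).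
move: (ones_norm _ _) (expR _) (N _)%:R => b e z b0.
by field; rewrite gt_eqF.
Qed.

Lemma ones_limit_ge0 : 0 <= ones_limit X r w.
Proof.
have h := scaled_ones_cvg; rewrite /ones_limit; apply: limr_ge; first exact: cvgP h.
by apply: nearW => n; rewrite /scaled_ones onesE mulr_ge0 ?powR_ge0.
Qed.

Lemma position_oscillates_time : oscillates (fun n => position X n w /
  Num.sqrt (critical_scale (n%:R `^ (1 - r)) n%:R))
  (Num.sqrt ((1 - r) * ones_limit X r w)).
Proof.
have b0 : 0 < 1 - r by case/andP: hr => _ r1; rewrite subr_gt0.
have hS : n%:R `^ (- (1 - r)) * (N n)%:R @[n --> \oo] --> ones_limit X r w.
  apply: cvg_trans scaled_ones_cvg; apply: near_eq_cvg; apply: nearW => n.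
  by rewrite /scaled_ones onesE.
have cr := critical_scale_ratio b0 ones_limit_ge0 NE hN hS.
have [m hm] := scale_large.
apply: (oscillates_eq (m := m) _ (oscillatesM position_oscillates (sqrtr_ge0 _) cr)).
move=> n mn; have [_ _ c0] := hm n mn; rewrite onesE.
rewrite mulrA divfK// gt_eqF// sqrtr_gt0//.
Qed.

Lemma critical_scale_ones_ge0 : exists m, forall n, (m <= n)%N ->
  0 <= critical_scale (number_of_ones X n w) (number_of_ones X n w).
Proof.
by have [m hm] := scale_large; exists m => n /hm[_ _ h]; rewrite onesE ltW.
Qed.

Lemma critical_scale_time_ge0 : exists m, forall n, (m <= n)%N ->
  0 <= critical_scale (n%:R `^ (1 - r)) n%:R :> R.
Proof.
have hid M : exists m, forall n, (m <= n)%N -> (M <= n)%N by exists M.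
have l1 := cvgy_ln (cvgy_natr hid : _ --> (+oo : set_system R)).
have /cvgryPge/(_ 0)[m1 _ h1] := l1.
have /cvgryPge/(_ 0)[m2 _ h2] := cvgy_ln (cvgy_ln l1).
exists (maxn m1 m2) => n; rewrite geq_max => /andP[n1 n2].
by rewrite /critical_scale !mulr_ge0 ?powR_ge0//; [exact: h1|exact: h2].
Qed.

End Typical.

End Conclusion.

Theorem theorem3p5 (d : measure_display) (T : measurableType d) (R : realType)
    (P : probability T R) (p q r s : R)
    (X : nat -> {RV P >-> R}) (K : nat -> {RV P >-> nat})
    (E : nat -> {RV P >-> R})
    (hp : 0 <= p <= 1) (hq : 0 <= q <= 1) (hr : 0 < r < 1)
    (hpqr : p + q + r = 1) (hs : 0 <= s <= 1)
    (hX : is_ERWS p q r s X K E)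
    (hcrit : p / (1 - r) = 3 / 4) :
  let S := position X in
  let ones := number_of_ones X in
  let Sigma := ones_limit X r in
  [/\ {ae P, forall w,
        limn_esup (fun n => (S n w /
          Num.sqrt (critical_scale (ones n w) (ones n w)))%:E) = 1%:E /\
        (- limn_einf (fun n => (S n w /
          Num.sqrt (critical_scale (ones n w) (ones n w)))%:E))%E = 1%:E},
      {ae P, forall w,
        limn_esup (fun n => (S n w ^+ 2 /
          critical_scale (ones n w) (ones n w))%:E) = 1%:E},
      {ae P, forall w, scaled_ones X r w n @[n --> \oo] --> Sigma w},
      {ae P, forall w,
        limn_esup (fun n => (S n w /
          Num.sqrt (critical_scale (n%:R `^ (1 - r)) n%:R))%:E)
          = (Num.sqrt ((1 - r) * Sigma w))%:E /\
        (- limn_einf (fun n => (S n w /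
          Num.sqrt (critical_scale (n%:R `^ (1 - r)) n%:R))%:E))%E
          = (Num.sqrt ((1 - r) * Sigma w))%:E} &
      {ae P, forall w,
        limn_esup (fun n => (S n w ^+ 2 /
          critical_scale (n%:R `^ (1 - r)) n%:R)%:E)
          = ((1 - r) * Sigma w)%:E}].
Proof.
move=> S ones Sigma.
have ae (Q : T -> Prop) : (forall w, typical r X w -> Q w) -> {ae P, forall w, Q w}.
  move=> tQ; apply: negligibleS (typical_ae hr hpqr hs hX hcrit) => w /= nQ tw.
  by apply: nQ; exact: tQ.
split; apply: ae => w hw.
- have [up low] := position_oscillates hw.
  by split; [exact: limn_esup_EFin|exact: limn_einf_EFin].
- have := oscillates_sqr ler01 (critical_scale_ones_ge0 hw) (position_oscillates hw).
  by rewrite expr1n.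
- exact: scaled_ones_cvg.
- have [up low] := position_oscillates_time hr hw.
  by split; [exact: limn_esup_EFin|exact: limn_einf_EFin].
- have := oscillates_sqr (sqrtr_ge0 _) (critical_scale_time_ge0 r)
    (position_oscillates_time hr hw).
  rewrite sqr_sqrtr// mulr_ge0 ?(ones_limit_ge0 hr hw)//.
  by case/andP: hr => _ r1; rewrite subr_ge0 ltW.
Qed.
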